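(* Let $L\in(0,\infty]$ and let $\|\cdot\|_{X(0,L)}$ be a rearrangement-invariant function norm on $(0,L)$. Let $\nu\colon(0,L)\to(0,L)$ be an increasing bijection; if $L=\infty$, assume that $\nu^{-1}\in\underline{D}^{\infty}$. Let $u,v\colon(0,L)\to(0,\infty)$ be nonincreasing; if $L<\infty$, assume that $v(L^-)>0$. Consider the following condition (A): (A) if $L<\infty$: the function $t\mapsto u(t)\int_{\nu^{-1}(t)}^Lv(s)\,ds$ belongs to $X'(0,L)$; if $L=\infty$: the function $t\mapsto u(t)\chi_{(0,\nu(1))}(t)\int_{\nu^{-1}(t)}^1v(s)\,ds$ belongs to $X'(0,\infty)$ and $\limsup_{\tau\to\infty}v(\tau)\|u\chi_{(0,\nu(\tau))}\|_{X'(0,\infty)}<\infty$. Assume that (A) is satisfied. Let $\|\cdot\|_{Y(0,L)}$ be the rearrangement-invariant function norm whose associate function norm $\|\cdot\|_{Y'(0,L)}$ is defined as $$\|f\|_{Y'(0,L)}=\sup_{h\sim f}\Big\|u(t)\int_{\nu^{-1}(t)}^L h(s)v(s)\,ds\Big\|_{X'(0,L)},\quad f\in\mathfrak{M}^+(0,L),$$ where the supremum extends over all $h\in\mathfrak{M}^+(0,L)$ equimeasurable with $f$. Then the rearrangement-invariant function space $Y(0,L)$ is the optimal target space for the operator $R_{u,v,\nu}$ and $X(0,L)$. Moreover, if (A) is not satisfied, then there is no rearrangement-invariant function space $Z(0,L)$ such that $R_{u,v,\nu}\colon X(0,L)\to Z(0,L)$ is bounded.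
   Context: Conventions: $\frac1\infty=0\cdot\infty=0$. $\mathfrak{M}(0,L)$ is the set of (Lebesgue) measurable functions on $(0,L)$ with values in $[-\infty,\infty]$, and $\mathfrak{M}^+(0,L)$ is the subset of those that are nonnegative a.e. Functions $f,g$ are equimeasurable, $f\sim g$, if $|\{|f|>\lambda\}|=|\{|g|>\lambda\}|$ for every $\lambda\in(0,\infty)$. A rearrangement-invariant function norm on $(0,L)$ is a functional $\|\cdot\|_{X(0,L)}\colon\mathfrak{M}^+(0,L)\to[0,\infty]$ such that, for all $f,g,f_k\in\mathfrak M^+(0,L)$ and $\lambda\in[0,\infty)$: (P1) $\|f\|=0$ iff $f=0$ a.e., $\|\lambda f\|=\lambda\|f\|$, $\|f+g\|\le\|f\|+\|g\|$; (P2) $f\le g$ a.e. implies $\|f\|\le\|g\|$; (P3) $f_k\nearrow f$ a.e. implies $\|f_k\|\nearrow\|f\|$; (P4) $\|\chi_E\|<\infty$ for every measurable $E$ of finite measure; (P5) for every measurable $E$ of finite measure there is a finite constant $C_E>0$ with $\int_E f\le C_E\|f\|$ for all $f$; (P6) $\|f\|=\|g\|$ whenever $f\sim g$. It is extended to $\mathfrak M(0,L)$ by $\|f\|=\|\,|f|\,\|$, and $X(0,L)=\{f\in\mathfrak M(0,L):\|f\|_{X(0,L)}<\infty\}$ is the induced rearrangement-invariant function space. The associate function norm is $\|f\|_{X'(0,L)}=\sup\{\int_0^Lf(t)g(t)\,dt: g\in\mathfrak M^+(0,L),\|g\|_{X(0,L)}\le1\}$, $f\in\mathfrak M^+(0,L)$;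 it is again a rearrangement-invariant function norm and $(X')'=X$ with equality of norms, so a rearrangement-invariant function norm is uniquely determined by its associate norm. $X(0,L)\hookrightarrow Y(0,L)$ means that there is $C>0$ with $\|f\|_{Y(0,L)}\le C\|f\|_{X(0,L)}$ for all $f\in\mathfrak M(0,L)$. $v(L^-)$ is the left limit at $L$. For an increasing bijection $\mu$ of $(0,\infty)$ onto itself, $\mu\in\underline{D}^\infty$ means that there is $\theta>1$ with $\liminf_{t\to\infty}\frac{\mu(\theta t)}{\mu(t)}>1$. The operator is $R_{u,v,\nu}g(t)=v(t)\int_0^{\nu(t)}|g(s)|u(s)\,ds$, $t\in(0,L)$, $g\in\mathfrak M(0,L)$. An operator $T$ is bounded from $X(0,L)$ to $Y(0,L)$ if $\|Tf\|_{Y(0,L)}\le C\|f\|_{X(0,L)}$ for some $C$ and all $f$. A rearrangement-invariant function space $Y(0,L)$ is the optimal target space for $T$ and $X(0,L)$ if $T\colon X(0,L)\to Y(0,L)$ is bounded and $Y(0,L)\hookrightarrow Z(0,L)$ whenever $Z(0,L)$ is a rearrangement-invariant function space such that $T\colon X(0,L)\to Z(0,L)$ is bounded. *)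

(* Defs.v *)
From HB Require Import structures.
From mathcomp Require Import all_boot all_order all_algebra.
From mathcomp Require Import all_classical all_reals all_analysis.
From mathcomp Require Import measurable_realfun.
Import Order.TTheory GRing.Theory Num.Theory.
Import numFieldNormedType.Exports.
Set Implicit Arguments.
Unset Strict Implicit.
Unset Printing Implicit Defensive.

Local Open Scope classical_set_scope.
Local Open Scope ring_scope.
Local Open Scope ereal_scope.

(* The type R with the sigma-algebra of Lebesgue measurable sets, i.e. the
   domain of completed_lebesgue_measure; the carrier is convertible to R. *)
Notation lebesgueType R := (caratheodory_type (@wlength R idfun)^*%mu).

Notation leb := (@completed_lebesgue_measure _).

(* The open interval (a, b), whose right endpoint may be infinite. *)
Definition oitv {R : realType} (a : R) (b : \bar R) : set R :=
  [set x | (a < x)%R /\ x%:E < b].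

(* A function on (0, L) is represented by a total function on R, of which only
   the restriction to (0, L) matters: measurability, a.e. statements, integrals
   and distribution functions below are all relative to (0, L). *)
Section function_norms.
Context {R : realType} (L : \bar R).
Implicit Types (f g h : R -> \bar R) (N : (R -> \bar R) -> \bar R).

Definition aeL (P : R -> Prop) : Prop :=
  {ae leb, forall x : lebesgueType R, oitv 0%R L x -> P x}.

Definition meas f : Prop :=
  measurable_fun (oitv 0%R L : set (lebesgueType R)) f.

Definition measplus f : Prop := meas f /\ aeL (fun x => 0 <= f x).

Definition equimeasurable f g : Prop :=
  forall lambda : R, (0 < lambda)%R ->
    leb [set x | oitv 0%R L x /\ lambda%:E < `|f x|] =
    leb [set x | oitv 0%R L x /\ lambda%:E < `|g x|].

(* N is only meaningful on measplus; its values elsewhere are arbitrary. *)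
Record ri_norm N : Prop := RiNorm {
  ri_ge0 : forall f, measplus f -> 0 <= N f ;
  ri_eq0 : forall f, measplus f -> N f = 0 <-> aeL (fun x => f x = 0) ;
  ri_scale : forall (lambda : R) f, (0 <= lambda)%R -> measplus f ->
    N (fun x => lambda%:E * f x) = lambda%:E * N f ;
  ri_triangle : forall f g, measplus f -> measplus g ->
    N (fun x => f x + g x) <= N f + N g ;
  ri_mono : forall f g, measplus f -> measplus g ->
    aeL (fun x => f x <= g x) -> N f <= N g ;
  ri_fatou : forall (fk : nat -> R -> \bar R) f,
    (forall k, measplus (fk k)) -> measplus f ->
    aeL (fun x => nondecreasing_seq (fk ^~ x) /\
                  fk k x @[k --> \oo] --> f x) ->
    nondecreasing_seq (fun k => N (fk k)) /\ N (fk k) @[k --> \oo] --> N f ;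
  ri_fin : forall E : set (lebesgueType R),
    measurable E -> E `<=` oitv 0%R L -> leb E < +oo ->
    N (fun x => (\1_E x)%:E) < +oo ;
  ri_int : forall E : set (lebesgueType R),
    measurable E -> E `<=` oitv 0%R L -> leb E < +oo ->
    exists2 C : R, (0 < C)%R &
      forall f, measplus f -> \int[leb]_(x in E) f x <= C%:E * N f ;
  ri_equi : forall f g, measplus f -> measplus g ->
    equimeasurable f g -> N f = N g
}.

(* The extension of a norm from measplus to meas. *)
Definition ext_norm N f : \bar R := N (fun x => `|f x|).

Definition in_space N f : Prop := meas f /\ ext_norm N f < +oo.

Definition associate N f : \bar R :=
  ereal_sup [set \int[leb]_(t in oitv 0%R L) (f t * g t) |
              g in [set g | measplus g /\ N g <= 1]].

Definition embeds N1 N2 : Prop :=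
  exists2 C : R, (0 < C)%R &
    forall f, meas f -> ext_norm N2 f <= C%:E * ext_norm N1 f.

Definition bounded_op (T : (R -> \bar R) -> (R -> \bar R)) N1 N2 : Prop :=
  exists C : R, forall f, meas f -> ext_norm N2 (T f) <= C%:E * ext_norm N1 f.

Definition optimal_target (T : (R -> \bar R) -> (R -> \bar R)) NX NY : Prop :=
  [/\ ri_norm NY, bounded_op T NX NY &
      forall NZ, ri_norm NZ -> bounded_op T NX NZ -> embeds NY NZ].

End function_norms.

Section hardy_operators.
Context {R : realType} (L : \bar R).
Implicit Types (nu u v : R -> R) (f g h : R -> \bar R).
Implicit Types (NX : (R -> \bar R) -> \bar R).

Definition invL nu : R -> R := 'pinv_(fun=> 0%R) (oitv 0%R L) nu.

Definition lowerDinfty (m : R -> R) : Prop :=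
  exists2 theta : R, (1 < theta)%R &
    1 < limf_einf (fun t : R => (m (theta * t) / m t)%:E) (pinfty_nbhs R).

Definition hardyR u v nu g (t : R) : \bar R :=
  (v t)%:E * \int[leb]_(s in oitv 0%R (nu t)%:E) (`|g s| * (u s)%:E).

Definition hardyH u v nu h (t : R) : \bar R :=
  (u t)%:E * \int[leb]_(s in oitv (invL nu t) L) (h s * (v s)%:E).

Definition condA NX u v nu : Prop :=
  (L < +oo ->
    in_space L (associate L NX)
      (fun t => (u t)%:E * \int[leb]_(s in oitv (invL nu t) L) (v s)%:E)) /\
  (L = +oo ->
    in_space L (associate L NX)
      (fun t => (u t)%:E * (\1_(oitv 0%R (nu 1%R)%:E) t)%:E *
                \int[leb]_(s in oitv (invL nu t) 1) (v s)%:E) /\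
    limf_esup (fun tau : R => (v tau)%:E *
        ext_norm (associate L NX)
          (fun t => (u t)%:E * (\1_(oitv 0%R (nu tau)%:E) t)%:E))
      (pinfty_nbhs R) < +oo).

(* The functional that defines the associate norm of the optimal target. *)
Definition hardyY' NX u v nu f : \bar R :=
  ereal_sup [set ext_norm (associate L NX) (hardyH u v nu h) |
              h in [set h | measplus L h /\ equimeasurable L h f]].

End hardy_operators.

(* Main.v *)
(** By Tonelli, hardyH is the dual of hardyR, so that hardyY' f is the supremum
    of the integrals of h * k over all h equimeasurable with f and all k in the
    image S0 of the unit ball of X under hardyR.  On the non-atomic space (0, L)
    rearranging h instead of k gives the same supremum, so hardyY' is the polar
    of a rearrangement-closed set.  It is therefore an associate norm that
    coincides with its second associate, and by the Lorentz-Luxemburg theorem a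
    norm on (0, L) is bounded on S0 exactly when it is dominated by the optimal
    one.  Conversely a bounded target controls the integrals of the functions of
    S0 over sets of finite measure.  This is condition (A), except for its limsup
    part, where the growth of the inverse of nu yields nu t <= n * nu (t / c) for
    some n and c > 1. *)

Require Import Defs.
From HB Require Import structures.
From mathcomp Require Import all_boot all_order all_algebra.
From mathcomp Require Import all_classical all_reals all_analysis.
From mathcomp Require Import measurable_realfun.
From mathcomp Require Import ring lra.
Import Order.TTheory GRing.Theory Num.Theory.
Import numFieldNormedType.Exports.

Set Implicit Arguments.
Unset Strict Implicit.
Unset Printing Implicit Defensive.

Local Open Scope classical_set_scope.
Local Open Scope ring_scope.

(** * Staircase approximation and level sets *)

(** Suprema over rearrangements are never assumed to be attained: each exchange between [h] and [k]
    starts from a strict inequality [a < ...] and may lose an arbitrarily small amount. A finite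
    staircase of level sets is then enough, and [k] can be moved piece by piece into sets of
    prescribed measure, without a measure-preserving map of the whole interval.

    The second associate theorem needs a functional that separates a function from the unit ball.
    For a bounded function supported on a set of finite measure it comes from a projection in L^2,
    and (P3) reduces the general case to this one.

    In the limsup part of (A), a bounded target controls only averages over intervals of fixed
    length, hence v(t) times the norm of u on (0, nu(s)) when s + 1 <= t. The growth of the inverse
    of nu bridges the gap between nu(s) and nu(t): since u is nonincreasing, its associate norm on
    (0, n r) is at most n times that on (0, r). *)

Section layers.
Local Open Scope ereal_scope.
Context {R : realType}.

(* y rounded down to a multiple of c, capped at N * c (one step lower when y is
   itself such a multiple). *)
Definition layers (c : R) (N : nat) (y : \bar R) : R :=
  (\sum_(j < N) c * ((j.+1%:R * c)%:E < y)%E%:R)%R.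

Lemma layers_ge0 c N y : (0 <= c)%R -> (0 <= layers c N y)%R.
Proof. by move=> c0; apply: sumr_ge0 => j _; rewrite mulr_ge0. Qed.

Lemma layers_bounds (c : R) N (y : R) : (0 < c)%R -> (0 <= y)%R ->
  (layers c N y%:E <= y)%R /\
  (layers c N y%:E = (N%:R * c)%R \/ (y <= layers c N y%:E + c)%R).
Proof.
move=> c0 y0; rewrite /layers; elim: N => [|N [IH1 IH2]].
  by rewrite big_ord0 mul0r; split; [|left].
rewrite big_ord_recr/= lte_fin; case: ltP => [lt_y|le_y] /=.
- rewrite mulr1.
  have le1 : (\sum_(j < N) c * ((j.+1%:R * c)%:E < y%:E)%E%:R <= N%:R * c)%R.
    rewrite (_ : (N%:R * c = \sum_(j < N) c)%R); last first.
      by rewrite sumr_const card_ord mulr_natl.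
    by apply: ler_sum => j _; case: (_ < _)%E; rewrite ?mulr1 ?mulr0// ltW.
  move: lt_y; rewrite -natr1 => lt_y; split; first by nra.
  by case: IH2 => H; [left; rewrite H; ring|right; lra].
- rewrite mulr0 addr0; split => //; right.
  by case: IH2 => // ->; move: le_y; rewrite -natr1; lra.
Qed.

Lemma layers_le (c : R) N (y : \bar R) : (0 < c)%R -> 0 <= y -> (layers c N y)%:E <= y.
Proof.
move=> c0; case: y => [y||]// y0; last by rewrite leey.
by rewrite !lee_fin in y0 *; exact: (layers_bounds N c0 y0).1.
Qed.

Lemma layers_pinfty c N : layers c N +oo = (N%:R * c)%R.
Proof.
rewrite /layers (eq_bigr (fun=> c)) => [|j _]; last by rewrite ltry mulr1.
by rewrite sumr_const card_ord mulr_natl.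
Qed.

Lemma layers_le_max (c : R) N (y : \bar R) : (0 <= c)%R -> (layers c N y <= N%:R * c)%R.
Proof.
move=> c0; rewrite -(layers_pinfty c N); apply: ler_sum => j _.
by rewrite ler_wpM2l// ltry; case: (_ < _).
Qed.

(** The step 1/(n+1) tends to 0 while the cap (n+1)^2/(n+1) = n+1 tends to infinity, so finite and
    infinite values of y are both reached. *)
Lemma cvg_layers (y : \bar R) : 0 <= y ->
  (layers n.+1%:R^-1 (n.+1 * n.+1) y)%:E @[n --> \oo] --> y.
Proof.
have H n : ((n.+1 * n.+1)%:R * n.+1%:R^-1 = n.+1%:R :> R)%R.
  by rewrite natrM mulfK.
case: y => [y||]// y0; last first.
  under eq_fun do rewrite layers_pinfty H.
  by apply/cvgeryP; rewrite (cvg_shiftS (fun n => n%:R : R)); exact: cvgr_idn.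
apply: cvg_EFin; first by apply: nearW.
apply: (@squeeze_cvgr _ _ _ _ (fun n => y - n.+1%:R^-1)%R (cst y)); last 2 first.
- by rewrite -[X in _ --> X]subr0; apply: cvgB; [exact: cvg_cst|exact: cvg_harmonic].
- exact: cvg_cst.
have [m ym] : exists m, (y < m%:R)%R by exists (Num.bound y); apply: archi_boundP.
exists m => // n /= mn.
have c0 : (0 < n.+1%:R^-1 :> R)%R by rewrite invr_gt0.
have [h1 h2] := @layers_bounds _ (n.+1 * n.+1) y c0 y0.
rewrite h1 andbT; case: h2 => [->|]; last by rewrite lerBlDr.
rewrite H lerBlDr (le_trans (ltW ym))// (@le_trans _ _ n.+1%:R)%R ?lerDl ?ltW//.
by rewrite ltr_nat ltnS.
Qed.

Context d (T : measurableType d) (mu : {measure set T -> \bar R}).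
Variables (A : set T) (mA : measurable A) (h w : T -> \bar R).
Hypotheses (mh : measurable_fun A h) (h0 : forall x, A x -> 0 <= h x).
Hypotheses (mw : measurable_fun A w) (w0 : forall x, A x -> 0 <= w x).

Let mlev y : measurable (A `&` [set x | y < h x]).
Proof. exact: emeasurable_fun_o_infty. Qed.

Lemma measurable_layers (c : R) N : measurable_fun A (fun x => layers c N (h x)).
Proof.
pose lev (j : nat) := A `&` [set x | (j.+1%:R * c)%:E < h x].
apply: (eq_measurable_fun (fun x => \sum_(j < N) c * \1_(lev j) x)%R).
  move=> x Ax; apply: eq_bigr => j _.
  by rewrite indicE in_setI Ax/= mem_setE.
apply: measurable_sum => j; apply: measurable_funM => //.
by apply: measurable_indic; exact: mlev.
Qed.

Let mlayersM (c : R) N : measurable_fun A (fun x => (layers c N (h x))%:E * w x).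
Proof.
by apply: emeasurable_funM => //; apply/measurable_EFinP; exact: measurable_layers.
Qed.

Lemma integral_layers (c : R) N : (0 <= c)%R ->
  \int[mu]_(x in A) ((layers c N (h x))%:E * w x) =
  \sum_(j < N) c%:E * \int[mu]_(x in A `&` [set x | (j.+1%:R * c)%:E < h x]) w x.
Proof.
move=> c0; pose lev (j : nat) := A `&` [set x | (j.+1%:R * c)%:E < h x].
have mI j : measurable_fun A (fun x => (\1_(lev j) x)%:E * w x).
  by apply: emeasurable_funM => //; apply/measurable_EFinP;
  apply: measurable_indic; exact: mlev.
transitivity (\int[mu]_(x in A) \sum_(j < N) c%:E * ((\1_(lev j) x)%:E * w x)).
  apply: eq_integral => x /set_mem Ax.
  rewrite /layers -sumEFin ge0_sume_distrl; last first.
    by move=> j _; rewrite lee_fin mulr_ge0.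
  apply: eq_bigr => j _; rewrite EFinM -muleA indicE in_setI (mem_set Ax)/=.
  by rewrite mem_setE.
rewrite ge0_integral_sum//; last 2 first.
- by move=> j; exact: measurable_funeM.
- by move=> j x Ax; rewrite mule_ge0 ?lee_fin// mule_ge0 ?lee_fin ?w0.
apply: eq_bigr => j _; rewrite ge0_integralZl_EFin//; last first.
  by move=> x Ax; rewrite mule_ge0 ?lee_fin ?w0.
congr (_ * _); rewrite -/(lev j).
have {2}-> : lev j = A `&` lev j by rewrite setIA setIid.
rewrite integral_mkcondr.
by apply: eq_integral => x _; rewrite epatch_indic muleC.
Qed.

Lemma le_sum_layers (c : R) N : (0 < c)%R ->
  \sum_(j < N) c%:E * \int[mu]_(x in A `&` [set x | (j.+1%:R * c)%:E < h x]) w x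
  <= \int[mu]_(x in A) (h x * w x).
Proof.
move=> c0; rewrite -integral_layers; last exact: ltW.
apply: ge0_le_integral => //.
- by move=> x Ax; rewrite mule_ge0 ?lee_fin ?layers_ge0 ?w0// ltW.
- exact: emeasurable_funM.
- by move=> x Ax; rewrite lee_wpmul2r ?w0// layers_le ?h0.
Qed.

(** Staircases with steps 1/(n+1) are not monotone in n, so Fatou's lemma takes the place of
    monotone convergence; it needs only their pointwise limit. *)
Lemma lt_sum_layers (a : \bar R) : a < \int[mu]_(x in A) (h x * w x) ->
  exists (c : R) N, (0 < c)%R /\
  a < \sum_(j < N) c%:E *
        \int[mu]_(x in A `&` [set x | (j.+1%:R * c)%:E < h x]) w x.
Proof.
move=> a_lt; apply: contrapT => /forallNP H.
suff : \int[mu]_(x in A) (h x * w x) <= a by rewrite leNgt a_lt.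
pose F n x := (layers n.+1%:R^-1 (n.+1 * n.+1) (h x))%:E * w x.
have F0 n x : A x -> 0 <= F n x.
  by move=> Ax; rewrite mule_ge0 ?lee_fin ?layers_ge0 ?w0.
have mF n : measurable_fun A (F n) by exact: mlayersM.
rewrite (_ : \int[mu]_(x in A) _ = \int[mu]_(x in A) limn_einf (F ^~ x)); last first.
  apply: eq_integral => x /set_mem Ax; apply/esym.
  suff /cvg_limn_einf_sup[->//] : F ^~ x @ \oo --> h x * w x.
  (* Multiplication is not continuous at 0 * +oo. Zeros of w and of h are treated apart; there all
     the staircase products vanish as well. *)
  have [wx0|wx0] := eqVneq (w x) 0.
    by under eq_fun do rewrite /F wx0 mule0; rewrite wx0 mule0; exact: cvg_cst.
  have [hx0|hx0] := eqVneq (h x) 0.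
    have H0 n : F n x = 0.
      apply/eqP; rewrite eq_le F0// andbT /F hx0 -[leRHS](mul0e (w x)).
      by rewrite lee_wpmul2r ?w0// layers_le.
    by under eq_fun do rewrite H0; rewrite hx0 mul0e; exact: cvg_cst.
  apply: cvgeM; [|exact: cvg_layers (h0 Ax)|exact: cvg_cst].
  by rewrite mule_defE (negbTE hx0) (negbTE wx0).
apply: (le_trans (fatou mu mA mF F0)).
rewrite limn_einf_lim; apply: lime_le.
  by apply: ereal_nondecreasing_is_cvgn; exact: nondecreasing_einfs.
apply: nearW => n; apply: (@le_trans _ _ (\int[mu]_(x in A) F n x)).
  by apply: ereal_inf_lbound; exists n => /=.
rewrite integral_layers// leNgt; apply/negP => lt_a.
by apply: (H n.+1%:R^-1%R); exists (n.+1 * n.+1)%N; split => //; rewrite invr_gt0.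
Qed.
End layers.

(** * Subsets of prescribed Lebesgue measure *)

Section lebesgue.
Local Open Scope ereal_scope.
Context {R : realType}.
Notation T := (lebesgueType R).
Implicit Types (A B G : set T) (k f g h : T -> \bar R).

Lemma borel_lebesgue (A : set (measurableTypeR R)) :
  measurable A -> measurable (A : set T).
Proof. exact: sub_caratheodory. Qed.

Lemma measurable_oitv (a : R) (b : \bar R) : measurable (oitv a b : set T).
Proof.
apply: borel_lebesgue; apply: is_interval_measurable => x y [ax xb] [ay yb] z /andP[xz zy].
by split; [exact: lt_le_trans xz|apply: le_lt_trans yb; rewrite lee_fin].
Qed.

Lemma leb_itvco (a b : R) : (a <= b)%R -> leb (`[a, b[%classic : set T) = (b - a)%:E.
Proof.
move=> ab; rewrite [LHS](lebesgue_measure_itv `[a, b[)/= lte_fin.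
by case: ltP => // ba; rewrite (@le_anti _ _ a b) ?subrr// ab.
Qed.

Lemma leb_oitv (a b : R) : (a <= b)%R -> leb (oitv a b%:E : set T) = (b - a)%:E.
Proof.
move=> ab; have -> : oitv a b%:E = `]a, b[%classic :> set R.
  by apply/seteqP; split=> x; rewrite /oitv /= in_itv/= lte_fin => /andP.
rewrite [LHS](lebesgue_measure_itv `]a, b[)/= lte_fin.
by case: ltP => // ba; rewrite (@le_anti _ _ a b) ?subrr// ab.
Qed.

Lemma leb_oitv_fin (A : set T) (b : R) : measurable A ->
  A `<=` oitv 0%R b%:E -> leb A < +oo.
Proof.
move=> mA Ab; have [b0|b0] := leP 0%R b.
  apply: (@le_lt_trans _ _ (leb (oitv 0%R b%:E : set T))).
    by apply: le_measure => //; rewrite inE//; exact: measurable_oitv.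
  by rewrite leb_oitv// ltry.
rewrite (_ : A = set0) ?measure0//; apply/seteqP; split => // x /Ab[/= x0].
by rewrite lte_fin => xb; have := lt_trans x0 (lt_trans xb b0); rewrite ltxx.
Qed.

(** The primitive of the indicator of G. It is 1-Lipschitz, so it takes all intermediate values,
    which is how the absence of atoms enters. *)
Definition cum G (x : R) : R := fine (leb (G `&` oitv 0%R x%:E)).

Section cum.
Variables (G : set T) (mG : measurable G) (G0 : G `<=` oitv 0%R +oo).

Let mGI x : measurable (G `&` oitv 0%R x : set T).
Proof. by apply: measurableI => //; exact: measurable_oitv. Qed.

Lemma cumE x : (cum G x)%:E = leb (G `&` oitv 0%R x%:E).
Proof.
rewrite fineK// ge0_fin_numE//; apply: (@leb_oitv_fin _ x); first exact: mGI.
exact: subIsetr.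
Qed.

Lemma cum_ge0 x : (0 <= cum G x)%R.
Proof. by rewrite fine_ge0. Qed.

Lemma cum_le0 x : (x <= 0)%R -> cum G x = 0%R.
Proof.
move=> x0; rewrite /cum (_ : _ `&` _ = set0) ?measure0//.
apply/seteqP; split => // y [_ [/= y0]]; rewrite lte_fin => yx.
by have := lt_le_trans (lt_trans y0 yx) x0; rewrite ltxx.
Qed.

Lemma le_cum x y : (x <= y)%R -> (cum G x <= cum G y)%R.
Proof.
move=> xy; rewrite -lee_fin !cumE; apply: le_measure; rewrite ?inE; [exact: mGI..|].
apply: setIS => z [? zx]; split => //; apply: (lt_le_trans zx).
by rewrite lee_fin.
Qed.

Lemma cum_lip x y : (x <= y)%R -> (cum G y <= cum G x + (y - x))%R.
Proof.
move=> xy; rewrite -lee_fin EFinD !cumE -leb_itvco//.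
have mi : measurable (`[x, y[%classic : set T) by exact: borel_lebesgue.
apply: (le_trans _ (measureU2 _ (mGI _) mi)).
apply: le_measure; rewrite ?inE; [exact: mGI|by apply: measurableU => //; exact: mGI|].
move=> z [Gz [z0 zy]]; have [zx|xz] := ltP z x; [left|right].
  by split => //; split => //; rewrite lte_fin.
by rewrite /= in_itv/= xz -lte_fin.
Qed.

Lemma continuous_cum : continuous (cum G).
Proof.
move=> x; apply/cvgrPdist_le => e e0; near=> y.
have : (`|x - y| <= e)%R.
  by near: y; exact: (@cvgr_dist_le _ _ _ _ _ id x (@cvg_id _ _)).
apply: le_trans; have [xy|yx] := leP x y.
  rewrite distrC (distrC x) !ger0_norm ?subr_ge0 ?le_cum//.
  by rewrite lerBlDl cum_lip.
have yx' := ltW yx; rewrite !ger0_norm ?subr_ge0 ?le_cum//.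
by rewrite lerBlDl cum_lip.
Unshelve. all: by end_near. Qed.

Lemma lt_leb_cum (c : \bar R) : c < leb G -> exists y : R, c < (cum G y)%:E.
Proof.
move=> cG.
pose F n := G `&` oitv 0%R n%:R%:E : set T.
have cvF : leb (F n) @[n --> \oo] --> leb G.
  have -> : G = \bigcup_n F n.
    apply/seteqP; split => [x Gx|x [n _ []//]].
    have [x0 _] := G0 Gx; exists (Num.bound x) => //; split => //; split => //.
    by rewrite lte_fin archi_boundP// ltW.
  apply: nondecreasing_cvg_mu; [by move=> n; exact: mGI| |].
    by apply: bigcup_measurable => n _; exact: mGI.
  move=> m n mn; apply/subsetPset; apply: setIS => z [? zx]; split => //.
  by apply: (lt_le_trans zx); rewrite lee_fin ler_nat.
apply: contrapT => /forallNP H; move: cG; apply/negP; rewrite -leNgt.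
rewrite -(cvg_lim _ cvF)//; apply: lime_le; first by apply/cvg_ex; exists (leb G).
by apply: nearW => n; rewrite -cumE leNgt; apply/negP/H.
Qed.

Lemma cum_surj_le (c y : R) : (0 <= c)%R -> (c <= cum G y)%R ->
  exists2 x, (0 <= x)%R & cum G x = c.
Proof.
move=> c0 cy; have [y0|y0] := ltP y 0%R.
  exists 0%R => //; apply/eqP; rewrite eq_le cum_le0// c0/=.
  by rewrite -(cum_le0 (ltW y0)).
have [||x] := @IVT R (cum G) 0%R y c y0.
- by apply: continuous_subspaceT; exact: continuous_cum.
- by rewrite cum_le0// min_l ?cum_ge0// max_r ?cum_ge0// c0.
by rewrite in_itv/= => /andP[x0 _] ?; exists x.
Qed.

Lemma cum_surj (c : R) : (0 <= c)%R -> c%:E < leb G ->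
  exists2 x, (0 <= x)%R & cum G x = c.
Proof.
by move=> c0 /lt_leb_cum[y]; rewrite lte_fin => /ltW; exact: cum_surj_le.
Qed.

Lemma measurable_cum_lt (c : \bar R) : measurable ([set x | (cum G x)%:E < c] : set T).
Proof.
apply: borel_lebesgue; case: c => [c||].
- rewrite (_ : mkset _ = cum G @^-1` `]-oo, c[%classic); last first.
    by apply/seteqP; split => x /=; rewrite in_itv/= lte_fin.
  rewrite -[X in measurable X]setTI.
  by apply: (continuous_measurable_fun continuous_cum).
- rewrite (_ : mkset _ = setT)//; apply/seteqP; split => // x _ /=.
  by rewrite ltry.
- by rewrite (_ : mkset _ = set0)//; apply/seteqP; split => // x /=.
Qed.

(** Cutting G by a condition on [cum], instead of at a point, also covers c = +oo and describes the
    level sets built in [transport]. Any real r < c is a value of [cum], which bounds the measure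
    from below; if c itself is a value, the set lies in G up to that point. *)
Lemma leb_cum_lt (c : \bar R) : 0 <= c -> c <= leb G ->
  leb (G `&` [set x | (cum G x)%:E < c]) = c.
Proof.
move=> c0 cG; have mS := measurableI _ _ mG (measurable_cum_lt c).
apply/eqP; rewrite eq_le; apply/andP; split.
- have [[y cy]|/forallNP H] := pselect (exists y, c <= (cum G y)%:E).
    move: c c0 cG mS cy => [c||] // c0 cG mS cy.
    have [x x0 xc] := cum_surj_le c0 cy.
    rewrite -[in leRHS]xc cumE; apply: le_measure; rewrite ?inE; [exact: mS|exact: mGI|].
    move=> z [Gz /=]; rewrite lte_fin -xc => zx; split => //; split.
      exact: (G0 Gz).1.
    by rewrite lte_fin ltNge; apply: contraTN zx => xz; rewrite -leNgt le_cum.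
  apply: (@le_trans _ _ (leb G)).
    by apply: le_measure; rewrite ?inE.
  rewrite leNgt; apply/negP => /lt_leb_cum[y /ltW]; exact: H.
- rewrite leNgt; apply/negP => lt_c.
  have fS : leb (G `&` [set x | (cum G x)%:E < c]) \is a fin_num.
    by rewrite ge0_fin_numE// (lt_le_trans lt_c)// leey.
  have [r /andP[r1 r2]] : exists r : R, leb (G `&` [set x | (cum G x)%:E < c]) < r%:E < c.
    move: lt_c; rewrite -(fineK fS); set s := fine _.
    case: c {c0 cG mS fS} @s => [c||] s // sc.
      exists ((s + c) / 2)%R; rewrite !lte_fin in sc *.
      by apply/andP; split; lra.
    by exists (s + 1)%R; rewrite lte_fin ltrDl ltr01 ltry.
  have r0 : (0 <= r)%R by rewrite -lee_fin ltW// (le_lt_trans _ r1).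
  have [x x0 xr] := cum_surj r0 (lt_le_trans r2 cG).
  move: r1; apply/negP; rewrite -leNgt -xr cumE.
  apply: le_measure; rewrite ?inE; [exact: mGI|exact: mS|].
  move=> z [Gz [z0 zx]]; split => //=; apply: le_lt_trans r2.
  by rewrite lee_fin -xr le_cum// ltW// -lte_fin.
Qed.

Lemma leb_subset_eq (c : \bar R) : 0 <= c -> c <= leb G ->
  exists P, [/\ measurable P, P `<=` G & leb P = c].
Proof.
move=> c0 cG; exists (G `&` [set x | (cum G x)%:E < c]); split.
- by apply: measurableI => //; exact: measurable_cum_lt.
- exact: subIsetl.
- exact: leb_cum_lt.
Qed.

End cum.
End lebesgue.

(** Layer-cake principle with weight 1: the staircase sums of h and k coincide, and they approximate
    one integral from below while staying under the other. *)
Lemma eq_integral_distribution d (T : measurableType d) (R : realType)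
    (mu : {measure set T -> \bar R}) (A B : set T) (h k : T -> \bar R) :
    measurable A -> measurable B ->
    measurable_fun A h -> (forall x, A x -> (0 <= h x)%E) ->
    measurable_fun B k -> (forall x, B x -> (0 <= k x)%E) ->
    (forall l : R, 0 < l -> mu (A `&` [set x | (l%:E < h x)%E]) =
                            mu (B `&` [set x | (l%:E < k x)%E])) ->
  (\int[mu]_(x in A) h x = \int[mu]_(x in B) k x)%E.
Proof.
wlog suff main : A B h k / measurable A -> measurable B ->
    measurable_fun A h -> (forall x, A x -> (0 <= h x)%E) ->
    measurable_fun B k -> (forall x, B x -> (0 <= k x)%E) ->
    (forall l : R, 0 < l -> mu (A `&` [set x | (l%:E < h x)%E]) =
                            mu (B `&` [set x | (l%:E < k x)%E])) ->
    (\int[mu]_(x in A) h x <= \int[mu]_(x in B) k x)%E.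
  move=> mA mB mh h0 mk k0 hk; apply/eqP; rewrite eq_le !main// => l l0.
  by rewrite hk.
move=> mA mB mh h0 mk k0 hk; rewrite leNgt; apply/negP => lt_kh.
have : (\int[mu]_(x in B) k x < \int[mu]_(x in A) (h x * 1))%E.
  by under [X in (_ < X)%E]eq_integral do rewrite mule1.
move=> /(lt_sum_layers mA mh h0 (measurable_cst 1%E) (fun x _ => lee01))[c [N [c0]]].
apply/negP; rewrite -leNgt.
have := @le_sum_layers R d T mu B mB k (fun=> 1%E) mk k0 (measurable_cst 1%E)
  (fun x _ => lee01) c N c0.
under [in X in (_ <= X)%E -> _]eq_integral do rewrite mule1.
apply: le_trans; apply: lee_sum => j _; rewrite !integral_cst//; last 2 first.
- exact: emeasurable_fun_o_infty.
- exact: emeasurable_fun_o_infty.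
by rewrite hk// mulr_gt0.
Qed.

(** * Transport of functions and resonance *)

Section transport.
Local Open Scope ereal_scope.
Context {R : realType}.
Notation T := (lebesgueType R).

(** The function k' is the decreasing rearrangement of k composed with [cum B]. Its level set above
    l cuts out of B the initial part of measure [dist l], so [leb_cum_lt] gives the distribution. *)
Lemma transport (A B : set T) (k : T -> \bar R) :
  measurable A -> measurable B -> B `<=` oitv 0%R +oo -> leb A = leb B ->
  measurable_fun A k ->
  exists k' : T -> \bar R, [/\ measurable_fun setT k', forall x, 0 <= k' x &
    forall l : R, (0 <= l)%R -> leb (B `&` [set x | l%:E < k' x]) =
                                leb (A `&` [set x | l%:E < k x])].
Proof.
move=> mA mB B0 AB mk.
pose dist (l : R) := leb (A `&` [set x | l%:E < k x]).
have mlev l : measurable (A `&` [set x | l%:E < k x]).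
  exact: emeasurable_fun_o_infty.
have le_dist l m : (l <= m)%R -> dist m <= dist l.
  move=> lm; apply: le_measure; rewrite ?inE; [exact: mlev..|].
  by apply: setIS => x /=; apply: le_lt_trans; rewrite lee_fin.
(* Right continuity of the distribution function: an inequality [cum B x < dist l] persists at a
   slightly higher level, so that the supremum [k' x] exceeds l strictly. *)
have dist_cont l : dist (l + n.+1%:R^-1)%R @[n --> \oo] --> dist l.
  rewrite /dist.
  rewrite (_ : A `&` _ = \bigcup_n (A `&` [set x | (l + n.+1%:R^-1)%:E < k x])).
    apply: nondecreasing_cvg_mu => [n|| m n mn]; first exact: mlev.
      by apply: bigcup_measurable => n _; exact: mlev.
    apply/subsetPset; apply: setIS => x /=; apply: le_lt_trans.
    by rewrite lee_fin lerD2l lef_pV2 ?posrE// ler_nat.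
  apply/seteqP; split => [x [Ax /= lk]|x [n _ [Ax /= lk]]]; last first.
    by split => //=; apply: le_lt_trans lk; rewrite lee_fin lerDl.
  have [y ly yk] : exists2 y : R, (l < y)%R & y%:E <= k x.
    case: (k x) lk => [r|_|]//; first by rewrite lte_fin => lr; exists r.
    by exists (l + 1)%R; rewrite ?ltrDl ?leey.
  have [n] : exists n, (n.+1%:R^-1 < y - l)%R.
    have /ltr_add_invr[n] : (0 < y - l)%R by rewrite subr_gt0.
    by rewrite add0r => ?; exists n.
  move=> nyl; exists n => //; split => //=; apply: lt_le_trans yk.
  by rewrite lte_fin -ltrBrDl.
(* The value 0 is put in by hand, so that the supremum is nonnegative where no level qualifies. *)
pose S x := [set y : \bar R | y = 0 \/
  exists l : R, [/\ (0 <= l)%R, (cum B x)%:E < dist l & y = l%:E]].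
pose k' x := ereal_sup (S x).
have k'0 x : 0 <= k' x by apply: ereal_sup_ubound; left.
have k'P l x : (0 <= l)%R -> (l%:E < k' x) = ((cum B x)%:E < dist l).
  move=> l0; apply/idP/idP.
    move=> /ereal_sup_gt[_ [->|[m [m0 xm ->]]]]; first by rewrite lte_fin ltNge l0.
    by rewrite lte_fin => lm; apply: (lt_le_trans xm); exact/le_dist/ltW.
  move=> xl; have [n xn] : exists n, (cum B x)%:E < dist (l + n.+1%:R^-1)%R.
    apply: contrapT => /forallNP H; move: xl; apply/negP; rewrite -leNgt.
    rewrite -(cvg_lim _ (dist_cont l))//; apply: lime_le.
      by apply/cvg_ex; exists (dist l).
    by apply: nearW => n; rewrite leNgt; apply/negP/H.
  apply: (@lt_le_trans _ _ (l + n.+1%:R^-1)%:E); first by rewrite lte_fin ltrDl.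
  apply: ereal_sup_ubound; right; exists (l + n.+1%:R^-1)%R; split => //.
  by rewrite addr_ge0.
exists k'; split; [|exact: k'0|].
- move=> mT; apply: (measurability _ (ErealGenOInfty.measurableE R)) => // _ [_ [l ->] <-].
  rewrite setTI; have [l0|l0] := leP 0%R l.
    rewrite (_ : _ @^-1` _ = [set x | (cum B x)%:E < dist l]).
      exact: measurable_cum_lt.
    by apply/seteqP; split => x /=; rewrite in_itv/= andbT k'P.
  rewrite (_ : _ @^-1` _ = setT)//; apply/seteqP; split => // x _ /=.
  by rewrite in_itv/= andbT; apply: lt_le_trans (k'0 x); rewrite lte_fin.
- move=> l l0; rewrite -/(dist l).
  rewrite (_ : [set x | l%:E < k' x] = [set x | (cum B x)%:E < dist l]).
    apply: leb_cum_lt => //; rewrite -AB; apply: le_measure; rewrite ?inE//.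
  by apply/seteqP; split => x /=; rewrite k'P.
Qed.

End transport.

Section transport_nonatomic.
Local Open Scope ereal_scope.
Context d (T : measurableType d) (R : realType) (mu : {measure set T -> \bar R}).
Variables (D : set T) (mD : measurable D) (D_ : nat -> set T).
Hypotheses (mD_ : forall n, measurable (D_ n)) (finD_ : forall n, mu (D_ n) < +oo)
  (ndD_ : nondecreasing_seq D_) (D_E : D = \bigcup_n D_ n).
Hypothesis divisible : forall (G : set T) (c : \bar R),
  measurable G -> G `<=` D -> 0 <= c -> c <= mu G ->
  exists P, [/\ measurable P, P `<=` G & mu P = c].
Hypothesis transportable : forall (A B : set T) (k : T -> \bar R),
  measurable A -> measurable B -> B `<=` D -> mu A = mu B ->
  measurable_fun A k ->
  exists k' : T -> \bar R, [/\ measurable_fun setT k', forall x, 0 <= k' x &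
    forall l : R, (0 <= l)%R -> mu (B `&` [set x | l%:E < k' x]) =
                                mu (A `&` [set x | l%:E < k x])].

(** Induction from the innermost set outward: after k has been moved from [H 1] into a subset of
    [F 1], the rest of [F 0] still has room for [H 0] minus [H 1]. This comparison cancels the
    measure of [H 1], hence the finiteness of all [H j] except [H 0]. *)
Lemma nested_transport (N : nat) (H F : nat -> set T) (k : T -> \bar R) :
  (forall j, measurable (H j)) -> (forall j, measurable (F j)) ->
  (forall j, H j.+1 `<=` H j) -> (forall j, F j.+1 `<=` F j) ->
  F 0%N `<=` D -> (forall j, mu (H j.+1) < +oo) ->
  (forall j, mu (H j) <= mu (F j)) -> measurable_fun (H 0%N) k ->
  exists (k' : T -> \bar R) (F' : nat -> set T),
    [/\ measurable_fun setT k', forall x, 0 <= k' x & forall j, (j <= N)%N ->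
      [/\ measurable (F' j), F' j `<=` F j, F' j `<=` F' 0%N, mu (F' j) = mu (H j) &
        forall l : R, (0 <= l)%R ->
          mu (F' j `&` [set x | l%:E < k' x]) = mu (H j `&` [set x | l%:E < k x])]].
Proof.
elim: N H F => [|N IH] H F mH mF sH sF F0 finH HF mk.
  have [P [mP PF PH]] := divisible (mF 0%N) F0 (measure_ge0 _ _) (HF 0%N).
  have [//|k' [mk' k'0 k'k]] := transportable (mH 0%N) mP (subset_trans PF F0) _ mk.
  by exists k', (fun=> P); split => // j; rewrite leqn0 => /eqP ->; split.
have mk1 : measurable_fun (H 1%N) k by apply: measurable_funS mk.
have [k1 [F1 [mk1' k10 k1P]]] := IH (H \o succn) (F \o succn)
  (fun j => mH _) (fun j => mF _) (fun j => sH _) (fun j => sF _)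
  (subset_trans (sF 0%N) F0) (fun j => finH _) (fun j => HF _) mk1.
have [mF10 sF10 _ F1H1 dF1] := k1P 0%N isT.
pose G := F 0%N `\` F1 0%N; pose K := H 0%N `\` H 1%N.
have mG : measurable G by exact: measurableD.
have mK : measurable K by exact: measurableD.
have G0 : G `<=` D by apply: subset_trans F0; exact: subDsetl.
have KG : mu K <= mu G.
  have H0K : mu (H 0%N) = mu (H 1%N) + mu K.
    by rewrite -measureU// /K ?setDIK// setDUK.
  have F0G : mu (F 0%N) = mu (F1 0%N) + mu G.
    by rewrite -measureU// /G ?setDIK// setDUK//; exact: subset_trans (sF 0%N).
  have := HF 0%N; rewrite H0K F0G F1H1 leeD2lE// ge0_fin_numE//.
have [P [mP PG PK]] := divisible mG G0 (measure_ge0 _ _) KG.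
have mkK : measurable_fun K k by apply: measurable_funS mk => //; exact: subDsetl.
have [//|k2 [mk2 k20 k2k]] := transportable mK mP (subset_trans PG G0) _ mkK.
have dPF1 : P `&` F1 0%N = set0.
  by apply/seteqP; split => // x [/PG[]].
pose k' := (k1 \_ (F1 0%N)) \+ (k2 \_ P).
have k'F1 x : F1 0%N x -> k' x = k1 x.
  move=> Fx; rewrite /k' /= /patch mem_set// memNset ?adde0// => Px.
  by have : (P `&` F1 0%N) x by []; rewrite dPF1.
have k'P x : P x -> k' x = k2 x.
  move=> Px; rewrite /k' /= /patch (mem_set Px) memNset ?add0e// => Fx.
  by have : (P `&` F1 0%N) x by []; rewrite dPF1.
have levF1 A l : A `<=` F1 0%N ->
    A `&` [set x | l%:E < k' x] = A `&` [set x | l%:E < k1 x].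
  by move=> AF; apply/seteqP; split => x [/[dup] Ax /AF Fx] /=; rewrite k'F1.
have levP l : P `&` [set x | l%:E < k' x] = P `&` [set x | l%:E < k2 x].
  by apply/seteqP; split => x [Px] /=; rewrite k'P.
exists k', (fun j => if j is j'.+1 then F1 j' else F1 0%N `|` P); split.
- by apply: emeasurable_funD; exact/(measurable_restrictT _ _).1/measurable_funTS.
- by move=> x; rewrite /k' adde_ge0// erestrict_ge0.
case=> [_|j jN].
  have mF1P := measurableU _ _ mF10 mP.
  have H0E : H 0%N = H 1%N `|` K by rewrite /K setDUK.
  split => //.
  - by move=> x [/sF10/sF//|/PG[]].
  - rewrite measureU//; last by rewrite setIC.
    have -> : mu (H 0%N) = mu (H 1%N) + mu K.
      by rewrite {1}H0E measureU// /K setDIK.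
    by congr (_ + _).
  - move=> l l0; rewrite setIUl levP levF1// measureU//; last 3 first.
    + by apply: emeasurable_fun_o_infty => //; exact: measurable_funTS.
    + by apply: emeasurable_fun_o_infty => //; exact: measurable_funTS.
    + by rewrite setIACA (setIC _ P) dPF1 set0I.
    have -> : mu (H 0%N `&` [set x | l%:E < k x]) =
        mu (H 1%N `&` [set x | l%:E < k x]) + mu (K `&` [set x | l%:E < k x]).
      rewrite {1}H0E setIUl measureU//.
      + exact: emeasurable_fun_o_infty.
      + exact: emeasurable_fun_o_infty.
      + by rewrite setIACA /K setDIK set0I.
    by rewrite -(dF1 l l0) -(k2k l l0).
have [mFj sFj sF0 FHj dFj] := k1P j jN.
split => //; first by move=> x /sF0; left.
by move=> l l0; rewrite levF1// dFj.
Qed.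

Definition equim (f g : T -> \bar R) : Prop := forall l : R, (0 < l)%R ->
  mu [set x | D x /\ l%:E < `|f x|] = mu [set x | D x /\ l%:E < `|g x|].

(* The integral of h * k is approximated by a sum over finitely many nested level
   sets of h, whose measures do not exceed those of the level sets of f, so k can
   be transported level by level. *)
Lemma lt_integral_equim (f h k : T -> \bar R) (a : \bar R) :
  measurable_fun setT f -> (forall x, 0 <= f x) ->
  measurable_fun setT h -> (forall x, 0 <= h x) ->
  measurable_fun setT k -> (forall x, 0 <= k x) ->
  equim h f -> a < \int[mu]_(x in D) (h x * k x) ->
  exists k' : T -> \bar R, [/\ measurable_fun setT k', forall x, 0 <= k' x,
    equim k' k & a < \int[mu]_(x in D) (f x * k' x)].
Proof.
move=> mf f0 mh h0 mk k0 hf a_lt.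
have mS d' (U : measurableType d') (g : T -> U) A : measurable_fun setT g -> measurable_fun A g.
  exact: measurable_funTS.
have sD n : D_ n `<=` D by rewrite D_E; exact: bigcup_sup.
(* Restricting to some [D_ n] makes the level sets of h finite in measure, as [nested_transport]
   requires; those of f may be infinite. *)
have [n an] : exists n, a < \int[mu]_(x in D_ n) (h x * k x).
  apply: contrapT => /forallNP H; move: a_lt; apply/negP; rewrite -leNgt.
  have cv : \int[mu]_(x in D_ n) (h x * k x) @[n --> \oo] -->
            \int[mu]_(x in D) (h x * k x).
    rewrite D_E; apply: ge0_nondecreasing_set_cvg_integral => //.
    - by move=> i; apply: mS; exact: emeasurable_funM.
    - by move=> i x _; rewrite mule_ge0.
  rewrite -(cvg_lim _ cv)//; apply: lime_le; first by apply/cvg_ex; eexists; exact: cv.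
  by apply: nearW => i; rewrite leNgt; apply/negP/H.
have [c [N [c0 acN]]] := lt_sum_layers (mD_ n) (mS _ _ _ _ mh) (fun x _ => h0 x)
  (mS _ _ _ _ mk) (fun x _ => k0 x) an.
have lt_next (j : nat) (y : \bar R) : (j.+2%:R * c)%:E < y -> (j.+1%:R * c)%:E < y.
  by apply: lt_trans; rewrite lte_fin ltr_pM2r// ltr_nat.
(* Index 0 is all of D and not a level set, so that the whole of k is transported and the result is
   equimeasurable with k. *)
pose H (j : nat) : set T :=
  if j is j'.+1 then D_ n `&` [set x | (j'.+1%:R * c)%:E < h x] else D.
pose F (j : nat) : set T :=
  if j is j'.+1 then D `&` [set x | (j'.+1%:R * c)%:E < f x] else D.
have mlev (A : set T) g l : measurable A -> measurable_fun setT g ->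
    measurable (A `&` [set x | l%:E < g x]).
  by move=> mA mg; apply: emeasurable_fun_o_infty => //; exact: mS.
have mH j : measurable (H j) by case: j => [|j] //; exact: mlev.
have mF j : measurable (F j) by case: j => [|j] //; exact: mlev.
have levE (g : T -> \bar R) (l : \bar R) : (forall x, 0 <= g x) ->
    [set x | D x /\ l < `|g x|] = D `&` [set x | l < g x].
  by move=> g0; apply/seteqP; split => x [Dx] /=; rewrite gee0_abs.
have sH j : H j.+1 `<=` H j.
  by case: j => [|j] x [xD lx]; [exact: sD xD|split=> //; exact: lt_next lx].
have sF j : F j.+1 `<=` F j.
  by case: j => [|j] x [? ?] //; split=> //=; exact: lt_next.
have finH j : mu (H j.+1) < +oo.
  apply: le_lt_trans (finD_ n); apply: le_measure; rewrite ?inE; [exact: (mH j.+1)|exact: mD_|].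
  exact: subIsetl.
have HF j : mu (H j) <= mu (F j).
  case: j => [|j] //; apply: (@le_trans _ _ (mu (D `&` [set x | (j.+1%:R * c)%:E < h x]))).
    apply: le_measure; rewrite ?inE; [exact: (mH j.+1)|exact: mlev|].
    by apply: setSI.
  have := hf (j.+1%:R * c)%R; rewrite !levE// => -> //.
  by rewrite mulr_gt0.
have [k' [F' [mk' k'0 kP]]] :=
  @nested_transport N H F k mH mF sH sF (@subset_refl _ D) finH HF (mS _ _ _ _ mk).
have [mF0 sF0 _ _ dF0] := kP 0%N isT.
(* Outside [F' 0] nothing is known about k'; with the value 0 there, only the level sets inherited
   from k remain. *)
pose k1 := k' \_ (F' 0%N).
have mk1 : measurable_fun setT k1 by exact/(measurable_restrictT _ _).1/mS.
have k10 x : 0 <= k1 x by exact: erestrict_ge0.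
exists k1; split => //.
- move=> l l0; rewrite !levE// -dF0 ?ltW//; congr (mu _).
  apply/seteqP; split => [x [Dx]|x [Fx lx]] /=; rewrite /k1 patchE.
    by case: ifPn => [/set_mem//|_]; rewrite lte_fin ltNge ltW.
  by rewrite mem_set//; split => //; exact: sF0.
apply: (lt_le_trans acN).
apply: (le_trans _ (le_sum_layers _ mD (mS _ _ _ _ mf) (fun x _ => f0 x)
  (mS _ _ _ _ mk1) (fun x _ => k10 x) N c0)).
apply: lee_sum => j _; apply: lee_wpmul2l; first by rewrite lee_fin ltW.
have [mFj sFj sFj0 _ dFj] := kP j.+1 (ltn_ord j).
rewrite (@eq_integral_distribution _ _ _ _ _ (F' j.+1) _ k')//.
- apply: (@le_trans _ _ (\int[mu]_(x in F' j.+1) k1 x)).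
    rewrite (_ : \int[mu]_(x in F' j.+1) k1 x = \int[mu]_(x in F' j.+1) k' x)//.
    by apply: eq_integral => x /set_mem/sFj0 Fx; rewrite /k1 patchE mem_set.
  by apply: ge0_subset_integral => //; [exact: (mF j.+1)|exact: mS].
- exact: (mH j.+1).
- exact: mS.
- exact: mS.
- by move=> l l0; rewrite dFj// ltW.
Qed.

End transport_nonatomic.

(** * The Lorentz-Luxemburg theorem *)

Section bounded_functions.
Context d (T : measurableType d) (R : realType) (mu : {measure set T -> \bar R}).
Variables (E : set T) (mE : measurable E) (finE : (mu E < +oo)%E).
Implicit Types p q : T -> R.

(** Bounded functions are closed under products and integrable over sets of finite measure, so the
    quadratic argument below deals with finite real numbers only. *)
Definition bnd p : Prop :=
  measurable_fun setT p /\ exists B : R, forall x, `|p x| <= B.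

Lemma bnd_cst (r : R) : bnd (fun=> r).
Proof. by split => //; exists `|r|. Qed.

Lemma bndD p q : bnd p -> bnd q -> bnd (fun x => p x + q x).
Proof.
move=> [mp [B pB]] [mq [C qC]]; split; first exact: measurable_funD.
by exists (B + C) => x; rewrite (le_trans (ler_normD _ _))// lerD.
Qed.

Lemma bndM p q : bnd p -> bnd q -> bnd (fun x => p x * q x).
Proof.
move=> [mp [B pB]] [mq [C qC]]; split; first exact: measurable_funM.
by exists (B * C) => x; rewrite normrM ler_pM.
Qed.

Lemma bndZ (r : R) p : bnd p -> bnd (fun x => r * p x).
Proof. by move=> bp; apply: bndM => //; exact: bnd_cst. Qed.

Lemma bndB p q : bnd p -> bnd q -> bnd (fun x => p x - q x).
Proof.
move=> [mp [B pB]] [mq [C qC]]; split; first exact: measurable_funB.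
by exists (B + C) => x; rewrite (le_trans (ler_normB _ _))// lerD.
Qed.

Lemma bnd_sqr p : bnd p -> bnd (fun x => p x ^+ 2).
Proof. by move=> bp; under eq_fun do rewrite expr2; exact: bndM. Qed.

Lemma bnd_norm p : bnd p -> bnd (fun x => `|p x|).
Proof.
move=> [mp [B pB]]; split; first exact: measurableT_comp.
by exists B => x; rewrite normr_id.
Qed.

Lemma bnd_min p q : bnd p -> bnd q -> bnd (fun x => Num.min (p x) (q x)).
Proof.
move=> [mp [B pB]] [mq [C qC]]; split; first exact: measurable_minr.
exists (B + C) => x; have B0 := le_trans (normr_ge0 _) (pB x).
have C0 := le_trans (normr_ge0 _) (qC x).
by rewrite /Num.min; case: ifP => _; [apply: ler_wpDr|apply: ler_wpDl].
Qed.

Lemma bnd_le p q : measurable_fun setT p -> bnd q -> (forall x, 0 <= p x <= q x) -> bnd p.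
Proof.
move=> mp [mq [B qB]] pq; split => //; exists B => x; have /andP[p0 ple] := pq x.
by rewrite ger0_norm// (le_trans ple)// (le_trans (ler_norm _)).
Qed.

Lemma bnd_integrable p : bnd p -> mu.-integrable E (EFin \o p).
Proof.
move=> [mp [B pB]]; apply: measurable_bounded_integrable => //.
  exact: measurable_funTS.
exists B; split => //; first exact: num_real.
by move=> C BC x _; rewrite /= (le_trans (pB x))// ltW.
Qed.

Definition bnd_integral p : R := \int[mu]_(x in E) p x.

Local Notation J := bnd_integral.

Lemma bnd_integralD p q : bnd p -> bnd q -> J (fun x => p x + q x) = J p + J q.
Proof. by move=> bp bq; rewrite /bnd_integral RintegralD//; exact: bnd_integrable. Qed.

Lemma bnd_integralZ (r : R) p : bnd p -> J (fun x => r * p x) = r * J p.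
Proof. by move=> bp; rewrite /bnd_integral RintegralZl//; exact: bnd_integrable. Qed.

Lemma bnd_integralN p : bnd p -> J (fun x => -1 * p x) = - J p.
Proof. by move=> bp; rewrite bnd_integralZ// mulN1r. Qed.

Lemma le_bnd_integral p q : bnd p -> bnd q -> (forall x, p x <= q x) -> J p <= J q.
Proof. by move=> bp bq pq; apply: le_Rintegral => //; exact: bnd_integrable. Qed.

Lemma bnd_integral_ge0 p : (forall x, 0 <= p x) -> 0 <= J p.
Proof. by move=> p0; apply: Rintegral_ge0 => x _. Qed.

Lemma bnd_integralE p : bnd p -> (\int[mu]_(x in E) (p x)%:E)%E = (J p)%:E.
Proof.
move=> bp; rewrite /bnd_integral /Rintegral fineK//.
exact: (integrable_fin_num mE (bnd_integrable bp)).
Qed.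

Lemma bnd_integral_eq0 p : bnd p -> (forall x, 0 <= p x) -> J p = 0 ->
  {ae mu, forall x, E x -> p x = 0}.
Proof.
move=> bp p0 Jp; have : (\int[mu]_(x in E) `|(p x)%:E|)%E = 0%E.
  by under eq_integral do rewrite gee0_abs ?lee_fin//; rewrite bnd_integralE// Jp.
move=> /(ae_eq_integral_abs mu mE)[].
  by apply/measurable_EFinP/measurable_funTS; exact: bp.1.
by move=> N [mN N0 H]; exists N; split => // t Ht; apply: H => He; apply: Ht => /He[].
Qed.

End bounded_functions.

Section function_norm.
Local Open Scope ereal_scope.
Context d (T : measurableType d) (R : realType) (mu : {measure set T -> \bar R}).
Variables (D : set T) (mD : measurable D).
Implicit Types (f g h w : T -> \bar R).

Definition aeD (P : T -> Prop) : Prop := {ae mu, forall x, D x -> P x}.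

Lemma aeDW (P : T -> Prop) : (forall x, D x -> P x) -> aeD P.
Proof. by move=> DP; exact: aeW. Qed.

Lemma aeDS (P Q : T -> Prop) : (forall x, D x -> P x -> Q x) -> aeD P -> aeD Q.
Proof. by move=> PQ; rewrite /aeD; apply: filterS => x Px Dx; apply: PQ => //; exact: Px. Qed.

Lemma aeDI (P Q : T -> Prop) : aeD P -> aeD Q -> aeD (fun x => P x /\ Q x).
Proof. by rewrite /aeD; apply: filterS2 => x Px Qx Dx; split; [exact: Px|exact: Qx]. Qed.

Definition mplus f : Prop := measurable_fun D f /\ aeD (fun x => 0 <= f x).

(** Members of [mplus] are nonnegative only almost everywhere on D and arbitrary off D. This
    representative is nonnegative everywhere, measurable on the whole space, and gives the same
    integrals over D. *)
Definition pospart f : T -> \bar R := f^\+ \_ D.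

Lemma measurable_pospart f : measurable_fun D f -> measurable_fun setT (pospart f).
Proof.
by move=> mf; apply/(measurable_restrictT _ mD).1; exact: measurable_funepos.
Qed.

Lemma pospart_ge0 f x : 0 <= pospart f x.
Proof. by apply: erestrict_ge0. Qed.

Lemma mplus_ge0 f : measurable_fun setT f -> (forall x, 0 <= f x) -> mplus f.
Proof.
by move=> mf f0; split; [exact: measurable_funTS|exact: aeDW].
Qed.

Lemma mplus_pospart f : measurable_fun D f -> mplus (pospart f).
Proof.
by move=> mf; apply: mplus_ge0; [exact: measurable_pospart|exact: pospart_ge0].
Qed.

Lemma pospart_ae f : mplus f -> aeD (fun x => pospart f x = f x).
Proof.
move=> [mf]; apply: aeDS => x Dx f0.
by rewrite /pospart patchE mem_set// funeposE max_l.
Qed.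

Lemma aeD_eq_integral f g : measurable_fun D f -> measurable_fun D g ->
  aeD (fun x => f x = g x) ->
  \int[mu]_(x in D) f x = \int[mu]_(x in D) g x.
Proof. by move=> mf mg fg; exact: ae_eq_integral. Qed.

Lemma integral_pospart f g : mplus f -> mplus g ->
  \int[mu]_(x in D) (f x * g x) = \int[mu]_(x in D) (pospart f x * pospart g x).
Proof.
move=> pf pg; apply: aeD_eq_integral.
- exact: (emeasurable_funM pf.1 pg.1).
- by apply: emeasurable_funM; apply: measurable_funTS; apply: measurable_pospart; [exact: pf.1|exact: pg.1].
- by apply: aeDS (aeDI (pospart_ae pf) (pospart_ae pg)) => x Dx [-> ->].
Qed.

Lemma integral_mplus_ge0 f g : mplus f -> mplus g ->
  0 <= \int[mu]_(x in D) (f x * g x).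
Proof.
move=> pf pg; rewrite integral_pospart//; apply: integral_ge0 => x _.
by rewrite mule_ge0// pospart_ge0.
Qed.

Lemma le_integral_mplus f1 g1 f2 g2 : mplus f1 -> mplus g1 -> mplus f2 -> mplus g2 ->
  aeD (fun x => f1 x <= f2 x) -> aeD (fun x => g1 x <= g2 x) ->
  \int[mu]_(x in D) (f1 x * g1 x) <= \int[mu]_(x in D) (f2 x * g2 x).
Proof.
move=> pf1 pg1 pf2 pg2 f12 g12.
rewrite (integral_pospart pf1 pg1) (integral_pospart pf2 pg2).
apply: ae_ge0_le_integral => //.
- by move=> x _; rewrite mule_ge0// pospart_ge0.
- by apply: emeasurable_funM; apply: measurable_funTS; apply: measurable_pospart; [exact: pf1.1|exact: pg1.1].
- by move=> x _; rewrite mule_ge0// pospart_ge0.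
- by apply: emeasurable_funM; apply: measurable_funTS; apply: measurable_pospart; [exact: pf2.1|exact: pg2.1].
apply: aeDS (aeDI (aeDI (aeDI (pospart_ae pf1) (pospart_ae pg1))
  (aeDI (pospart_ae pf2) (pospart_ae pg2))) (aeDI f12 g12)) => x Dx.
move=> [[[e1 e2] [e3 e4]] [le1 le2]].
by apply: lee_pmul; rewrite ?pospart_ge0// ?e1 ?e2 ?e3 ?e4.
Qed.

Lemma mplus_cst (r : R) : (0 <= r)%R -> mplus (fun=> r%:E).
Proof. by move=> r0; apply: mplus_ge0 => // x; rewrite lee_fin. Qed.

Lemma mplus_scale (r : R) f : (0 <= r)%R -> mplus f -> mplus (fun x => r%:E * f x).
Proof.
move=> r0 [mf f0]; split; first exact: measurable_funeM.
by apply: aeDS f0 => x Dx f0; rewrite mule_ge0.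
Qed.

Lemma mplusD f g : mplus f -> mplus g -> mplus (fun x => f x + g x).
Proof.
move=> [mf f0] [mg g0]; split; first exact: emeasurable_funD.
by apply: aeDS (aeDI f0 g0) => x Dx [? ?]; rewrite adde_ge0.
Qed.

Lemma mplus_EFin (h : T -> R) : measurable_fun setT h -> (forall x, 0 <= h x)%R ->
  mplus (EFin \o h).
Proof.
by move=> mh h0; apply: mplus_ge0 => [|x]; [exact/measurable_EFinP|rewrite lee_fin].
Qed.

Section separation.
Variable N : (T -> \bar R) -> \bar R.
Hypothesis N_ge0 : forall f, mplus f -> 0 <= N f.
Hypothesis N_scale : forall (l : R) f, (0 <= l)%R -> mplus f ->
  N (fun x => l%:E * f x) = l%:E * N f.
Hypothesis N_triangle : forall f g, mplus f -> mplus g ->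
  N (fun x => f x + g x) <= N f + N g.
Hypothesis N_mono : forall f g, mplus f -> mplus g ->
  aeD (fun x => f x <= g x) -> N f <= N g.
Hypothesis N_fatou : forall (fk : nat -> T -> \bar R) f,
  (forall k, mplus (fk k)) -> mplus f ->
  aeD (fun x => nondecreasing_seq (fk ^~ x) /\ fk k x @[k --> \oo] --> f x) ->
  nondecreasing_seq (fun k => N (fk k)) /\ N (fk k) @[k --> \oo] --> N f.

Lemma norm_cst0 : N (fun=> 0) = 0.
Proof.
rewrite (_ : (fun=> 0) = (fun x => 0%R%:E * cst 0 x :> \bar R)).
  by rewrite N_scale// ?mul0e//; exact: mplus_cst.
by apply/funext => x; rewrite mule0.
Qed.

Lemma norm_convex f g (t : R) : (0 <= t <= 1)%R -> mplus f -> mplus g ->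
  N f <= 1 -> N g <= 1 -> N (fun x => (1 - t)%:E * f x + t%:E * g x) <= 1.
Proof.
move=> /andP[t0 t1] pf pg Nf Ng; have t1' : (0 <= 1 - t)%R by rewrite subr_ge0.
have := N_triangle (mplus_scale t1' pf) (mplus_scale t0 pg).
move=> /le_trans; apply; rewrite !N_scale//.
apply: (@le_trans _ _ ((1 - t)%:E * 1 + t%:E * 1)).
  by apply: leeD; rewrite lee_wpmul2l// lee_fin.
by rewrite !mule1 -EFinD subrK.
Qed.

Lemma measurable_limn_einf (fk : nat -> T -> \bar R) :
  (forall k, measurable_fun setT (fk k)) ->
  measurable_fun setT (fun x => limn_einf (fk ^~ x)).
Proof.
move=> mfk; apply: (emeasurable_fun_cvg (fun n x => einfs (fk ^~ x) n)).
  by move=> n; exact: measurable_fun_einfs.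
move=> x _; rewrite limn_einf_lim; apply: ereal_nondecreasing_is_cvgn.
exact: nondecreasing_einfs.
Qed.

(** The tail infima increase to the lower limit and lie below the members of the sequence, so (P2)
    and (P3) apply. As no convergence is assumed, a minimiser can be defined at every point as a
    lower limit. *)
Lemma norm_liminf (fk : nat -> T -> \bar R) : (forall k, measurable_fun setT (fk k)) ->
  (forall k x, 0 <= fk k x) -> (forall k, N (fk k) <= 1) ->
  N (fun x => limn_einf (fk ^~ x)) <= 1.
Proof.
move=> mfk fk0 N1.
pose g n x := einfs (fk ^~ x) n.
have g0 n x : 0 <= g n x.
  by apply: le_ereal_inf_tmp => _ [m /= _ <-]; exact: fk0.
have mg n : measurable_fun setT (g n) by exact: measurable_fun_einfs.
have pg n : mplus (g n) by apply: mplus_ge0.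
have cvg_g x : g n x @[n --> \oo] --> limn_einf (fk ^~ x).
  by rewrite limn_einf_lim; apply: ereal_nondecreasing_is_cvgn; exact: nondecreasing_einfs.
have mlim := measurable_limn_einf mfk.
have plim : mplus (fun x => limn_einf (fk ^~ x)).
  apply: mplus_ge0 => // x; apply: (cvge_ge _ (cvg_g x)).
  by apply: nearW => n; exact: g0.
have [|_ cN] := N_fatou pg plim.
  by apply: aeDW => x _; split; [exact: nondecreasing_einfs|exact: cvg_g].
apply: (cvge_le _ cN); apply: nearW => n; apply: le_trans (N1 n).
apply: N_mono => //; first exact: mplus_ge0.
by apply: aeDW => x _; apply: ereal_inf_lbound; exists n => /=.
Qed.

(* The functional separating fr from the unit ball of N is fr - h', where h'
   minimises the L^2 distance to fr.  No completeness of L^2 is needed: a fast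
   minimising sequence converges almost everywhere, by the parallelogram law. *)
Section minimisation.
Variables (fr : T -> R) (M : R) (E : set T).
Hypotheses (mE : measurable E) (ED : E `<=` D) (finE : mu E < +oo).
Hypotheses (mfr : measurable_fun setT fr) (fr_bnd : forall x, (0 <= fr x <= M)%R).
Hypothesis fr_out : forall x, ~ E x -> fr x = 0%R.

Local Notation J := (bnd_integral mu E).
Local Notation bnd_integrable := (bnd_integrable mE finE).

Let bfr : bnd fr.
Proof. by apply: (bnd_le mfr (bnd_cst T M)). Qed.

Let K (h' : T -> R) := [/\ bnd h', forall x, (0 <= h' x)%R & N (EFin \o h') <= 1].

Let sq (h' : T -> R) : R := J (fun x => (fr x - h' x) ^+ 2)%R.

Let bsq (h' : T -> R) : bnd h' -> bnd (fun x => (fr x - h' x) ^+ 2)%R.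
Proof. by move=> bh; apply: bnd_sqr; exact: bndB. Qed.

Let sq_ge0 (h' : T -> R) : (0 <= sq h')%R.
Proof. by apply: bnd_integral_ge0 => x; rewrite sqr_ge0. Qed.

Let Kmplus (h' : T -> R) : K h' -> mplus (EFin \o h').
Proof. by move=> [[mh _] h0 _]; exact: mplus_EFin. Qed.

Let K0 : K (fun=> 0%R).
Proof.
split; [exact: bnd_cst|by []|].
by rewrite (_ : _ \o _ = fun=> 0) ?norm_cst0.
Qed.

Let Kconv (a b : T -> R) (t : R) : (0 <= t <= 1)%R -> K a -> K b ->
  K (fun x => (1 - t) * a x + t * b x)%R.
Proof.
move=> /andP[t0 t1] Ka Kb; have [ba a0 Na] := Ka; have [bb b0 Nb] := Kb.
split.
- by apply: bndD; exact: bndZ.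
- by move=> x; rewrite addr_ge0// mulr_ge0// subr_ge0.
- have := @norm_convex (EFin \o a) (EFin \o b) t; rewrite t0 t1.
  move=> /(_ isT (Kmplus Ka) (Kmplus Kb) Na Nb); congr (N _ <= _).
Qed.

(** Truncation by fr does not increase the distance to fr either ([sq_min]). A minimising sequence
    may therefore be taken below fr, so that its limit is bounded and vanishes off E. *)
Let Kmin (h' : T -> R) : K h' -> K (fun x => Num.min (h' x) (fr x)).
Proof.
move=> Kh; have [bh h0 Nh] := Kh; split; first exact: bnd_min.
  by move=> x; rewrite le_min h0/=; case/andP: (fr_bnd x).
apply: le_trans Nh; apply: N_mono; last 1 first.
- by apply: aeDW => x _ /=; rewrite lee_fin ge_min lexx.
- apply: mplus_EFin; first exact: (bnd_min bh bfr).1.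
  by move=> x; rewrite le_min h0/=; case/andP: (fr_bnd x).
- exact: Kmplus.
Qed.

Let sq_min (h' : T -> R) : bnd h' -> (sq (fun x => Num.min (h' x) (fr x)) <= sq h')%R.
Proof.
move=> bh; apply: le_bnd_integral => //; [exact/bsq/bnd_min|exact: bsq|].
move=> x; case: (leP (h' x) (fr x)) => // _.
by rewrite subrr expr0n/= sqr_ge0.
Qed.

Let delta : R := inf [set sq h' | h' in K].

Let has_inf_sq : has_inf [set sq h' | h' in K].
Proof.
split; first by exists (sq (fun=> 0%R)); exists (fun=> 0%R).
by exists 0%R => _ [h' _ <-].
Qed.

Let delta_le (h' : T -> R) : K h' -> (delta <= sq h')%R.
Proof. by move=> Kh; apply: ge_inf; [exact: has_inf_sq.2|exists h']. Qed.

Let q (n : nat) : R := (2^-1 ^+ n)%R.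

Let q_gt0 n : (0 < q n)%R.
Proof. by rewrite exprn_gt0// invr_gt0. Qed.

Let q_le1 n : (q n <= 1)%R.
Proof. by rewrite exprn_ile1// ?invr_ge0// invf_le1// ler1n. Qed.

Let qS n : q n.+1 = (q n / 2)%R.
Proof. by rewrite /q exprSr. Qed.

Let sum_q n : (\sum_(0 <= k < n) q k = 2 - 2 * q n)%R.
Proof.
elim: n => [|n IH]; first by rewrite big_geq// /q expr0 mulr1 subrr.
by rewrite big_nat_recr//= IH qS; field.
Qed.

Let minimising : exists h : nat -> T -> R, forall n,
  [/\ K (h n), forall x, (h n x <= fr x)%R & (sq (h n) <= delta + q n ^+ 2)%R].
Proof.
suff /choice[h hP] : forall n, exists h' : T -> R, [/\ K h', forall x, (h' x <= fr x)%R &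
    (sq h' <= delta + q n ^+ 2)%R] by exists h.
move=> n; have q2 : (0 < q n ^+ 2)%R by rewrite exprn_gt0.
have [_ [h' Kh <-] lt_h] := inf_adherent q2 has_inf_sq.
exists (fun x => Num.min (h' x) (fr x)); split; first exact: Kmin.
  by move=> x; rewrite ge_min lexx orbT.
by rewrite (le_trans (sq_min _)) ?ltW//; case: Kh.
Qed.

(** The midpoint of a and b belongs to the convex set K, hence its squared distance to fr is at
    least delta; near minimality of a and b thus forces them to be close. *)
Let parallelogram (a b : T -> R) (ea eb : R) : K a -> K b ->
  (sq a <= delta + ea)%R -> (sq b <= delta + eb)%R ->
  (J (fun x => (b x - a x) ^+ 2) <= 2 * (ea + eb))%R.
Proof.
move=> Ka Kb sa sb; have [ba _ _] := Ka; have [bb _ _] := Kb.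
have Km : K (fun x => (1 - 2^-1) * a x + 2^-1 * b x)%R.
  by apply: Kconv => //; rewrite invr_ge0 invf_le1//= ler0n ler1n.
have bm : bnd (fun x => (1 - 2^-1) * a x + 2^-1 * b x)%R by case: Km.
have : (sq a + sq b = 2 * sq (fun x => (1 - 2^-1) * a x + 2^-1 * b x) +
    2^-1 * J (fun x => (b x - a x) ^+ 2))%R.
  have bba := bnd_sqr (bndB bb ba).
  rewrite /sq -(bnd_integralD mE finE (bsq ba) (bsq bb)) -(bnd_integralZ mE finE 2%R (bsq bm)).
  rewrite -(bnd_integralZ mE finE 2^-1%R bba) -(bnd_integralD mE finE (bndZ _ (bsq bm)) (bndZ _ bba)).
  by congr (J _); apply/funext => x; field.
have := delta_le Km; lra.
Qed.

Let J1_ge0 : (0 <= J (fun=> 1%R))%R.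
Proof. exact: bnd_integral_ge0. Qed.

(** Young's inequality |y| <= y^2 / (2 e) + e / 2 passes from the squared L^2 distance to the L^1
    distance, in which the differences can be summed. *)
Let l1_bound (a b : T -> R) (e : R) : (0 < e)%R -> bnd a -> bnd b ->
  (J (fun x => (b x - a x) ^+ 2) <= 4 * e ^+ 2)%R ->
  (J (fun x => `|b x - a x|) <= e * (2 + J (fun=> 1%R)))%R.
Proof.
move=> e0 ba bb Jab; have bba := bndB bb ba.
have b1 := bndZ (e^-1 / 2)%R (bnd_sqr bba); have b2 := bndZ (e / 2)%R (bnd_cst T 1%R).
apply: (@le_trans _ _ (J (fun x => e^-1 / 2 * (b x - a x) ^+ 2 + e / 2 * 1))%R).
  apply: (le_bnd_integral mE finE (bnd_norm bba) (bndD b1 b2)) => x.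
  rewrite mulr1; set y := (b x - a x)%R.
  have -> : (e^-1 / 2 * y ^+ 2 + e / 2 = `|y| + e^-1 / 2 * (`|y| - e) ^+ 2)%R.
    have -> : (y ^+ 2 = `|y| ^+ 2)%R by rewrite real_normK// num_real.
    by field; rewrite gt_eqF.
  by rewrite lerDl mulr_ge0 ?sqr_ge0// divr_ge0// invr_ge0 ltW.
rewrite (bnd_integralD mE finE b1 b2) (bnd_integralZ mE finE _ (bnd_sqr bba)) (bnd_integralZ mE finE _ (bnd_cst T 1%R)).
have : (e^-1 / 2 * J (fun x => (b x - a x) ^+ 2) <= e^-1 / 2 * (4 * e ^+ 2))%R.
  by rewrite ler_pM2l// divr_gt0// invr_gt0.
have -> : (e^-1 / 2 * (4 * e ^+ 2) = 2 * e)%R by field; rewrite gt_eqF.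
by move: J1_ge0; nra.
Qed.

Let minimising_cvg (h : nat -> T -> R) : (forall n,
  [/\ K (h n), forall x, (h n x <= fr x)%R & (sq (h n) <= delta + q n ^+ 2)%R]) ->
  {ae mu, forall x, E x -> cvgn (fun n => h n x)}.
Proof.
move=> hP; pose dif (n : nat) (x : T) : R := `|h n.+1 x - h n x|%R.
have dif0 n x : (0 <= dif n x)%R by exact: normr_ge0.
have bh n : bnd (h n) by have [[]] := hP n.
have bdif n : bnd (dif n) by apply/bnd_norm/bndB.
have Jdif n : (J (dif n) <= q n * (2 + J (fun=> 1%R)))%R.
  apply: l1_bound => //; have [Kn _ sn] := hP n; have [Kn1 _ sn1] := hP n.+1.
  (* The errors q(n)^2 and q(n)^2 / 4 give 5/2 q(n)^2, which is below the 4 q(n)^2 required by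
     [l1_bound]. *)
  apply: (le_trans (parallelogram Kn Kn1 sn sn1)); rewrite qS.
  by have := q_gt0 n; nra.
(* The total variation of the sequence at x. It has a finite integral, so it is finite at almost
   every x, and there the telescoping series converges absolutely. *)
pose S x := \sum_(0 <= n <oo) (dif n x)%:E.
have mdif n : measurable_fun setT (EFin \o dif n).
  by apply/measurable_EFinP; exact: (bdif n).1.
have S0 x : 0 <= S x by apply: nneseries_ge0 => n _ _; rewrite lee_fin dif0.
have mS : measurable_fun setT S.
  apply: (@ge0_emeasurable_sum _ _ _ _ (fun n => EFin \o dif n) xpredT) => //.
  by move=> n x _ _; rewrite lee_fin dif0.
have Sfin : \int[mu]_(x in E) S x < +oo.
  rewrite integral_nneseries//; last 2 first.
  - by move=> n; apply: measurable_funTS; exact: mdif.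
  - by move=> n x _; rewrite lee_fin dif0.
  apply: (@le_lt_trans _ _ ((2 * (2 + J (fun=> 1%R)))%:E)); last by rewrite ltry.
  apply: lime_le.
    by apply: is_cvg_nneseries => n _ _; apply: integral_ge0 => x _; rewrite lee_fin dif0.
  apply: nearW => n; under eq_bigr do rewrite (bnd_integralE mE finE (bdif _)).
  rewrite sumEFin lee_fin (le_trans (ler_sum _ (fun k _ => Jdif k)))//.
  rewrite -mulr_suml sum_q ler_wpM2r ?addr_ge0// lerBlDr lerDl.
  by rewrite mulr_ge0// ltW.
have : mu.-integrable E S.
  apply/integrableP; split; first exact: measurable_funTS.
  by under eq_integral do rewrite gee0_abs//.
move=> /(integrable_ae mE); apply: filterS => x Sx Ex.
have {}Sx := Sx Ex.
have cvS : cvgn [normed series (telescope (h^~ x))].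
  apply: nondecreasing_is_cvgn.
    by apply: nondecreasing_series => n _ _; rewrite normr_ge0.
  exists (fine (S x)) => _ [n _ <-]; rewrite -lee_fin fineK// /series/= -sumEFin.
  apply: (@nneseries_lim_ge _ (fun n => (dif n x)%:E)) => k _ _; rewrite lee_fin.
  exact: normr_ge0.
have := normed_cvg cvS; rewrite telescopeK => cvB.
rewrite (_ : (fun n => h n x) = (fun n => (h n x - h 0%N x) + h 0%N x)%R); last first.
  by apply/funext => n; rewrite subrK.
by apply: is_cvgD => //; exact: is_cvg_cst.
Qed.

Lemma exists_minimiser : exists h' : T -> R, [/\ K h', forall x, (h' x <= fr x)%R &
  forall w : T -> R, K w -> (sq h' <= sq w)%R].
Proof.
have [h hP] := minimising; have := minimising_cvg hP => cv.
have mh n : measurable_fun setT (EFin \o h n).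
  by apply/measurable_EFinP; have [[[]]] := hP n.
have h0 n x : (0 <= h n x)%R by have [[]] := hP n.
have hfr n x : (h n x <= fr x)%R by have [_] := hP n.
(* The lower limit exists everywhere and lies between 0 and fr; almost everywhere on E it is the
   limit, which is all that Fatou's lemma for the squared distances needs. *)
pose l x := limn_einf (fun n => (h n x)%:E).
have lfr x : 0 <= l x <= (fr x)%:E.
  have cvl : cvgn (einfs (fun n => (h n x)%:E)).
    by apply: ereal_nondecreasing_is_cvgn; exact: nondecreasing_einfs.
  rewrite /l limn_einf_lim; apply/andP; split.
    apply: lime_ge => //; apply: nearW => n.
    by apply: le_ereal_inf_tmp => _ [m /= _ <-]; rewrite lee_fin.
  apply: lime_le => //; apply: nearW => n; apply: (@le_trans _ _ (h n x)%:E).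
    by apply: ereal_inf_lbound; exists n => /=.
  by rewrite lee_fin.
have lE x : (fine (l x))%:E = l x.
  by have /andP[l0 l1] := lfr x; rewrite fineK// ge0_fin_numE// (le_lt_trans l1)// ltry.
have lbnd x : (0 <= fine (l x) <= fr x)%R by rewrite -!lee_fin lE.
have ml : measurable_fun setT l by exact: (measurable_limn_einf mh).
have bl : bnd (fun x => fine (l x)).
  by apply: (bnd_le _ bfr) => //; apply: measurableT_comp.
have Kl : K (fun x => fine (l x)).
  split => //; first by move=> x; case/andP: (lbnd x).
  rewrite (_ : _ \o _ = l); last by apply/funext => x /=; rewrite lE.
  by apply: (norm_liminf mh) => [n x|n]; [rewrite lee_fin|have [[]] := hP n].
exists (fun x => fine (l x)); split => //; first by move=> x; case/andP: (lbnd x).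
move=> w Kw; apply: le_trans (delta_le Kw).
have cvsq : (sq (h n))%:E @[n --> \oo] --> delta%:E.
  apply: cvg_EFin; first exact: nearW.
  apply: (@squeeze_cvgr _ _ _ _ (cst delta) (fun n => delta + q n)%R).
  - apply: nearW => n; have [Kn _ sn] := hP n; rewrite delta_le//= (le_trans sn)//.
    by rewrite lerD2l expr2; have := q_gt0 n; have := q_le1 n; nra.
  - exact: cvg_cst.
  - rewrite -[X in _ --> X]addr0; apply: cvgD; first exact: cvg_cst.
    by apply: cvg_expr; rewrite gtr0_norm ?invr_gt0// invf_lt1// ltr1n.
have bh n : bnd (h n) by have [[]] := hP n.
rewrite -lee_fin /sq -(bnd_integralE mE finE (bsq bl)).
have <- : limn_einf (fun n => (sq (h n))%:E) = delta%:E by have [] := cvg_limn_einf_sup cvsq.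
under [X in _ <= limn_einf X]eq_fun => n do rewrite -(bnd_integralE mE finE (bsq (bh n))).
apply: le_trans (fatou mu mE _ _) => //; last 2 first.
- by move=> n; apply/measurable_EFinP/measurable_funTS; exact: (bsq (bh n)).1.
- by move=> n x _; rewrite lee_fin sqr_ge0.
apply: ae_ge0_le_integral => //.
- by move=> x _; rewrite lee_fin sqr_ge0.
- by apply/measurable_EFinP/measurable_funTS; exact: (bsq bl).1.
- move=> x _; rewrite limn_einf_lim; apply: lime_ge.
    by apply: ereal_nondecreasing_is_cvgn; exact: nondecreasing_einfs.
  apply: nearW => n; apply: le_ereal_inf_tmp => _ [m /= _ <-].
  by rewrite lee_fin sqr_ge0.
- apply: measurable_funTS; apply: measurable_limn_einf => n.
  by apply/measurable_EFinP; exact: (bsq (bh n)).1.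
apply: filterS cv => x cvx Ex; have {}cvx := cvx Ex.
have cvE : (h n x)%:E @[n --> \oo] --> (limn (fun n => h n x))%:E.
  by apply: cvg_EFin cvx; exact: nearW.
rewrite /l (cvg_limn_einf_sup cvE).1/=.
set a := limn _ in cvE *.
suff cvs : ((fr x - h n x) ^+ 2)%:E @[n --> \oo] --> ((fr x - a) ^+ 2)%:E.
  by rewrite (cvg_limn_einf_sup cvs).1.
apply: cvg_EFin; first exact: nearW.
under eq_fun do rewrite expr2; rewrite expr2.
by apply: cvgM; (apply: cvgB; [exact: cvg_cst|exact: cvx]).
Qed.

(** First-order condition at a minimum over a convex set: moving from h' towards w must not decrease
    the squared distance, so A below is nonpositive. *)
Let variation (h' w : T -> R) : K h' -> (forall w : T -> R, K w -> (sq h' <= sq w)%R) ->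
  K w -> (J (fun x => (fr x - h' x) * w x) <= J (fun x => (fr x - h' x) * h' x))%R.
Proof.
move=> Kh minh Kw; have [bh h0 _] := Kh; have [bw w0 _] := Kw.
have bg := bndB bfr bh.
pose A := J (fun x => (fr x - h' x) * (w x - h' x))%R.
pose B := J (fun x => (w x - h' x) ^+ 2)%R.
have bwh := bndB bw bh.
have B0 : (0 <= B)%R by apply: bnd_integral_ge0 => x; rewrite sqr_ge0.
suff A0 : (A <= 0)%R.
  rewrite -subr_le0 -(bnd_integralN mE finE (bndM bg bh)) -(bnd_integralD mE finE (bndM bg bw)).
    by rewrite (_ : (fun x => _) = fun x => (fr x - h' x) * (w x - h' x))%R//; apply/funext => x; ring.
  exact/bndZ/bndM.
rewrite leNgt; apply/negP => A0.
(* Along the segment the squared distance changes by t^2 B - 2 t A. This t lies in (0, 1] and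
   satisfies t B < A, which makes the change negative. *)
pose t := (A / (A + B + 1))%R.
have d0 : (0 < A + B + 1)%R by rewrite addr_gt0// ltr_pwDl.
have t0 : (0 < t)%R by rewrite divr_gt0.
have t1 : (t <= 1)%R by rewrite ler_pdivrMr// mul1r -addrA lerDl addr_ge0.
have Kt : K (fun x => (1 - t) * h' x + t * w x)%R by apply: Kconv => //; rewrite ltW.
have := minh _ Kt.
have -> : sq (fun x => (1 - t) * h' x + t * w x)%R = (sq h' + (- (2 * t) * A + t ^+ 2 * B))%R.
  rewrite /sq /A /B -(bnd_integralZ mE finE _ (bndM bg bwh)) -(bnd_integralZ mE finE _ (bnd_sqr bwh)).
  rewrite -(bnd_integralD mE finE (bndZ _ (bndM bg bwh)) (bndZ _ (bnd_sqr bwh))).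
  rewrite -(bnd_integralD mE finE (bsq bh) (bndD (bndZ _ (bndM bg bwh)) (bndZ _ (bnd_sqr bwh)))).
  by congr (J _); apply/funext => x; ring.
rewrite lerDl.
have tE : (t * (A + B + 1) = A)%R by rewrite divfK// gt_eqF.
nra.
Qed.

Lemma separation : 1 < N (EFin \o fr) ->
  exists g : T -> \bar R, [/\ measurable_fun setT g, forall x, 0 <= g x,
    forall w, mplus w -> N w <= 1 -> \int[mu]_(x in D) (w x * g x) <= 1 &
    1 < \int[mu]_(x in D) ((fr x)%:E * g x)].
Proof.
move=> N1; have [h' [Kh hfr minh]] := exists_minimiser.
have [bh h0 Nh] := Kh.
have bg := bndB bfr bh; have bgh := bndM bg bh.
have g0 x : (0 <= fr x - h' x)%R by rewrite subr_ge0.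
have g_out x : ~ E x -> (fr x - h' x = 0)%R.
  move=> Ex; apply/eqP; rewrite fr_out// sub0r oppr_eq0 eq_le h0 andbT.
  by rewrite -(fr_out Ex).
pose c := J (fun x => (fr x - h' x) * h' x)%R.
have c0 : (0 <= c)%R by apply: bnd_integral_ge0 => x; rewrite mulr_ge0.
have d0 : (0 < sq h')%R.
  rewrite lt_neqAle sq_ge0 andbT; apply/eqP => sq0.
  move: N1; apply/negP; rewrite -leNgt; apply: le_trans Nh.
  apply: N_mono; [exact: mplus_EFin mfr (fun x => proj1 (andP (fr_bnd x)))|exact: Kmplus|].
  have := bnd_integral_eq0 mE finE (bsq bh) (fun x => sqr_ge0 _) (esym sq0).
  apply: filterS => x Px _ /=; rewrite lee_fin -subr_le0.
  have [Ex|Ex] := pselect (E x); last by rewrite g_out.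
  by have /eqP := Px Ex; rewrite sqrf_eq0 => /eqP ->.
(* Pairing with fr - h' gives at most c on K and exactly c + [sq h'] at fr. Normalising by the value
   halfway puts K at most 1 and fr above 1. *)
pose s := (c + sq h' / 2)^-1%R.
have s0 : (0 < s)%R by rewrite invr_gt0 ltr_wpDl// divr_gt0.
pose g x := (s * (fr x - h' x))%R.
have bsg : bnd g by exact: bndZ.
have gge0 x : (0 <= g x)%R by rewrite mulr_ge0// ltW.
have restr (f : T -> \bar R) :
    \int[mu]_(x in D) (f x * (g x)%:E) = \int[mu]_(x in E) (f x * (g x)%:E).
  have {1}-> : E = D `&` E by rewrite setIidr.
  rewrite integral_mkcondr; apply: eq_integral => x _.
  rewrite patchE; case: ifPn => // /negP Ex.
  by rewrite /g g_out ?mulr0 ?mule0// => ?; apply: Ex; rewrite inE.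
exists (EFin \o g); split => /=.
- by apply/measurable_EFinP; exact: bsg.1.
- by move=> x; rewrite lee_fin.
- move=> w pw Nw.
  rewrite (aeD_eq_integral (g := fun x => pospart w x * (g x)%:E)); last 3 first.
  + by apply: emeasurable_funM; [exact: pw.1|apply: measurable_funTS; apply/measurable_EFinP; exact: bsg.1].
  + by apply: emeasurable_funM; apply: measurable_funTS; [exact: measurable_pospart pw.1|apply/measurable_EFinP; exact: bsg.1].
  + by apply: aeDS (pospart_ae pw) => x _ ->.
  rewrite restr leNgt; apply/negP => lt1.
  have mp : measurable_fun E (pospart w) by exact/measurable_funTS/measurable_pospart/pw.1.
  have mg : measurable_fun E (EFin \o g).
    by apply/measurable_funTS/measurable_EFinP; exact: bsg.1.
  have gge0' x : E x -> 0 <= (EFin \o g) x by rewrite lee_fin.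
  have pw0 x : E x -> 0 <= pospart w x by rewrite pospart_ge0.
  (* The function w may be unbounded. Its staircases are bounded, lie in the unit ball by (P2), and
     approximate the integral, so [variation] applies to them. *)
  have [e [n [e0]]] := lt_sum_layers mE mp pw0 mg gge0' lt1.
  rewrite -(integral_layers mu mE mp mg gge0' n (ltW e0)).
  apply/negP; rewrite -leNgt.
  pose w' x := (layers e n (pospart w x) : R).
  have mw' : measurable_fun setT w'.
    by apply: measurable_layers => //; exact: measurable_pospart pw.1.
  have w'0 x : (0 <= w' x)%R by rewrite layers_ge0 ?ltW.
  have Kw' : K w'.
    split => //; first by split => //; exists (n%:R * e)%R => x; rewrite ger0_norm//; apply: layers_le_max; exact: ltW.
    apply: le_trans Nw; apply: N_mono => //; first exact: mplus_EFin.
    by apply: aeDS (pospart_ae pw) => x _ <-; rewrite layers_le ?pospart_ge0.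
  have [bw' _ _] := Kw'.
  under eq_integral do rewrite -EFinM.
  rewrite (bnd_integralE mE finE (bndM bw' bsg)) lee_fin.
  rewrite (_ : (fun x => _) = fun x => s * ((fr x - h' x) * w' x))%R; last first.
    by apply/funext => x; rewrite /g; ring.
  rewrite (bnd_integralZ mE finE _ (bndM bg bw')).
  apply: (@le_trans _ _ (s * c)%R); first by rewrite ler_pM2l// variation.
  by rewrite /s mulrC ler_pdivrMr ?mul1r ?lerDl ?divr_ge0 ?ltW// -invr_gt0.
- rewrite restr; under eq_integral do rewrite -EFinM.
  rewrite (bnd_integralE mE finE (bndM bfr bsg)) lte_fin.
  rewrite (_ : (fun x => _) = fun x => s * ((fr x - h' x) * h' x + (fr x - h' x) ^+ 2))%R; last first.
    by apply/funext => x; rewrite /g; ring.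
  rewrite (bnd_integralZ mE finE _ (bndD bgh (bsq bh))) (bnd_integralD mE finE bgh (bsq bh)) -/c -/(sq h').
  rewrite /s mulrC ltr_pdivlMr ?mul1r; last by rewrite -invr_gt0.
  by rewrite ltrD2l ltr_pdivrMr// ltr_pMr// ltr1n.
Qed.

End minimisation.

Section exhaustion.
Variable D_ : nat -> set T.
Hypotheses (mD_ : forall n, measurable (D_ n)) (finD_ : forall n, mu (D_ n) < +oo)
  (ndD_ : nondecreasing_seq D_) (D_E : D = \bigcup_n D_ n).

Let cvg_min_nat (y : \bar R) : mine y n%:R%:E @[n --> \oo] --> y.
Proof.
have [->|yoo] := eqVneq y +oo.
  by under eq_fun do rewrite (min_idPr (leey _)); apply/cvgeryP; exact: cvgr_idn.
have [m ym] : exists m : nat, y <= m%:R%:E.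
  case: y yoo => [y _|//|_]; last by exists 0%N; rewrite leNye.
  exists (Num.bound `|y|%R); rewrite lee_fin (le_trans (ler_norm _))// ltW//.
  exact: archi_boundP.
apply: cvg_near_cst; exists m => // n /= mn; apply/min_idPl.
by rewrite (le_trans ym)// lee_fin ler_nat.
Qed.

Lemma lt_second_associate f (a : \bar R) : mplus f -> a < N f ->
  exists g, [/\ mplus g, forall w, mplus w -> N w <= 1 ->
    \int[mu]_(x in D) (w x * g x) <= 1 & a < \int[mu]_(x in D) (f x * g x)].
Proof.
move=> pf aN; have [a0|a0] := ltP a 0.
  exists (fun=> 0); split; [exact: mplus_cst| |].
    by move=> w _ _; rewrite integral0_eq// => x _; rewrite mule0.
  by rewrite integral0_eq// => x _; rewrite mule0.
pose fr n x := (fine (mine (pospart f x) n%:R%:E) * \1_(D_ n) x)%R.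
have min0 n x : 0 <= mine (pospart f x) n%:R%:E.
  by rewrite le_min pospart_ge0 lee_fin/=.
have minle n x : mine (pospart f x) n%:R%:E <= n%:R%:E by rewrite ge_min lexx orbT.
have minE n x : (fine (mine (pospart f x) n%:R%:E))%:E = mine (pospart f x) n%:R%:E.
  by rewrite fineK// ge0_fin_numE// (le_lt_trans (minle n x))// ltry.
have fr_bnd n x : (0 <= fr n x <= n%:R)%R.
  rewrite /fr indicE; case: (_ \in _); rewrite ?mulr1 ?mulr0 ?lexx ?ler0n//.
  by rewrite -!lee_fin minE min0 minle.
have fr0 n x : (0 <= fr n x)%R by case/andP: (fr_bnd n x).
have mfr n : measurable_fun setT (fr n).
  apply: measurable_funM; last exact: measurable_indic.
  apply: measurableT_comp => //; apply: measurable_mine => //.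
  exact: measurable_pospart pf.1.
have frE n x : (fr n x)%:E = (mine (pospart f x) n%:R%:E) * (\1_(D_ n) x)%:E.
  by rewrite EFinM minE.
have fr_nd x : nondecreasing_seq (fun n => (fr n x)%:E).
  move=> m n mn; rewrite !frE; apply: lee_pmul; rewrite ?lee_fin//.
    by rewrite le_min2// lee_fin ler_nat.
  rewrite !indicE; case: (boolP (x \in D_ m)) => // /set_mem xm.
  by rewrite mem_set//; move/subsetPset: (ndD_ mn); apply.
have fr_le n x : (fr n x)%:E <= pospart f x.
  rewrite frE indicE; case: (_ \in _); rewrite ?mule1 ?mule0 ?pospart_ge0//.
  by rewrite ge_min lexx.
have fr_cvg x : D x -> (fr n x)%:E @[n --> \oo] --> pospart f x.
  move=> Dx; have : D x by []; rewrite {1}D_E => -[m _ xm].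
  have eqn : {near \oo, (fun n => mine (pospart f x) n%:R%:E) =1 (fun n => (fr n x)%:E)}.
    exists m => // n /= mn; rewrite frE indicE mem_set ?mule1//.
    by move/subsetPset: (ndD_ mn); apply.
  apply: (cvg_trans (G := mine (pospart f x) n%:R%:E @[n --> \oo])).
    exact: near_eq_cvg eqn.
  exact: cvg_min_nat.
have pfr n : mplus (EFin \o fr n) by exact: mplus_EFin.
have ppf := mplus_pospart pf.1.
have [|_ cvN] := N_fatou pfr ppf.
  by apply: aeDW => x Dx; split; [exact: fr_nd|exact: fr_cvg].
have Nf : N f = N (pospart f).
  by apply/eqP; rewrite eq_le !N_mono//; apply: aeDS (pospart_ae pf) => x _ ->.
have [n an] : exists n, a < N (EFin \o fr n).
  apply: contrapT => /forallNP H; move: aN; apply/negP; rewrite -leNgt Nf.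
  by apply: (cvge_le _ cvN); apply: nearW => n; rewrite leNgt; apply/negP/H.
(* A real b strictly in between is positive even if a = 0 and finite even if the norm is not, so
   division by b brings the truncation to norm above 1. *)
have [b /andP[ab bN]] : exists b : R, a < b%:E < N (EFin \o fr n).
  case: a a0 an {aN} => [a||]//= a0 an; last by rewrite ltNge leey in an.
  move: an; case: (N (EFin \o fr n)) => [r||]//; last first.
    by exists (a + 1)%R; rewrite lte_fin ltrDl ltr01 ltry.
  rewrite lte_fin => ar; exists ((a + r) / 2)%R; rewrite !lte_fin.
  by apply/andP; split; lra.
have b0 : (0 < b)%R by rewrite -lte_fin (le_lt_trans a0).
pose fb x := (b^-1 * fr n x)%R.
have N1 : 1 < N (EFin \o fb).
  rewrite (_ : _ \o _ = fun x => b^-1%:E * (EFin \o fr n) x)//.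
  by rewrite N_scale ?invr_ge0 ?(ltW b0)// lte_pdivlMl// mule1.
have fb_bnd x : (0 <= fb x <= b^-1 * n%:R)%R.
  have /andP[x0 x1] := fr_bnd n x.
  by rewrite mulr_ge0 ?invr_ge0 ?(ltW b0)//= ler_wpM2l// invr_ge0 ltW.
have fb_out x : ~ D_ n x -> fb x = 0%R.
  by move=> Dx; rewrite /fb /fr indicE memNset// mulr0 mulr0.
have mfb : measurable_fun setT fb by exact: measurable_funM.
have D_D : D_ n `<=` D by rewrite D_E; exact: bigcup_sup.
have [g [mg g0 gN gf]] := separation (mD_ n) D_D (finD_ n) mfb fb_bnd fb_out N1.
exists g; split; [exact: mplus_ge0|exact: gN|].
apply: (lt_le_trans ab); apply: (@le_trans _ _ (\int[mu]_(x in D) ((fr n x)%:E * g x))).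
  move: gf; rewrite /fb; under eq_integral do rewrite EFinM -muleA.
  rewrite ge0_integralZl_EFin//.
  - by rewrite lte_pdivlMl// mule1 => /ltW.
  - by move=> x _; rewrite mule_ge0// lee_fin.
  - apply: emeasurable_funM; apply: measurable_funTS => //.
    exact/measurable_EFinP.
  - by rewrite invr_ge0 ltW.
have pg := mplus_ge0 mg g0.
apply: (le_integral_mplus (pfr n) pg pf pg); last exact: aeDW.
by apply: aeDS (pospart_ae pf) => x _ e; rewrite -e; exact: fr_le.
Qed.

End exhaustion.

End separation.

Lemma integral_mplusC f g : \int[mu]_(x in D) (f x * g x) = \int[mu]_(x in D) (g x * f x).
Proof. by apply: eq_integral => x _; rewrite muleC. Qed.

Let mpp f g : mplus f -> mplus g -> measurable_fun D (fun x => pospart f x * pospart g x).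
Proof.
by move=> pf pg; apply: emeasurable_funM; apply: measurable_funTS;
  apply: measurable_pospart; [exact: pf.1|exact: pg.1].
Qed.

Lemma integral_mplusD f g k : mplus f -> mplus g -> mplus k ->
  \int[mu]_(x in D) ((f x + g x) * k x) =
  \int[mu]_(x in D) (f x * k x) + \int[mu]_(x in D) (g x * k x).
Proof.
move=> pf pg pk.
rewrite (integral_pospart pf pk) (integral_pospart pg pk) -ge0_integralD//.
- apply: aeD_eq_integral.
  + exact: (emeasurable_funM (mplusD pf pg).1 pk.1).
  + by apply: emeasurable_funD; exact: mpp.
  + have H := aeDI (pospart_ae pk) (aeDI (pospart_ae pf) (pospart_ae pg)).
    apply: aeDS H => x _ [ek [ef eg]].
    by rewrite -ek -ef -eg ge0_muleDl ?pospart_ge0.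
- by move=> x _; rewrite mule_ge0 ?pospart_ge0.
- exact: mpp.
- by move=> x _; rewrite mule_ge0 ?pospart_ge0.
- exact: mpp.
Qed.

Lemma integral_mplusZ (r : R) f k : (0 <= r)%R -> mplus f -> mplus k ->
  \int[mu]_(x in D) (r%:E * f x * k x) = r%:E * \int[mu]_(x in D) (f x * k x).
Proof.
move=> r0 pf pk; rewrite (integral_pospart pf pk) -ge0_integralZl_EFin//.
- apply: aeD_eq_integral.
  + exact: (emeasurable_funM (mplus_scale r0 pf).1 pk.1).
  + by apply: measurable_funeM; exact: mpp.
  + apply: aeDS (aeDI (pospart_ae pk) (pospart_ae pf)) => x _ [ek ef].
    by rewrite -ek -ef muleA.
- by move=> x _; rewrite mule_ge0 ?pospart_ge0.
- exact: mpp.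
Qed.

Lemma integral_mplus_fatou (fk : nat -> T -> \bar R) f k (c : \bar R) :
  (forall n, mplus (fk n)) -> mplus f -> mplus k ->
  aeD (fun x => nondecreasing_seq (fk ^~ x) /\ fk n x @[n --> \oo] --> f x) ->
  (forall n, \int[mu]_(x in D) (fk n x * k x) <= c) ->
  \int[mu]_(x in D) (f x * k x) <= c.
Proof.
move=> pfk pf pk cv fkc.
have F0 n x : D x -> 0 <= pospart (fk n) x * pospart k x.
  by move=> _; rewrite mule_ge0 ?pospart_ge0.
have mF n := mpp (pfk n) pk.
apply: (@le_trans _ _ (\int[mu]_(x in D)
    limn_einf (fun n => pospart (fk n) x * pospart k x))); last first.
  apply: (le_trans (fatou mu mD mF F0)); rewrite limn_einf_lim; apply: lime_le.
    by apply: ereal_nondecreasing_is_cvgn; exact: nondecreasing_einfs.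
  apply: nearW => n; apply: (@le_trans _ _ (\int[mu]_(x in D) (fk n x * k x))) => //.
  rewrite (integral_pospart (pfk n) pk).
  by apply: ereal_inf_lbound; exists n => /=.
rewrite (integral_pospart pf pk); apply: ae_ge0_le_integral => //.
- by move=> x _; rewrite mule_ge0 ?pospart_ge0.
- exact: mpp.
- move=> x Dx; rewrite limn_einf_lim; apply: lime_ge.
    by apply: ereal_nondecreasing_is_cvgn; exact: nondecreasing_einfs.
  by apply: nearW => n; apply: le_ereal_inf_tmp => _ [m /= _ <-]; exact: F0.
- apply: (measurable_funTS (measurable_limn_einf _)) => n.
  by apply: emeasurable_funM; apply: measurable_pospart; [exact: (pfk n).1|exact: pk.1].
have pfk_ae : aeD (fun x => forall n, pospart (fk n) x = fk n x).
  have : {ae mu, forall x, forall n, D x -> pospart (fk n) x = fk n x}.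
    by apply/ae_foralln => n; exact: (pospart_ae (pfk n)).
  by apply: filterS => x H Dx n; exact: H.
apply: aeDS (aeDI (pospart_ae pf) (aeDI cv pfk_ae)) => x Dx [ef [[nd cvx] efk]].
set y := pospart k x; have y0 : 0 <= y by exact: pospart_ge0.
rewrite ef; under [X in _ <= limn_einf X]eq_fun do rewrite efk.
suff cvy : fk n x * y @[n --> \oo] --> f x * y by rewrite (cvg_limn_einf_sup cvy).1.
have [->|ny0] := eqVneq y 0.
  by under eq_fun do rewrite mule0; rewrite mule0; exact: cvg_cst.
have fk_le n : fk n x <= f x.
  have := ereal_nondecreasing_cvgn nd => /(cvg_unique _ cvx) ->//.
  by apply: ereal_sup_ubound; exists n.
have [fx0|nf0] := eqVneq (f x) 0.
  have H0 n : fk n x * y = 0.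
    have -> : fk n x = 0 by apply/eqP; rewrite eq_le -{1}fx0 fk_le -efk pospart_ge0.
    by rewrite mul0e.
  by under eq_fun do rewrite H0; rewrite fx0 mul0e; exact: cvg_cst.
apply: cvgeM => //; last exact: cvg_cst.
by rewrite mule_defE (negbTE nf0) (negbTE ny0).
Qed.

Section polar.
Variable S : set (T -> \bar R).
Hypothesis S_mplus : forall k, S k -> mplus k.

(** The support function of S. Associate norms are of this form, and by resonance so is the norm of
    the theorem, which lets the common axioms be proved once for all S. *)
Definition polar (S : set (T -> \bar R)) f : \bar R :=
  ereal_sup [set \int[mu]_(x in D) (f x * k x) | k in S].

Lemma le_polar f k : S k -> \int[mu]_(x in D) (f x * k x) <= polar S f.
Proof. by move=> Sk; apply: ereal_sup_ubound; exists k. Qed.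

Lemma polar_le f (c : \bar R) :
  (forall k, S k -> \int[mu]_(x in D) (f x * k x) <= c) -> polar S f <= c.
Proof. by move=> H; apply: ge_ereal_sup => _ [k Sk <-]; exact: H. Qed.

Hypothesis S0 : S !=set0.

Lemma polar_ge0 f : mplus f -> 0 <= polar S f.
Proof.
move=> pf; have [k Sk] := S0; apply: le_trans (le_polar f Sk).
by apply: integral_mplus_ge0 => //; exact: S_mplus.
Qed.

Lemma polar_mono f g : mplus f -> mplus g -> aeD (fun x => f x <= g x) ->
  polar S f <= polar S g.
Proof.
move=> pf pg fg; apply: polar_le => k Sk; apply: le_trans (le_polar g Sk).
by have pk := S_mplus Sk; apply: le_integral_mplus => //; exact: aeDW.
Qed.

Lemma polar_triangle f g : mplus f -> mplus g ->
  polar S (fun x => f x + g x) <= polar S f + polar S g.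
Proof.
move=> pf pg; apply: polar_le => k Sk; have pk := S_mplus Sk.
by rewrite integral_mplusD// leeD// le_polar.
Qed.

Lemma polar_scale (r : R) f : (0 <= r)%R -> mplus f ->
  polar S (fun x => r%:E * f x) = r%:E * polar S f.
Proof.
move=> r0 pf; apply/eqP; rewrite eq_le; apply/andP; split.
  apply: polar_le => k Sk; rewrite integral_mplusZ//; last exact: S_mplus.
  by rewrite lee_wpmul2l// le_polar.
have [->|rn0] := eqVneq r 0%R; first by rewrite mul0e polar_ge0//; exact: mplus_scale.
have {rn0} r0 : (0 < r)%R by rewrite lt_neqAle eq_sym rn0.
rewrite -lee_pdivlMl//; apply: polar_le => k Sk.
rewrite lee_pdivlMl// -integral_mplusZ ?(ltW r0)//; last exact: S_mplus.
exact: (le_polar (fun x => r%:E * f x)).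
Qed.

Lemma polar_fatou (fk : nat -> T -> \bar R) f :
  (forall n, mplus (fk n)) -> mplus f ->
  aeD (fun x => nondecreasing_seq (fk ^~ x) /\ fk n x @[n --> \oo] --> f x) ->
  nondecreasing_seq (fun n => polar S (fk n)) /\ polar S (fk n) @[n --> \oo] --> polar S f.
Proof.
move=> pfk pf cv.
have nd : nondecreasing_seq (fun n => polar S (fk n)).
  by move=> m n mn; apply: polar_mono => //; apply: aeDS cv => x _ [+ _]; exact.
split => //; have := ereal_nondecreasing_cvgn nd.
set s := ereal_sup _; suff -> : s = polar S f by [].
apply/eqP; rewrite eq_le; apply/andP; split.
  apply: ge_ereal_sup => _ [n _ <-]; apply: polar_mono => //.
  apply: aeDS cv => x _ [ndx cvx].
  have := ereal_nondecreasing_cvgn ndx => /(cvg_unique _ cvx) ->//.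
  by apply: ereal_sup_ubound; exists n.
apply: polar_le => k Sk; apply: integral_mplus_fatou cv _ => //; first exact: S_mplus.
by move=> n; apply: le_trans (le_polar (fk n) Sk) _; apply: ereal_sup_ubound; exists n.
Qed.

End polar.

End function_norm.

(** * Associate norms and rearrangement-closed polars *)

Section associate_norm.
Local Open Scope ereal_scope.
Context d (T : measurableType d) (R : realType) (mu : {measure set T -> \bar R}).
Variables (D : set T) (mD : measurable D).
Implicit Types (f g h k w : T -> \bar R) (N : (T -> \bar R) -> \bar R).

Local Notation mplus := (mplus mu D).
Local Notation aeD := (aeD mu D).
Local Notation equim := (equim mu D).
Local Notation polar := (polar mu D).

Definition assoc N f : \bar R := polar [set g | mplus g /\ N g <= 1] f.

(** The axioms common to all polars of nonempty sets. Definiteness, (P4), (P5) and (P6) depend on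
    the set and are established separately. *)
Record fnorm N : Prop := FNorm {
  fn_ge0 : forall f, mplus f -> 0 <= N f ;
  fn_scale : forall (l : R) f, (0 <= l)%R -> mplus f ->
    N (fun x => l%:E * f x) = l%:E * N f ;
  fn_triangle : forall f g, mplus f -> mplus g ->
    N (fun x => f x + g x) <= N f + N g ;
  fn_mono : forall f g, mplus f -> mplus g ->
    aeD (fun x => f x <= g x) -> N f <= N g ;
  fn_fatou : forall (fk : nat -> T -> \bar R) f,
    (forall n, mplus (fk n)) -> mplus f ->
    aeD (fun x => nondecreasing_seq (fk ^~ x) /\ fk n x @[n --> \oo] --> f x) ->
    nondecreasing_seq (fun n => N (fk n)) /\ N (fk n) @[n --> \oo] --> N f }.

Lemma fnorm_polar (S : set (T -> \bar R)) : (forall k, S k -> mplus k) ->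
  S !=set0 -> fnorm (polar S).
Proof.
move=> Sp S0; split.
- exact: polar_ge0.
- exact: polar_scale.
- exact: polar_triangle.
- exact: polar_mono.
- exact: polar_fatou.
Qed.

Lemma polar_eqD (S : set (T -> \bar R)) f g : (forall x, D x -> f x = g x) ->
  polar S f = polar S g.
Proof.
move=> fg; congr ereal_sup; apply: eq_imagel => k _.
by apply: eq_integral => x /set_mem Dx; rewrite fg.
Qed.

Lemma assoc_ball_mplus N g : [set g | mplus g /\ N g <= 1] g -> mplus g.
Proof. by case. Qed.

Lemma assoc_ball_neq0 N : fnorm N -> [set g | mplus g /\ N g <= 1] !=set0.
Proof.
move=> nN; exists (fun=> 0); split; first exact: mplus_cst.
by rewrite (norm_cst0 (fn_scale nN)).
Qed.

Lemma fnorm_assoc N : fnorm N -> fnorm (assoc N).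
Proof.
by move=> nN; apply: fnorm_polar; [exact: assoc_ball_mplus|exact: assoc_ball_neq0].
Qed.

Lemma le_assoc N f g : mplus g -> N g <= 1 ->
  \int[mu]_(x in D) (f x * g x) <= assoc N f.
Proof. by move=> pg Ng; apply: le_polar. Qed.

(** A positive real bound c stands in for [N f], so that f can be normalised also when [N f] is
    0. *)
Lemma holder N f g (c : R) : fnorm N -> mplus f -> mplus g -> (0 < c)%R ->
  N f <= c%:E -> \int[mu]_(x in D) (f x * g x) <= c%:E * assoc N g.
Proof.
move=> nN pf pg c0 Nf; have c1 : (0 <= c^-1)%R by rewrite invr_ge0 ltW.
rewrite -lee_pdivrMl// -integral_mplusZ// integral_mplusC.
apply: le_assoc; first exact: mplus_scale.
by rewrite (fn_scale nN)// lee_pdivrMl// mule1.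
Qed.

Lemma holder_dual N f g (c : R) : fnorm N -> mplus f -> mplus g -> (0 < c)%R ->
  assoc N g <= c%:E -> \int[mu]_(x in D) (f x * g x) <= c%:E * N f.
Proof.
move=> nN pf pg c0 Ng; have := fn_ge0 nN pf.
case Nf : (N f) => [r||]// r0; last by rewrite gt0_muley ?lte_fin// leey.
rewrite lee_fin in r0; rewrite -EFinM; apply/lee_addgt0Pr => e e0.
(* This bound is positive even if [N f] is 0, and after multiplication by c it costs only e. *)
have re0 : (0 < r + e / c)%R by rewrite ltr_wpDl// divr_gt0.
have Nfe : N f <= (r + e / c)%:E.
  by rewrite Nf lee_fin lerDl; apply: divr_ge0; exact: ltW.
apply: le_trans (holder nN pf pg re0 Nfe) _; apply: (@le_trans _ _ ((r + e / c)%:E * c%:E)).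
  by rewrite lee_wpmul2l// lee_fin ltW.
by rewrite -EFinM -EFinD lee_fin mulrDl divfK ?gt_eqF// mulrC.
Qed.

Section second_associate.
Variable D_ : nat -> set T.
Hypotheses (mD_ : forall n, measurable (D_ n)) (finD_ : forall n, mu (D_ n) < +oo)
  (ndD_ : nondecreasing_seq D_) (D_E : D = \bigcup_n D_ n).

Lemma second_associate N f : fnorm N -> mplus f -> N f <= assoc (assoc N) f.
Proof.
move=> nN pf; rewrite leNgt; apply/negP => /[dup] lt_f.
move=> /(lt_second_associate mD (fn_scale nN) (fn_triangle nN)
  (fn_mono nN) (fn_fatou nN) mD_ finD_ ndD_ D_E pf)[g [pg gN]].
apply/negP; rewrite -leNgt; apply: le_assoc => //.
by apply: polar_le => w [pw Nw]; rewrite integral_mplusC gN.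
Qed.

Lemma equim_sym f g : equim f g -> equim g f.
Proof. by move=> fg l l0; rewrite fg. Qed.

Lemma equim_trans f g h : equim f g -> equim g h -> equim f h.
Proof. by move=> fg gh l l0; rewrite fg// gh. Qed.

Let mlev f (l : R) : measurable_fun D f -> measurable [set x | D x /\ l%:E < `|f x|].
Proof.
move=> mf; apply: (emeasurable_fun_o_infty mD (f := abse \o f)).
exact: measurableT_comp.
Qed.

Lemma equim_ae f g : measurable_fun D f -> measurable_fun D g ->
  aeD (fun x => f x = g x) -> equim f g.
Proof.
move=> mf mg fg l l0.
have sub h : [set x | D x /\ l%:E < `|h x|] `&` D = [set x | D x /\ l%:E < `|h x|].
  by apply: setIidl => x [].
rewrite -(sub f) -(sub g) -!integral_indic//; try exact: mlev.
apply: aeD_eq_integral => //.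
- by apply/measurable_EFinP/measurable_indic; exact: mlev.
- by apply/measurable_EFinP/measurable_indic; exact: mlev.
- apply: aeDS fg => x Dx fgx; congr (_%:E); rewrite !indicE; congr (_ : bool)%:R.
  by apply/idP/idP; rewrite !inE/= fgx.
Qed.

Section resonance_nonneg.
Hypothesis res : forall f h k (a : \bar R),
  measurable_fun setT f -> (forall x, 0 <= f x) ->
  measurable_fun setT h -> (forall x, 0 <= h x) ->
  measurable_fun setT k -> (forall x, 0 <= k x) ->
  equim h f -> a < \int[mu]_(x in D) (h x * k x) ->
  exists k', [/\ measurable_fun setT k', forall x, 0 <= k' x,
    equim k' k & a < \int[mu]_(x in D) (f x * k' x)].

Lemma resonance f h k (a : \bar R) : mplus f -> mplus h -> mplus k ->
  equim h f -> a < \int[mu]_(x in D) (h x * k x) ->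
  exists k', [/\ mplus k', equim k' k & a < \int[mu]_(x in D) (f x * k' x)].
Proof.
move=> pf ph pk hf; rewrite (integral_pospart mD ph pk).
have eqp g : mplus g -> equim (pospart D g) g.
  move=> pg; apply: equim_ae; [exact: (mplus_pospart mu mD pg.1).1|exact: pg.1|].
  exact: pospart_ae.
have hf' : equim (pospart D h) (pospart D f).
  exact: equim_trans (eqp _ ph) (equim_trans hf (equim_sym (eqp _ pf))).
move=> /(res (measurable_pospart mD pf.1) (pospart_ge0 D f)
  (measurable_pospart mD ph.1) (pospart_ge0 D h)
  (measurable_pospart mD pk.1) (pospart_ge0 D k) hf')[k' [mk' k'0 k'k ak']].
have pk' := mplus_ge0 mu D mk' k'0.
exists k'; split => //; first exact: equim_trans k'k (eqp _ pk).
apply: (lt_le_trans ak'); apply: le_integral_mplus => //.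
- exact: mplus_pospart pf.1.
- by apply: aeDS (pospart_ae pf) => x _ ->.
- exact: aeDW.
Qed.

End resonance_nonneg.

Hypothesis reso : forall f h k (a : \bar R), mplus f -> mplus h -> mplus k ->
  equim h f -> a < \int[mu]_(x in D) (h x * k x) ->
  exists k', [/\ mplus k', equim k' k & a < \int[mu]_(x in D) (f x * k' x)].

Variable S0 : set (T -> \bar R).
Hypotheses (S0_mplus : forall k, S0 k -> mplus k) (S0_neq0 : S0 !=set0).

Definition ri_polar f : \bar R :=
  ereal_sup [set polar S0 h | h in [set h | mplus h /\ equim h f]].

Let S1 := [set k' | mplus k' /\ exists2 k, S0 k & equim k' k].

Lemma le_ri_polar f h k : mplus h -> equim h f -> S0 k ->
  \int[mu]_(x in D) (h x * k x) <= ri_polar f.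
Proof.
move=> ph hf S0k; apply: le_trans (le_polar mu D h S0k) _.
by apply: ereal_sup_ubound; exists h.
Qed.

Lemma ri_polar_equim f g : equim f g -> ri_polar f = ri_polar g.
Proof.
move=> fg; congr (ereal_sup (image _ _)); apply/seteqP; split => h [ph hf]; split => //.
  exact: equim_trans hf fg.
exact: equim_trans hf (equim_sym fg).
Qed.

(** In [ri_polar] the set of competitors varies with f, which hides subadditivity and (P3).
    Resonance, applied once in each direction, moves the rearrangement to the fixed set S1. *)
Lemma ri_polarE f : mplus f -> ri_polar f = polar S1 f.
Proof.
move=> pf; apply/eqP; rewrite eq_le; apply/andP; split.
- apply: ge_ereal_sup => _ [h [ph hf] <-]; apply: polar_le => k S0k.
  have pk := S0_mplus S0k; rewrite leNgt; apply/negP.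
  move=> /(reso pf ph pk hf)[k' [pk' k'k]]; apply/negP; rewrite -leNgt.
  by apply: le_polar; split => //; exists k.
- apply: polar_le => k' [pk' [k S0k k'k]]; rewrite leNgt; apply/negP.
  have pk := S0_mplus S0k; rewrite integral_mplusC.
  move=> /(reso pk pk' pf k'k)[f' [pf' f'f]]; apply/negP; rewrite -leNgt.
  by rewrite integral_mplusC; exact: le_ri_polar.
Qed.

Let S1_mplus k : S1 k -> mplus k.
Proof. by case. Qed.

Let S0S1 k : S0 k -> S1 k.
Proof. by move=> S0k; split; [exact: S0_mplus|exists k]. Qed.

Let S1_neq0 : S1 !=set0.
Proof. by have [k /S0S1 ?] := S0_neq0; exists k. Qed.

Lemma fnorm_ri_polar : fnorm ri_polar.
Proof.
have n1 := fnorm_polar S1_mplus S1_neq0; split.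
- by move=> f pf; rewrite ri_polarE// (fn_ge0 n1).
- by move=> l f l0 pf; rewrite !ri_polarE ?(fn_scale n1)//; exact: mplus_scale.
- by move=> f g pf pg; rewrite !ri_polarE ?(fn_triangle n1)//; exact: mplusD.
- by move=> f g pf pg fg; rewrite !ri_polarE ?(fn_mono n1).
- move=> fk f pfk pf cv; rewrite ri_polarE//.
  under eq_fun do rewrite ri_polarE//.
  by have := fn_fatou n1 pfk pf cv.
Qed.

Lemma second_associate_ri_polar f : mplus f -> assoc (assoc ri_polar) f = ri_polar f.
Proof.
move=> pf; apply/eqP; rewrite eq_le second_associate ?andbT//; last exact: fnorm_ri_polar.
have := fn_ge0 fnorm_ri_polar pf.
case E : (ri_polar f) => [r||]// r0; last by rewrite leey.
apply: polar_le => g [pg Ng]; rewrite lee_fin in r0.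
apply/lee_addgt0Pr => e e0; have re0 : (0 < r + e)%R by rewrite ltr_wpDl.
have := holder fnorm_ri_polar pf pg re0; rewrite E lee_fin lerDl ltW// => /(_ isT).
move=> /le_trans; apply; rewrite -EFinD -[leRHS]mule1.
by rewrite lee_wpmul2l// lee_fin ltW.
Qed.

Lemma assoc_ri_polar_equim f g : mplus f -> mplus g -> equim f g ->
  assoc ri_polar f = assoc ri_polar g.
Proof.
wlog suff le : f g / mplus f -> mplus g -> equim f g ->
    assoc ri_polar f <= assoc ri_polar g.
  move=> pf pg fg; apply/eqP; rewrite eq_le !le//; exact: equim_sym.
move=> pf pg fg; apply: polar_le => k [pk Nk]; rewrite leNgt; apply/negP.
move=> /(reso pg pf pk fg)[k' [pk' k'k]]; apply/negP; rewrite -leNgt.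
by apply: le_assoc => //; rewrite (ri_polar_equim k'k).
Qed.

(** By Hoelder the integral of f over [D_ n] is controlled by the associate norm as soon as the
    indicator of [D_ n] has finite norm; if the former norm is 0, then f vanishes on each [D_ n]. *)
Lemma assoc_ri_polar_eq0 f : (forall n, ri_polar (fun x => (\1_(D_ n) x)%:E) < +oo) ->
  mplus f -> assoc ri_polar f = 0 <-> aeD (fun x => f x = 0).
Proof.
move=> fin pf; have nP := fnorm_ri_polar; split=> [N0|f0]; last first.
  apply/eqP; rewrite eq_le (fn_ge0 (fnorm_assoc nP))// andbT.
  apply: polar_le => g [pg _]; rewrite (aeD_eq_integral mD (g := fun=> 0)).
  - by rewrite integral0.
  - exact: (emeasurable_funM pf.1 pg.1).
  - exact: measurable_cst.
  - by apply: aeDS f0 => x _ ->; rewrite mul0e.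
have p1 n : mplus (fun x => (\1_(D_ n) x)%:E).
  by apply: (mplus_EFin mu D) => // x; rewrite indicE.
have int0 n : \int[mu]_(x in D) ((\1_(D_ n) x)%:E * f x) = 0.
  apply/eqP; rewrite eq_le integral_mplus_ge0// andbT.
  have c0 : (0 < fine (ri_polar (fun x => (\1_(D_ n) x)%:E)) + 1)%R.
    by rewrite ltr_wpDl// fine_ge0// (fn_ge0 nP).
  have := holder nP (p1 n) pf c0; rewrite N0 mule0; apply.
  rewrite EFinD fineK ?leeDl// ge0_fin_numE ?fin//; exact: (fn_ge0 nP).
have H : {ae mu, forall x, forall n, D x -> (\1_(D_ n) x)%:E * pospart D f x = 0}.
  apply/ae_foralln => n.
  have mF : measurable_fun D (fun x => (\1_(D_ n) x)%:E * pospart D f x).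
    by apply: emeasurable_funM; apply: measurable_funTS; [exact/measurable_EFinP|exact: measurable_pospart pf.1].
  have := (ae_eq_integral_abs mu mD mF).1; apply.
  rewrite -[RHS](int0 n); apply: aeD_eq_integral => //.
  + exact: measurableT_comp.
  + exact: (emeasurable_funM (p1 n).1 pf.1).
  + apply: aeDS (pospart_ae pf) => x _ <-.
    by rewrite gee0_abs// mule_ge0 ?pospart_ge0// lee_fin indicE.
have {}H : aeD (fun x => forall n, (\1_(D_ n) x)%:E * pospart D f x = 0).
  by apply: filterS H => x H Dx n; exact: H.
apply: aeDS (aeDI H (pospart_ae pf)) => x; rewrite {1}D_E => -[n _ xn] [+ <-].
by move=> /(_ n); rewrite indicE mem_set// mul1e.
Qed.

(** This yields boundedness of the operator with constant 1. N is below its second associate, whose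
    test functions g satisfy [ri_polar g <= 1], and k is among the functions against which
    [ri_polar] tests. *)
Lemma norm_le1_polar N k : fnorm N -> (forall g, mplus g -> assoc N g = ri_polar g) ->
  S0 k -> N k <= 1.
Proof.
move=> nN NE S0k; have pk := S0_mplus S0k.
apply: le_trans (second_associate nN pk) _; apply: polar_le => g [pg].
rewrite NE// => Ng; apply: le_trans Ng; rewrite integral_mplusC.
exact: le_ri_polar.
Qed.

(** Optimality by duality: N' is at most c on S0, hence by (P6) on all rearrangements of S0, so the
    unit ball of its associate norm lies in the ball of radius c of [ri_polar]. *)
Lemma norm_le_optimal N N' (c : R) : fnorm N -> fnorm N' ->
  (forall f g, mplus f -> mplus g -> equim f g -> N' f = N' g) -> (0 < c)%R ->
  (forall g, mplus g -> assoc N g = ri_polar g) ->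
  (forall k, S0 k -> N' k <= c%:E) -> forall f, mplus f -> N' f <= c%:E * N f.
Proof.
move=> nN nN' equiN' c0 NE N'c f pf.
apply: le_trans (second_associate nN' pf) _; apply: polar_le => g [pg N'g].
apply: holder_dual => //; rewrite NE// ri_polarE//.
apply: polar_le => k' [pk' [k S0k k'k]]; rewrite integral_mplusC.
have N'k' : N' k' <= c%:E by rewrite (equiN' _ _ pk' (S0_mplus S0k) k'k) N'c.
apply: le_trans (holder nN' pk' pg c0 N'k') _.
by rewrite -[leRHS]mule1 lee_wpmul2l// lee_fin ltW.
Qed.

End second_associate.
End associate_norm.

(** * Rearrangement-invariant polars of indicators *)

Section indicators.
Local Open Scope ereal_scope.
Context d (T : measurableType d) (R : realType) (mu : {measure set T -> \bar R}).
Variables (D : set T) (mD : measurable D).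
Implicit Types (f g h k w : T -> \bar R).

Definition ind (E : set T) : T -> \bar R := fun x => (\1_E x)%:E.

Lemma mplus_ind (E : set T) : measurable E -> mplus mu D (ind E).
Proof.
move=> mE; apply: mplus_ge0 => [|x]; last by rewrite lee_fin indicE.
by apply/measurable_EFinP; exact: measurable_indic.
Qed.

Lemma integral_indI (A E : set T) f :
  \int[mu]_(x in A) (ind E x * f x) = \int[mu]_(x in A `&` E) f x.
Proof.
by rewrite integral_mkcondr; apply: eq_integral => x _; rewrite epatch_indic muleC.
Qed.

Lemma integral_ind (E : set T) f : E `<=` D ->
  \int[mu]_(x in D) (ind E x * f x) = \int[mu]_(x in E) f x.
Proof.
move=> ED; by rewrite integral_indI setIidr.
Qed.

Lemma integral_ind1 (E : set T) : measurable E -> E `<=` D ->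
  \int[mu]_(x in D) ind E x = mu E.
Proof.
move=> mE ED; rewrite integral_indic//; congr (mu _); exact: setIidl.
Qed.

Let lev_ind (E : set T) (l : R) : E `<=` D -> (0 < l)%R ->
  [set x | D x /\ l%:E < `|ind E x|] = if (l < 1)%R then E else set0.
Proof.
move=> ED l0; apply/seteqP; split => x /=; rewrite /ind indicE.
  case: (boolP (x \in E)) => [/set_mem Ex|_] [_ lx]; move: lx; rewrite /= ?normr1 ?normr0 lte_fin.
    by move=> ->.
  by move=> /(lt_trans l0); rewrite ltxx.
case: ifPn => //= l1 Ex; rewrite mem_set//= normr1 lte_fin l1; split => //.
exact: ED.
Qed.

Lemma equim_ind (A B : set T) : A `<=` D -> B `<=` D -> mu A = mu B ->
  equim mu D (ind A) (ind B).
Proof.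
by move=> AD BD AB l l0; rewrite !lev_ind//; case: ifP => // _.
Qed.

Lemma equim_ind_le1 h (E : set T) : E `<=` D -> measurable_fun D h ->
  equim mu D h (ind E) -> aeD mu D (fun x => `|h x| <= 1).
Proof.
move=> ED mh hE; have := hE 1%R ltr01; rewrite lev_ind// ltxx measure0 => H.
exists [set x | D x /\ 1 < `|h x|]; split => //.
  by apply: (emeasurable_fun_o_infty mD (f := abse \o h)); exact: measurableT_comp.
by move=> x /= /not_implyP[Dx /negP]; rewrite -ltNge.
Qed.

Lemma equim_ind_integral h (E : set T) : measurable E -> E `<=` D ->
  measurable_fun D h -> equim mu D h (ind E) -> \int[mu]_(x in D) `|h x| = mu E.
Proof.
move=> mE ED mh hE; rewrite -(integral_ind1 mE ED).
apply: eq_integral_distribution => //.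
- exact: measurableT_comp.
- exact: (mplus_ind mE).1.
- by move=> x _; rewrite lee_fin indicE.
- move=> l l0; have := hE l l0; rewrite /setI/= => ->; congr (mu _).
  by apply/seteqP; split => x /=; rewrite /ind ger0_norm ?indicE.
Qed.

Section resonance_indicators.
Hypothesis res : forall f h k (a : \bar R), mplus mu D f -> mplus mu D h ->
  mplus mu D k -> equim mu D h f -> a < \int[mu]_(x in D) (h x * k x) ->
  exists k', [/\ mplus mu D k', equim mu D k' k & a < \int[mu]_(x in D) (f x * k' x)].

(** Resonance for two indicators. It carries an estimate on one convenient set to every set of the
    same measure. *)
Lemma integral_ind_swap (A B : set T) g (a : \bar R) : measurable A -> A `<=` D ->
  measurable B -> B `<=` D -> mu A = mu B -> mplus mu D g ->
  a < \int[mu]_(x in A) g x ->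
  exists g', [/\ mplus mu D g', equim mu D g' g & a < \int[mu]_(x in B) g' x].
Proof.
move=> mA AD mB BD AB pg; rewrite -(integral_ind _ AD).
move=> /(res (mplus_ind mB) (mplus_ind mA) pg (equim_ind AD BD AB)).
by case=> g' [pg' g'g]; rewrite integral_ind//; exists g'.
Qed.

Variable S0 : set (T -> \bar R).
Hypothesis S0_mplus : forall k, S0 k -> mplus mu D k.

(** A rearrangement h of the indicator of E is at most 1 and has integral |E|. The first fact bounds
    the part of the pairing over E0, the second the part where k <= M. *)
Lemma ri_polar_ind_fin (E E0 : set T) (M : R) : measurable E -> E `<=` D -> mu E < +oo ->
  measurable E0 -> E0 `<=` D -> polar mu D S0 (ind E0) < +oo -> (0 <= M)%R ->
  (forall k s, S0 k -> D s -> ~ E0 s -> k s <= M%:E) -> ri_polar mu D S0 (ind E) < +oo.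
Proof.
move=> mE ED finE mE0 E0D fin0 M0 kM.
apply: (@le_lt_trans _ _ (polar mu D S0 (ind E0) + M%:E * mu E)); last first.
  rewrite lte_add_pinfty// lte_mul_pinfty//; rewrite ?lee_fin//.
apply: ge_ereal_sup => _ [h [ph hE] <-]; apply: polar_le => k S0k.
have pk := S0_mplus S0k; have h1 := equim_ind_le1 ED ph.1 hE.
have mC : measurable (D `\` E0) by exact: measurableD.
have pC := mplus_ind mC; have pE0 := mplus_ind mE0.
have pM f g : mplus mu D f -> mplus mu D g -> mplus mu D (fun x => f x * g x).
  move=> pf pg; split; first exact: (emeasurable_funM pf.1 pg.1).
  by apply: aeDS (aeDI pf.2 pg.2) => x _ [f0 g0]; rewrite mule_ge0.
have -> : \int[mu]_(x in D) (h x * k x) =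
    \int[mu]_(x in D) ((h x * ind E0 x + h x * ind (D `\` E0) x) * k x).
  apply: eq_integral => x /set_mem Dx; congr (_ * _).
  rewrite /ind !indicE in_setD (mem_set Dx)/=.
  by case: (x \in E0); rewrite ?mule1 ?mule0 ?adde0 ?add0e.
rewrite (integral_mplusD mD (pM _ _ ph pE0) (pM _ _ ph pC) pk); apply: leeD.
  apply: (le_trans _ (le_polar mu D (ind E0) S0k)).
  apply: (le_integral_mplus mD (pM _ _ ph pE0) pk pE0 pk); last exact: aeDW.
  apply: aeDS (aeDI h1 ph.2) => x _ [hx1 hx0].
  rewrite gee0_abs// in hx1.
  by rewrite -[leRHS]mul1e lee_wpmul2r// lee_fin indicE.
have mabs : measurable_fun D (fun x => `|h x|) by exact: measurableT_comp ph.1.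
rewrite -[X in _ * X](equim_ind_integral mE ED ph.1 hE) -ge0_integralZl_EFin//.
have pcM : mplus mu D (fun=> M%:E) by exact: mplus_cst.
apply: (@le_trans _ _ (\int[mu]_(x in D) (h x * (fun=> M%:E) x))).
  under eq_integral do rewrite -muleA.
  apply: (le_integral_mplus mD ph (pM _ _ pC pk) ph pcM); first exact: aeDW.
  apply: aeDS pk.2 => x Dx kx0; rewrite /ind indicE in_setD (mem_set Dx)/=.
  case: (boolP (x \in E0)) => [_|/negP xE0]; first by rewrite mul0e lee_fin.
  by rewrite mul1e; apply: kM => // E0x; apply: xE0; rewrite inE.
rewrite le_eqVlt; apply/orP; left; apply/eqP; apply: (aeD_eq_integral mD).
- exact: (emeasurable_funM ph.1 pcM.1).
- apply: emeasurable_funM; first exact: measurable_cst.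
  exact: mabs.
- by apply: aeDS ph.2 => x _ hx; rewrite gee0_abs// muleC.
Qed.

(** A set of measure at most m is exchanged for a subset of I, where k0 / e >= 1, so the integral of
    f over it is at most 1/e times the polar. A larger E is cut into pieces of measure m, each
    adding 1/e to the constant. *)
Lemma ri_polar_int (I : set T) (k0 : T -> \bar R) (m e : R) :
  (forall (G : set T) (c : \bar R), measurable G -> G `<=` D -> 0 <= c -> c <= mu G ->
    exists P, [/\ measurable P, P `<=` G & mu P = c]) ->
  measurable I -> I `<=` D -> mu I = m%:E -> (0 < m)%R -> (0 < e)%R -> S0 k0 ->
  (forall x, I x -> e%:E <= k0 x) ->
  forall E, measurable E -> E `<=` D -> mu E < +oo ->
  exists2 C : R, (0 < C)%R & forall f, mplus mu D f ->
    \int[mu]_(x in E) f x <= C%:E * ri_polar mu D S0 f.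
Proof.
move=> divisible mI ID muI m0 e0 S0k0 ek0 E mE ED finE.
have pk0 := S0_mplus S0k0; have e0' : (0 <= e^-1)%R by rewrite invr_ge0 ltW.
have small (A : set T) : measurable A -> A `<=` D -> mu A <= m%:E ->
    forall f, mplus mu D f -> \int[mu]_(x in A) f x <= e^-1%:E * ri_polar mu D S0 f.
  move=> mA AD Am f pf; rewrite leNgt; apply/negP.
  have [|I' [mI' I'I muI']] := divisible I (mu A) mI ID (measure_ge0 _ _).
    by rewrite muI.
  have I'D := subset_trans I'I ID.
  move=> /(integral_ind_swap mA AD mI' I'D (esym muI') pf)[f' [pf' f'f]].
  apply/negP; rewrite -leNgt -integral_ind//.
  have pI' := mplus_ind mI'.
  apply: (@le_trans _ _ (\int[mu]_(x in D) (e^-1%:E * k0 x * f' x))).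
    apply: (le_integral_mplus mD pI' pf' (mplus_scale e0' pk0) pf'); last exact: aeDW.
    apply: aeDS pk0.2 => x Dx k0x; rewrite /ind indicE.
    case: (boolP (x \in I')) => [/set_mem/I'I/ek0 ek|_]; last by rewrite mule_ge0// lee_fin.
    by rewrite lee_pdivlMl// mule1.
  rewrite integral_mplusZ// lee_wpmul2l ?lee_fin// integral_mplusC.
  exact: le_ri_polar.
have {finE} [n En] : exists n : nat, mu E <= (n%:R * m)%:E.
  have fE : mu E \is a fin_num by rewrite ge0_fin_numE.
  exists (Num.bound (fine (mu E) / m)); rewrite -(fineK fE) lee_fin -ler_pdivrMr//.
  by rewrite ltW// archi_boundP// divr_ge0 ?fine_ge0// ltW.
elim: n E mE ED En => [|n IH] E mE ED En.
  exists e^-1%R; first by rewrite invr_gt0.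
  by apply: small => //; apply: (le_trans En); rewrite mul0r lee_fin ltW.
have [Em|/ltW mE'] := leP (mu E) m%:E.
  by exists e^-1%R; [rewrite invr_gt0|exact: small].
have m0' : 0 <= m%:E by rewrite lee_fin ltW.
have [A [mA AE muA]] := divisible E m%:E mE ED m0' mE'.
have mC : measurable (E `\` A) by exact: measurableD.
have CD : E `\` A `<=` D by move=> x [/ED].
have AD := subset_trans AE ED.
have EC : mu E = mu A + mu (E `\` A).
  by rewrite -measureU//; [rewrite setDUK|rewrite setDIK].
have [|C C0 HC] := IH _ mC CD.
  by move: En; rewrite EC muA -natr1 mulrDl mul1r EFinD [leRHS]addeC leeD2lE.
exists (e^-1 + C)%R; first by rewrite addr_gt0// invr_gt0.
move=> f pf.
have P0 : 0 <= ri_polar mu D S0 f.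
  apply: (@le_trans _ _ (\int[mu]_(x in D) (f x * k0 x))).
    by apply: integral_mplus_ge0.
  by apply: le_ri_polar.
rewrite EFinD ge0_muleDl ?lee_fin// ?(ltW C0)//.
rewrite -(integral_ind _ ED).
have -> : \int[mu]_(x in D) (ind E x * f x) =
    \int[mu]_(x in D) ((ind A x + ind (E `\` A) x) * f x).
  apply: eq_integral => x _; congr (_ * _); rewrite /ind !indicE in_setD.
  case: (boolP (x \in A)) => [/set_mem/AE Ex|_]; first by rewrite mem_set//= adde0.
  by rewrite add0e andbT.
rewrite (integral_mplusD mD (mplus_ind mA) (mplus_ind mC) pf) !integral_ind//.
by apply: leeD; [apply: small => //; rewrite muA|exact: HC].
Qed.

End resonance_indicators.
End indicators.
Arguments ind {d T R} E x.

(** * The Hardy operators *)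

Lemma tonelli_kernel d (T : measurableType d) (R : realType)
    (mu : {sigma_finite_measure set T -> \bar R}) (P : set (T * T)) (a b : T -> \bar R) :
  measurable P -> measurable_fun setT a -> (forall x, (0 <= a x)%E) ->
  measurable_fun setT b -> (forall x, (0 <= b x)%E) ->
  (\int[mu]_x (a x * \int[mu]_(y in [set y | P (x, y)]) b y) =
   \int[mu]_y (b y * \int[mu]_(x in [set x | P (x, y)]) a x))%E.
Proof.
move=> mP ma a0 mb b0.
pose f (z : T * T) := (a z.1 * b z.2 * (\1_P z)%:E)%E.
have mf : measurable_fun setT f.
  apply: emeasurable_funM; last by apply/measurable_EFinP; exact: measurable_indic.
  by apply: emeasurable_funM; apply: measurableT_comp.
have f0 z : (0 <= f z)%E by rewrite !mule_ge0// lee_fin indicE.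
have mx x : measurable [set y | P (x, y)].
  by have := measurable_xsection x mP; congr measurable; apply/seteqP; split => y; rewrite /xsection/= inE.
have my y : measurable [set x | P (x, y)].
  by have := measurable_ysection y mP; congr measurable; apply/seteqP; split => x; rewrite /ysection/= inE.
have := fubini_tonelli (m1 := mu) (m2 := mu) f mf f0.
have -> : (\int[mu]_x \int[mu]_y f (x, y) =
    \int[mu]_x (a x * \int[mu]_(y in [set y | P (x, y)]) b y))%E.
  apply: eq_integral => x _; rewrite -[in RHS](setTI [set y | _]) integral_mkcondr.
  rewrite -ge0_integralZl//.
  - apply: eq_integral => y _; rewrite /f/= -muleA patchE indicE.
    have -> : ((x, y) \in P) = (y \in [set y | P (x, y)]) by apply/idP/idP; rewrite !inE.
    by case: (_ \in _); rewrite ?mule1 ?mule0.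
  - exact/(measurable_restrictT _ (mx x)).1/measurable_funTS.
  - by move=> y _; exact: erestrict_ge0.
have -> : (\int[mu]_y \int[mu]_x f (x, y) =
    \int[mu]_y (b y * \int[mu]_(x in [set x | P (x, y)]) a x))%E.
  apply: eq_integral => y _; rewrite -[in RHS](setTI [set x | _]) integral_mkcondr.
  rewrite -ge0_integralZl//.
  - apply: eq_integral => x _; rewrite /f/= (muleC (a x)) -muleA patchE indicE.
    have -> : ((x, y) \in P) = (x \in [set x | P (x, y)]) by apply/idP/idP; rewrite !inE.
    by case: (_ \in _); rewrite ?mule1 ?mule0.
  - exact/(measurable_restrictT _ (my y)).1/measurable_funTS.
  - by move=> x _; exact: erestrict_ge0.
by [].
Qed.

Section kernel_duality.
Local Open Scope ereal_scope.
Context d (T : measurableType d) (R : realType)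
  (mu : {sigma_finite_measure set T -> \bar R}).
Variables (D : set T) (mD : measurable D) (P : set (T * T)) (mP : measurable P)
  (PD : forall x y, P (x, y) -> D x /\ D y) (u v : T -> \bar R).
Hypotheses (mu_ : measurable_fun D u) (u0 : forall x, D x -> 0 <= u x)
  (mv_ : measurable_fun D v) (v0 : forall x, D x -> 0 <= v x).
Implicit Types g h b : T -> \bar R.

Lemma measurable_integral_section b : measurable_fun setT b -> (forall x, 0 <= b x) ->
  measurable_fun setT (fun x => \int[mu]_(y in [set y | P (x, y)]) b y).
Proof.
move=> mb b0; pose f (z : T * T) := b z.2 * (\1_P z)%:E.
have mf : measurable_fun setT f.
  apply: emeasurable_funM; last by apply/measurable_EFinP; exact: measurable_indic.
  exact: measurableT_comp.
have f0 z : 0 <= f z by rewrite mule_ge0// lee_fin indicE.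
have mI := measurable_fun_fubini_tonelli_F (m2 := mu) f mf f0.
apply: (eq_measurable_fun _ _ mI) => x _; rewrite /fubini_F -[in RHS](setTI [set y | _]) integral_mkcondr.
apply: eq_integral => y _; rewrite /f/= patchE indicE.
have -> : ((x, y) \in P) = (y \in [set y | P (x, y)]) by apply/idP/idP; rewrite !inE.
by case: (_ \in _); rewrite ?mule1 ?mule0.
Qed.

Let b_ g t := pospart D (abse \o g) t * (u \_ D) t.

Let mb_ g : measurable_fun D g -> measurable_fun setT (b_ g).
Proof.
move=> mg; apply: emeasurable_funM; last exact/(measurable_restrictT _ mD).1.
by apply: measurable_pospart => //; exact: measurableT_comp.
Qed.

Let b0_ g t : 0 <= b_ g t.
Proof. by rewrite mule_ge0 ?pospart_ge0// erestrict_ge0. Qed.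

Let b_E g t : D t -> `|g t| * u t = b_ g t.
Proof.
move=> Dt; rewrite /b_ /pospart !patchE mem_set//.
by have := ge0_funeposE (D := D) (f := abse \o g) (fun x _ => abse_ge0 (g x)); move=> ->//; rewrite inE.
Qed.

Let int_b_E g x : D x -> \int[mu]_(y in [set y | P (x, y)]) (`|g y| * u y) =
  \int[mu]_(y in [set y | P (x, y)]) b_ g y.
Proof.
by move=> Dx; apply: eq_integral => y /set_mem/PD[_ Dy]; exact: b_E.
Qed.

Lemma measurable_kernel g : measurable_fun D g ->
  measurable_fun D (fun x => v x * \int[mu]_(y in [set y | P (x, y)]) (`|g y| * u y)).
Proof.
move=> mg; apply: emeasurable_funM => //.
apply: (eq_measurable_fun (fun x => \int[mu]_(y in [set y | P (x, y)]) b_ g y)).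
  by move=> x /set_mem Dx; rewrite int_b_E.
by apply: measurable_funTS; apply: measurable_integral_section => //; exact: mb_.
Qed.

Lemma kernel_ge0 g x : D x -> 0 <= v x * \int[mu]_(y in [set y | P (x, y)]) (`|g y| * u y).
Proof.
move=> Dx; rewrite mule_ge0 ?v0//; apply: integral_ge0 => y /PD[_ Dy].
by rewrite mule_ge0// u0.
Qed.

End kernel_duality.

Section dual_kernel.
Local Open Scope ereal_scope.
Context d (T : measurableType d) (R : realType)
  (mu : {sigma_finite_measure set T -> \bar R}).
Variables (D : set T) (mD : measurable D) (P : set (T * T)) (mP : measurable P)
  (PD : forall x y, P (x, y) -> D x /\ D y) (u v : T -> \bar R).
Hypotheses (mu_ : measurable_fun D u) (u0 : forall x, D x -> 0 <= u x)
  (mv_ : measurable_fun D v) (v0 : forall x, D x -> 0 <= v x).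
Implicit Types g h b : T -> \bar R.

(** Transposing the region and exchanging u and v turns the dual operator into a kernel operator of
    the first kind. *)
Let Pt : set (T * T) := [set z | P (z.2, z.1)].

Let mPt : measurable Pt.
Proof.
have : measurable_fun setT (fun z : T * T => (z.2, z.1)).
  by apply: measurable_fun_pair; [exact: measurable_snd|exact: measurable_fst].
by move=> /(_ measurableT _ mP); rewrite setTI.
Qed.

(** One operator integrates |g|, its dual integrates h itself; on [mplus] the two conventions
    agree. *)
Let abs_ae h y : mplus mu D h -> D y ->
  \int[mu]_(x in [set x | P (x, y)]) (h x * v x) =
  \int[mu]_(x in [set x | P (x, y)]) (`|h x| * v x).
Proof.
move=> [mh h0] Dy.
have my : measurable [set x | P (x, y)].
  by have := measurable_ysection y mP; congr measurable; apply/seteqP; split => x; rewrite /ysection/= inE.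
have sub : [set x | P (x, y)] `<=` D by move=> x /PD[].
apply: ae_eq_integral => //.
- by apply: emeasurable_funM; exact: measurable_funS sub _.
- apply: emeasurable_funM; last exact: measurable_funS sub _.
  by apply: measurableT_comp => //; exact: measurable_funS sub _.
- by move: h0; rewrite /aeD; apply: filterS => x H /sub Dx; rewrite gee0_abs// H.
Qed.

Lemma measurable_dual_kernel h : mplus mu D h ->
  measurable_fun D (fun y => u y * \int[mu]_(x in [set x | P (x, y)]) (h x * v x)).
Proof.
move=> ph.
apply: (eq_measurable_fun (fun y => u y * \int[mu]_(x in [set x | P (x, y)]) (`|h x| * v x))).
  by move=> y /set_mem Dy; rewrite (abs_ae ph Dy).
apply: (@measurable_kernel _ _ _ mu D mD Pt mPt _ v u) => //; last exact: ph.1.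
by move=> x y /PD[].
Qed.

Lemma dual_kernel_ge0 h y : mplus mu D h -> D y ->
  0 <= u y * \int[mu]_(x in [set x | P (x, y)]) (h x * v x).
Proof.
move=> ph Dy; rewrite (abs_ae ph Dy); apply: (@kernel_ge0 _ _ _ mu D Pt _ v u) => //.
by move=> x z /PD[].
Qed.

Lemma kernel_dual h g : mplus mu D h -> mplus mu D g ->
  \int[mu]_(x in D) (h x * (v x * \int[mu]_(y in [set y | P (x, y)]) (`|g y| * u y))) =
  \int[mu]_(y in D) (u y * \int[mu]_(x in [set x | P (x, y)]) (h x * v x) * g y).
Proof.
move=> ph pg; have [mh h0] := ph; have [mg g0] := pg.
pose a x := `|h x| * v x; pose b y := `|g y| * u y.
have ma : measurable_fun setT (a \_ D).
  by apply/(measurable_restrictT _ mD).1; apply: emeasurable_funM => //; exact: measurableT_comp.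
have mb : measurable_fun setT (b \_ D).
  by apply/(measurable_restrictT _ mD).1; apply: emeasurable_funM => //; exact: measurableT_comp.
have a0 x : 0 <= (a \_ D) x by apply: erestrict_ge0 => z Dz; rewrite mule_ge0// v0.
have b0 x : 0 <= (b \_ D) x by apply: erestrict_ge0 => z Dz; rewrite mule_ge0// u0.
have E1 x : \int[mu]_(y in [set y | P (x, y)]) (`|g y| * u y) =
    \int[mu]_(y in [set y | P (x, y)]) (b \_ D) y.
  by apply: eq_integral => y /set_mem/PD[_ Dy]; rewrite patchE mem_set.
have E2 y : \int[mu]_(x in [set x | P (x, y)]) (`|h x| * v x) =
    \int[mu]_(x in [set x | P (x, y)]) (a \_ D) x.
  by apply: eq_integral => x /set_mem/PD[Dx _]; rewrite patchE mem_set.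
transitivity (\int[mu]_x ((a \_ D) x * \int[mu]_(y in [set y | P (x, y)]) (b \_ D) y)).
  transitivity (\int[mu]_(x in D) (a x * \int[mu]_(y in [set y | P (x, y)]) (`|g y| * u y))).
    apply: aeD_eq_integral => //.
    - by apply: emeasurable_funM => //; exact: measurable_kernel.
    - under eq_fun do rewrite -muleA; apply: emeasurable_funM; first exact: measurableT_comp.
      exact: measurable_kernel.
    - by apply: aeDS h0 => x Dx hx; rewrite /a gee0_abs// muleA.
  rewrite integral_mkcond; apply: eq_integral => x _; rewrite !patchE E1.
  by case: ifP => // _; rewrite mul0e.
rewrite tonelli_kernel//.
transitivity (\int[mu]_(y in D) (b y * \int[mu]_(x in [set x | P (x, y)]) (`|h x| * v x))).
  rewrite [RHS]integral_mkcond; apply: eq_integral => y _; rewrite !patchE E2.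
  by case: ifP => // _; rewrite mul0e.
apply: aeD_eq_integral => //.
- under eq_fun do rewrite -muleA; apply: emeasurable_funM; first exact: measurableT_comp.
  apply: (@measurable_kernel _ _ _ mu D mD Pt mPt _ v u) => //.
  by move=> x y /PD[].
- by apply: emeasurable_funM => //; exact: measurable_dual_kernel.
- by apply: aeDS g0 => y Dy gy; rewrite -(abs_ae ph Dy) /b gee0_abs// -muleA muleC.
Qed.

End dual_kernel.

(** * Exhaustion of (0, L) and resonance for Lebesgue measure *)

Section lebesgue_interval.
Local Open Scope ereal_scope.
Context {R : realType} (L : \bar R).
Notation T := (lebesgueType R).
Notation mu := (@completed_lebesgue_measure R).
Notation D := (oitv 0%R L : set T).

Let D_ (n : nat) : set T := D `&` oitv 0%R n%:R%:E.

Lemma measurable_exhaust n : measurable (D_ n).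
Proof. by apply: measurableI; exact: measurable_oitv. Qed.

Lemma leb_exhaust n : mu (D_ n) < +oo.
Proof. by apply: (@leb_oitv_fin _ _ n%:R); [exact: measurable_exhaust|exact: subIsetr]. Qed.

Lemma nondecreasing_exhaust : nondecreasing_seq D_.
Proof.
move=> m n mn; apply/subsetPset; apply: setIS => x [x0 xm]; split => //.
by apply: (lt_le_trans xm); rewrite lee_fin ler_nat.
Qed.

Lemma exhaustE : D = \bigcup_n D_ n.
Proof.
apply/seteqP; split => [x [x0 xL]|x [n _ []//]].
by exists (Num.bound x) => //; split; split => //; rewrite lte_fin archi_boundP// ltW.
Qed.

Lemma oitv_sub_pos : D `<=` oitv 0%R +oo.
Proof. by move=> x [x0 _]; split => //; rewrite ltry. Qed.

Lemma leb_resonance (f h k : T -> \bar R) (a : \bar R) :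
  mplus mu D f -> mplus mu D h -> mplus mu D k ->
  equim mu D h f -> a < \int[mu]_(x in D) (h x * k x) ->
  exists k' : T -> \bar R, [/\ mplus mu D k', equim mu D k' k &
    a < \int[mu]_(x in D) (f x * k' x)].
Proof.
have mD := measurable_oitv 0%R L.
apply: (resonance mD) => {}f {}h {}k {}a mf f0 mh h0 mk k0.
apply: (lt_integral_equim mD measurable_exhaust leb_exhaust nondecreasing_exhaust exhaustE) => //.
- move=> G c mG GD c0 cG.
  exact: (leb_subset_eq mG (subset_trans GD oitv_sub_pos) c0 cG).
- move=> A B k' mA mB BD AB mk'.
  exact: (transport mA mB (subset_trans BD oitv_sub_pos) AB mk').
Qed.

End lebesgue_interval.

Section hardy.
Local Open Scope ereal_scope.
Context {R : realType} (L : \bar R) (nu u v : R -> R).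
Notation T := (lebesgueType R).
Notation mu := (@completed_lebesgue_measure R).
Notation D := (oitv 0%R L : set T).
Hypotheses (nu_bij : set_bij (oitv 0%R L) (oitv 0%R L) nu)
  (nu_incr : {in oitv 0%R L &, {homo nu : x y / (x < y)%R}})
  (u_gt0 : {in oitv 0%R L, forall x, (0 < u x)%R})
  (v_gt0 : {in oitv 0%R L, forall x, (0 < v x)%R})
  (u_nincr : {in oitv 0%R L &, {homo u : x y /~ (x <= y)%R}})
  (v_nincr : {in oitv 0%R L &, {homo v : x y /~ (x <= y)%R}}).
Implicit Types (f g h : T -> \bar R).

Let mD : measurable D := measurable_oitv 0%R L.

Lemma nuD (t : R) : D t -> D (nu t).
Proof. by case: nu_bij => fD _ _ Dt; exact: fD. Qed.

Lemma nu_invK (t : R) : D t -> nu (invL L nu t) = t.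
Proof.
by case: nu_bij => _ _ sD Dt; apply: (surjpK _ sD); rewrite inE.
Qed.

Lemma inv_nuK (t : R) : D t -> invL L nu (nu t) = t.
Proof.
by case: nu_bij => _ iD _ Dt; apply: (pinvKV _ iD); rewrite inE.
Qed.

Lemma invD (t : R) : D t -> D (invL L nu t).
Proof.
case: nu_bij => _ _ sD Dt.
have /(_ (invL L nu t)) := @surjpinv_image_sub _ _ (fun=> 0%R) (oitv 0%R L) (oitv 0%R L) nu sD.
by apply; exists t.
Qed.

Lemma nu_le (s t : R) : D s -> D t -> (s <= t)%R -> (nu s <= nu t)%R.
Proof.
move=> Ds Dt; rewrite le_eqVlt => /predU1P[->//|st].
by rewrite ltW// nu_incr// inE.
Qed.

Lemma lt_nu (s t : R) : D s -> D t -> (t < nu s)%R = (invL L nu t < s)%R.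
Proof.
move=> Ds Dt; apply/idP/idP.
  by rewrite !ltNge; apply: contra => /(nu_le Ds (invD Dt)); rewrite nu_invK.
by move=> lt; rewrite -{1}(nu_invK Dt) nu_incr// inE//; exact: invD.
Qed.

Lemma u_le (s t : R) : D s -> D t -> (s <= t)%R -> (u t <= u s)%R.
Proof. by move=> Ds Dt st; apply: u_nincr => //; rewrite inE. Qed.

Lemma v_le (s t : R) : D s -> D t -> (s <= t)%R -> (v t <= v s)%R.
Proof. by move=> Ds Dt st; apply: v_nincr => //; rewrite inE. Qed.

Lemma u_pos (t : R) : D t -> (0 < u t)%R.
Proof. by move=> Dt; apply: u_gt0; rewrite inE. Qed.

Lemma v_pos (t : R) : D t -> (0 < v t)%R.
Proof. by move=> Dt; apply: v_gt0; rewrite inE. Qed.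

Lemma oitv_between (r s t : R) : D r -> D t -> (r <= s <= t)%R -> D s.
Proof.
move=> [r0 _] [_ tL] /andP[rs st]; split; first exact: lt_le_trans rs.
by apply: le_lt_trans tL; rewrite lee_fin.
Qed.

Lemma nonincreasing_measurable_oitv f :
  (forall s t : R, D s -> D t -> (s <= t)%R -> f t <= f s) -> measurable_fun D f.
Proof.
move=> f_ni _; apply: (measurability _ (ErealGenOInfty.measurableE R)) => //.
move=> _ [_ [l ->] <-]; apply: borel_lebesgue; apply: is_interval_measurable.
move=> x y [Dx _] [Dy /=]; rewrite !in_itv/= !andbT => ly z xyz.
have Dz := oitv_between Dx Dy xyz; split => //=; rewrite in_itv/= andbT.
by apply: (lt_le_trans ly); apply: f_ni => //; case/andP: xyz.
Qed.

Lemma measurable_u : measurable_fun D (fun t : T => (u t)%:E).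
Proof.
by apply: nonincreasing_measurable_oitv => s t Ds Dt st; rewrite lee_fin u_le.
Qed.

Lemma measurable_v : measurable_fun D (fun t : T => (v t)%:E).
Proof.
by apply: nonincreasing_measurable_oitv => s t Ds Dt st; rewrite lee_fin v_le.
Qed.

Lemma oitv_nu_sub (t : R) : D t -> (oitv 0%R (nu t)%:E : set T) `<=` D.
Proof.
move=> /nuD[_ nuL] x [x0 xt]; split => //; exact: lt_trans nuL.
Qed.

Lemma oitv_inv_sub (t : R) : D t -> (oitv (invL L nu t) L : set T) `<=` D.
Proof.
by move=> /invD[i0 _] x [x0 xt]; split => //; exact: lt_trans x0.
Qed.

(** The common region of integration: its sections in one variable give [hardyR], in the other
    [hardyH]. *)
Let P : set (T * T) := [set z | [/\ D z.1, D z.2 & (z.2 < nu z.1)%R]].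

(** A rational q between t and nu s exhibits the region as a countable union of products of two
    intervals, by monotonicity of nu alone. *)
Let mP : measurable P.
Proof.
have mq (q : rat) : measurable (D `&` [set x : T | (ratr q < nu x)%R]).
  apply: borel_lebesgue; apply: is_interval_measurable.
  move=> x y [Dx qx] [Dy qy] z xyz; have Dz := oitv_between Dx Dy xyz; split => //=.
  by apply: (lt_le_trans qx); apply: nu_le => //; case/andP: xyz.
have mq' (q : rat) : measurable (D `&` [set x : T | (x < ratr q)%R]).
  apply: borel_lebesgue; apply: is_interval_measurable.
  move=> x y [Dx qx] [Dy qy] z xyz; have Dz := oitv_between Dx Dy xyz; split => //=.
  by apply: le_lt_trans qy; case/andP: xyz.
rewrite (_ : P = \bigcup_(q : rat) ((D `&` [set x : T | (ratr q < nu x)%R]) `*`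
    (D `&` [set x : T | (x < ratr q)%R]))).
  by apply: bigcupT_measurable_rat => q; exact: measurableX.
apply/seteqP; split => [[s t] [/= Ds Dt /rat_in_itvoo[q]]|[s t] [q _ [[/= Ds qs] [/= Dt tq]]]].
  by rewrite in_itv/= => /andP[tq qs]; exists q.
by split => //=; exact: lt_trans tq qs.
Qed.

Let PD (s t : T) : P (s, t) -> D s /\ D t.
Proof. by case. Qed.

Let P1 (s : T) : D s -> [set t | P (s, t)] = oitv 0%R (nu s)%:E.
Proof.
move=> Ds; apply/seteqP; split => t /= [].
  by move=> _ [t0 _] ts; split.
by move=> t0 ts; split => //; exact: (oitv_nu_sub Ds).
Qed.

Let P2 (t : T) : D t -> [set s | P (s, t)] = oitv (invL L nu t) L.
Proof.
move=> Dt; apply/seteqP; split => s /=.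
  by case=> Ds _ st; split; [rewrite -lt_nu|case: Ds].
by move=> st; have Ds := oitv_inv_sub Dt st; split => //; rewrite lt_nu//; case: st.
Qed.

Let u0 (t : T) : D t -> 0 <= (u t)%:E.
Proof. by move=> Dt; rewrite lee_fin ltW// u_pos. Qed.

Let v0 (t : T) : D t -> 0 <= (v t)%:E.
Proof. by move=> Dt; rewrite lee_fin ltW// v_pos. Qed.

Let hardyRE g (t : T) : D t -> hardyR u v nu g t =
  (v t)%:E * \int[mu]_(s in [set s | P (t, s)]) (`|g s| * (u s)%:E).
Proof. by move=> Dt; rewrite P1. Qed.

Let hardyHE h (t : T) : D t -> hardyH L u v nu h t =
  (u t)%:E * \int[mu]_(s in [set s | P (s, t)]) (h s * (v s)%:E).
Proof. by move=> Dt; rewrite P2. Qed.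

Lemma hardyR_ge0 g (t : T) : D t -> 0 <= hardyR u v nu g t.
Proof. by move=> Dt; rewrite hardyRE//; exact: (kernel_ge0 mu PD u0 v0). Qed.

Lemma hardyH_ge0 h (t : T) : mplus mu D h -> D t -> 0 <= hardyH L u v nu h t.
Proof.
by move=> ph Dt; rewrite hardyHE//; exact: (dual_kernel_ge0 mD mP PD u0 measurable_v v0 ph Dt).
Qed.

Lemma measurable_hardyR g : measurable_fun D g -> measurable_fun D (hardyR u v nu g : T -> \bar R).
Proof.
move=> mg; apply: (eq_measurable_fun _ _
  (measurable_kernel mu mD mP PD measurable_u u0 measurable_v mg)).
by move=> t /set_mem Dt; rewrite hardyRE.
Qed.

Lemma mplus_hardyR g : measurable_fun D g -> mplus mu D (hardyR u v nu g).
Proof.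
by move=> mg; split; [exact: measurable_hardyR|apply: aeDW => t; exact: hardyR_ge0].
Qed.

Lemma measurable_hardyH h : mplus mu D h -> measurable_fun D (hardyH L u v nu h : T -> \bar R).
Proof.
move=> ph; apply: (eq_measurable_fun _ _
  (measurable_dual_kernel mD mP PD measurable_u measurable_v v0 ph)).
by move=> t /set_mem Dt; rewrite hardyHE.
Qed.

Lemma tonelli_hardy h g : mplus mu D h -> mplus mu D g ->
  \int[mu]_(s in D) (h s * hardyR u v nu g s) =
  \int[mu]_(t in D) (hardyH L u v nu h t * g t).
Proof.
move=> ph pg; transitivity (\int[mu]_(s in D) (h s *
    ((v s)%:E * \int[mu]_(t in [set t | P (s, t)]) (`|g t| * (u t)%:E)))).
  by apply: eq_integral => s /set_mem Ds; rewrite hardyRE.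
rewrite (kernel_dual mD mP PD measurable_u u0 measurable_v v0 ph pg).
by apply: eq_integral => t /set_mem Dt; rewrite hardyHE.
Qed.

Lemma ri_fnorm N : ri_norm L N -> fnorm mu D N.
Proof.
case=> N0 _ Nscale Ntri Nmono Nfatou _ _ _; split; [exact: N0|exact: Nscale|exact: Ntri|exact: Nmono|].
exact: Nfatou.
Qed.

(** f and |f| are equal only almost everywhere on (0, L); (P6) identifies their norms. *)
Lemma ri_ext_norm N f : ri_norm L N -> mplus mu D f -> ext_norm N f = N f.
Proof.
move=> nN pf; apply: (ri_equi nN).
- split; first exact: (measurableT_comp (@abse_measurable R setT) pf.1).
  exact: aeDW.
- exact: pf.
- by move=> l l0; under eq_set do rewrite abse_id.
Qed.

(** * Condition (A) and the optimal target *)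

Section target.
Variable NX : (T -> \bar R) -> \bar R.
Hypothesis NX_ri : ri_norm L NX.

Let nX := ri_fnorm NX_ri.

Let B : set (T -> \bar R) := [set g | mplus mu D g /\ NX g <= 1].

Definition hardy_ball : set (T -> \bar R) := [set (hardyR u v nu g : T -> \bar R) | g in B].

Local Notation S0 := hardy_ball.
Local Notation Phi := (ri_polar mu D S0).

Lemma hardy_ball_mplus k : S0 k -> mplus mu D k.
Proof. by move=> [g [pg _] <-]; exact: (mplus_hardyR pg.1). Qed.

Lemma hardy_ball_neq0 : S0 !=set0.
Proof.
have [g Bg] := assoc_ball_neq0 nX; exists (hardyR u v nu g : T -> \bar R).
by exists g.
Qed.

Lemma assoc_hardyH h : mplus mu D h ->
  ext_norm (associate L NX) (hardyH L u v nu h) = polar mu D S0 h.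
Proof.
move=> ph; have -> : ext_norm (associate L NX) (hardyH L u v nu h) =
    polar mu D B (hardyH L u v nu h).
  apply: (@polar_eqD _ _ _ mu D B) => t Dt; rewrite gee0_abs//.
  exact: hardyH_ge0.
apply/eqP; rewrite eq_le; apply/andP; split.
  apply: polar_le => g Bg; rewrite -tonelli_hardy//; last by case: Bg.
  by apply: le_polar; exists g.
apply: polar_le => _ [g Bg <-]; rewrite tonelli_hardy//; last by case: Bg.
exact: le_polar.
Qed.

Lemma hardyY'E f : hardyY' L NX u v nu f = Phi f.
Proof.
by congr ereal_sup; apply: eq_imagel => h [ph _]; rewrite assoc_hardyH.
Qed.

Lemma in_space_hardyH (F : T -> \bar R) h : mplus mu D h ->
  (forall t, D t -> F t = hardyH L u v nu h t) ->
  in_space L (associate L NX) F <-> polar mu D S0 h < +oo.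
Proof.
move=> ph FE; have e : ext_norm (associate L NX) F = polar mu D S0 h.
  rewrite -(assoc_hardyH ph); apply: (@polar_eqD _ _ _ mu D B) => t Dt.
  by rewrite FE.
split; first by case; rewrite e.
move=> fin; split; last by rewrite e.
apply: (eq_measurable_fun _ _ (measurable_hardyH ph)).
by move=> t /set_mem Dt; rewrite FE.
Qed.

Hypothesis L_gt0 : 0 < L.

Let leb_div (G : set T) (c : \bar R) : measurable G -> G `<=` D -> 0 <= c -> c <= mu G ->
  exists P, [/\ measurable P, P `<=` G & mu P = c].
Proof.
move=> mG GD c0 cG.
exact: (leb_subset_eq mG (subset_trans GD (@oitv_sub_pos _ L)) c0 cG).
Qed.

Let pB g : B g -> mplus mu D g.
Proof. by case. Qed.

Lemma hardyR_scale (c : R) g t : (0 <= c)%R -> measurable_fun D g -> D t ->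
  hardyR u v nu (fun x => c%:E * g x) t = c%:E * hardyR u v nu g t.
Proof.
move=> c0 mg Dt; rewrite /hardyR muleCA; congr (_ * _).
have sD := oitv_nu_sub Dt.
rewrite -ge0_integralZl_EFin; [|exact: measurable_oitv| | |exact: c0].
- by apply: eq_integral => s _; rewrite abseM gee0_abs ?lee_fin// muleA.
- by move=> s /sD Ds; rewrite mule_ge0// u0.
- apply: (measurable_funS mD sD); apply: emeasurable_funM; last exact: measurable_u.
  exact: (measurableT_comp (@abse_measurable R setT) mg).
Qed.

Lemma hardyR_abs g : hardyR u v nu (fun x => `|g x|) = hardyR u v nu g.
Proof.
by apply/funext => t; congr (_ * _); apply: eq_integral => s _; rewrite abse_id.
Qed.

(** For [ri_polar_int] one function of [hardy_ball] bounded below on an interval suffices: the image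
    of a small multiple of the indicator of (0, a), a = nu t1. For s in (t1, t2) the integral in
    [hardyR] covers (0, a), where u >= u a, and v s >= v t2. *)
Lemma Phi_int (E : set T) : measurable E -> E `<=` D -> mu E < +oo ->
  exists2 C : R, (0 < C)%R & forall f, mplus mu D f ->
    \int[mu]_(x in E) f x <= C%:E * Phi f.
Proof.
have [t2 Dt2] : exists t : R, D t.
  move: L_gt0; case: (L) => [l||]//.
    by rewrite lte_fin => l0; exists (l / 2)%R; split; rewrite ?lte_fin; lra.
  by move=> _; exists 1%R; split; rewrite ?ltry.
pose t1 := (t2 / 2)%R.
have t20 : (0 < t2)%R by case: Dt2.
have t12 : (t1 < t2)%R by rewrite /t1; lra.
have t10 : (0 < t1)%R by rewrite /t1; lra.
have Dt1 : D t1 by split => //; apply: lt_trans Dt2.2; rewrite lte_fin.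
pose a := nu t1; have Da : D a := nuD Dt1; have a0 : (0 < a)%R by case: Da.
pose E1 : set T := oitv 0%R a%:E.
have mE1 : measurable E1 := measurable_oitv _ _.
have E1D : E1 `<=` D := oitv_nu_sub Dt1.
have NE1 : NX (ind E1) < +oo.
  by apply: (ri_fin NX_ri) => //; apply: (leb_oitv_fin (b := a)).
have pE1 : mplus mu D (ind E1) by exact: mplus_ind.
have NE0 := fn_ge0 nX pE1.
pose c := (fine (NX (ind E1)) + 1)^-1%R.
have c0 : (0 < c)%R by rewrite invr_gt0 ltr_wpDl// fine_ge0.
have Bg : B (fun x => c%:E * ind E1 x).
  split; first exact: (mplus_scale (ltW c0) pE1).
  rewrite (fn_scale nX (ltW c0) pE1) lee_pdivrMl ?invr_gt0// ?invrK; last first.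
    by rewrite ltr_wpDl// fine_ge0.
  by rewrite mule1 EFinD fineK ?leeDl// ge0_fin_numE.
pose g0 : T -> \bar R := fun x => c%:E * ind E1 x.
pose I : set T := oitv t1 t2%:E.
have ID : I `<=` D.
  move=> x [x1 x2]; split; first exact: lt_trans x1.
  by apply: lt_trans Dt2.2.
have muI : mu I = (t2 - t1)%:E by exact: leb_oitv (ltW t12).
have e0 : (0 < v t2 * (c * u a * a))%R.
  by rewrite mulr_gt0 ?v_pos// mulr_gt0// mulr_gt0// u_pos.
apply: (ri_polar_int mD (leb_resonance (L := L)) hardy_ball_mplus leb_div (I := I)
  (k0 := hardyR u v nu g0) (m := (t2 - t1)%R) _ ID _ _ e0).
- exact: measurable_oitv.
- exact: muI.
- by rewrite subr_gt0.
- by exists g0.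
- move=> s Is; have Ds := ID _ Is; have [t1s st2] := Is.
  rewrite EFinM; apply: lee_pmul; rewrite ?lee_fin.
  + by rewrite ltW// v_pos.
  + by rewrite ltW// mulr_gt0// mulr_gt0// u_pos.
  + by apply: v_le => //; rewrite ltW// -lte_fin.
  have sub : E1 `<=` oitv 0%R (nu s)%:E.
    move=> x [x0 xa]; split => //; apply: (lt_le_trans xa).
    by rewrite lee_fin nu_le// ltW.
  have mG : measurable_fun D (fun x => `|g0 x| * (u x)%:E).
    apply: emeasurable_funM; last exact: measurable_u.
    by apply: (measurableT_comp (@abse_measurable R setT)); case: Bg => -[].
  apply: (@le_trans _ _ (\int[mu]_(x in E1) (`|g0 x| * (u x)%:E))); last first.
    apply: ge0_subset_integral; [exact: mE1|exact: measurable_oitv| | |exact: sub].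
    * exact: (measurable_funS mD (oitv_nu_sub Ds) mG).
    * by move=> x /(oitv_nu_sub Ds) Dx; apply: mule_ge0; [exact: abse_ge0|exact: u0].
  have -> : (c * u a * a)%:E = \int[mu]_(x in E1) (cst (c * u a)%:E) x.
    have muE1 : mu E1 = a%:E by rewrite leb_oitv ?subr0// ltW.
    by rewrite integral_cst// EFinM -muE1.
  apply: ge0_le_integral; [exact: mE1| | | |].
  + by move=> x _; rewrite lee_fin ltW// mulr_gt0// u_pos.
  + exact: measurable_cst.
  + exact: (measurable_funS mD E1D mG).
  + move=> x Ex; rewrite /g0 /ind indicE mem_set// mule1 gee0_abs ?lee_fin ?(ltW c0)//.
    rewrite ler_pM2l// u_le//; first exact: E1D.
    by case: Ex => _; rewrite lte_fin => /ltW.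
Qed.

Lemma hardyH_ind_D t : L < +oo -> D t ->
  (u t)%:E * \int[mu]_(s in oitv (invL L nu t) L) (v s)%:E = hardyH L u v nu (ind D) t.
Proof.
move=> _ Dt; congr (_ * _); apply: eq_integral => s /set_mem st.
by rewrite /ind indicE mem_set ?mul1e//; exact: (oitv_inv_sub Dt).
Qed.

(** For t >= nu 1 the interval from the inverse image of t to 1 is empty, so the indicator of (0, nu
    1) in condition (A) changes nothing. *)
Lemma hardyH_ind_01 t : L = +oo -> D t ->
  (u t)%:E * (\1_(oitv 0%R (nu 1%R)%:E) t)%:E *
    \int[mu]_(s in oitv (invL L nu t) 1) (v s)%:E =
  hardyH L u v nu (ind (oitv 0%R 1)) t.
Proof.
move=> Loo Dt; have D1 : D 1%R by split; rewrite ?Loo ?ltry.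
rewrite /hardyH -muleA; congr (_ * _).
have i0 : (0 < invL L nu t)%R by case: (invD Dt).
have setE : oitv (invL L nu t) L `&` oitv 0%R 1 = oitv (invL L nu t) 1 :> set T.
  apply/seteqP; split => s; first by move=> [[? _] [_ ?]]; split.
  move=> [ts s1]; split; split => //; last exact: lt_trans ts.
  by rewrite Loo ltry.
have -> : \int[mu]_(s in oitv (invL L nu t) L) (ind (oitv 0%R 1) s * (v s)%:E) =
    \int[mu]_(s in oitv (invL L nu t) 1) (v s)%:E.
  by rewrite -setE; exact: integral_indI.
have [t1|t1] := ltP (invL L nu t) 1%R.
  rewrite indicE mem_set ?mul1e//; split; first by case: Dt.
  by rewrite lte_fin lt_nu.
rewrite (_ : oitv (invL L nu t) 1 = set0) ?integral_set0 ?mule0//.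
apply/seteqP; split => // s [ts]; rewrite lte_fin => s1.
by have := lt_le_trans (lt_trans ts s1) t1; rewrite ltxx.
Qed.

Let uchi (s : R) : T -> \bar R := fun t => (u t)%:E * (\1_(oitv 0%R (nu s)%:E) t)%:E.

Let mplus_uchi s : mplus mu D (uchi s).
Proof.
split; last by apply: aeDW => t Dt; rewrite mule_ge0 ?u0// lee_fin indicE.
apply: emeasurable_funM; first exact: measurable_u.
by apply/measurable_EFinP; apply: measurable_indic; exact: measurable_oitv.
Qed.

(** By [int_uchi], [v s] times this is the supremum of [hardyR g s] over the unit ball of X, so the
    limsup in (A) is a uniform bound on [hardy_ball] near infinity. *)
Let Nu (s : R) : \bar R := ext_norm (associate L NX) (uchi s).

Let NuE s : Nu s = polar mu D B (uchi s).
Proof.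
apply: (@polar_eqD _ _ _ mu D B) => t Dt; rewrite gee0_abs//.
by rewrite mule_ge0 ?u0// lee_fin indicE.
Qed.

Let int_uchi s g : D s -> mplus mu D g ->
  \int[mu]_(t in D) (uchi s t * g t) =
  \int[mu]_(t in oitv 0%R (nu s)%:E) (`|g t| * (u t)%:E).
Proof.
move=> Ds pg; have sD := oitv_nu_sub Ds.
transitivity (\int[mu]_(t in D) (ind (oitv 0%R (nu s)%:E) t * (`|g t| * (u t)%:E)));
  last exact: integral_ind.
apply: (aeD_eq_integral mD).
- exact: (emeasurable_funM (mplus_uchi s).1 pg.1).
- apply: emeasurable_funM.
    by apply/measurable_EFinP; apply: measurable_indic; exact: measurable_oitv.
  apply: emeasurable_funM; last exact: measurable_u.
  exact: (measurableT_comp (@abse_measurable R setT) pg.1).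
- by apply: aeDS pg.2 => t _ gt; rewrite gee0_abs// /uchi (muleC (u t)%:E) -muleA (muleC (u t)%:E).
Qed.

Lemma hardyR_le g s : B g -> D s -> hardyR u v nu g s <= (v s)%:E * Nu s.
Proof.
move=> Bg Ds; rewrite /hardyR lee_wpmul2l ?v0// -int_uchi//; last exact: pB.
by rewrite NuE; exact: le_polar.
Qed.

Lemma le_Nu s t : D s -> D t -> (s <= t)%R -> Nu s <= Nu t.
Proof.
move=> Ds Dt st; rewrite !NuE; apply: (polar_mono mD pB) => //.
apply: aeDW => x Dx; rewrite lee_wpmul2l ?u0// lee_fin !indicE.
case: (boolP (x \in _)) => [/set_mem[x0 xs]|_]; last by rewrite ler0n.
rewrite mem_set//; split => //; apply: (lt_le_trans xs).
by rewrite lee_fin nu_le.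
Qed.

Let Nu_ge0 s : 0 <= Nu s.
Proof. by rewrite NuE; apply: (polar_ge0 mD pB) => //; exact: assoc_ball_neq0. Qed.

(** Here (A) enters: its integral part makes the polar of the indicator of E0 finite, with E0 = (0,
    L) or (0, 1), and for L = +oo its limsup part bounds [hardy_ball] off E0. *)
Lemma Phi_fin (E : set T) : condA L NX u v nu -> measurable E -> E `<=` D ->
  mu E < +oo -> Phi (ind E) < +oo.
Proof.
move=> [A1 A2] mE ED finE; have [Loo|Lfin] := eqVneq L +oo; last first.
  have Loo : L < +oo by rewrite ltey.
  have pD : mplus mu D (ind D) by exact: mplus_ind.
  have fin0 : polar mu D S0 (ind D) < +oo.
    by apply: (in_space_hardyH pD _).1 (A1 Loo) => t; exact: hardyH_ind_D.
  apply: (@ri_polar_ind_fin _ _ _ mu D mD S0 hardy_ball_mplus E D 0%R) => //.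
have [A3 A4] := A2 Loo.
have Dpos (x : R) : (0 < x)%R -> D x by move=> x0; split; rewrite ?Loo ?ltry.
have mE0 : measurable (oitv 0%R 1 : set T) := measurable_oitv _ _.
have pE0 : mplus mu D (ind (oitv 0%R 1)) by exact: mplus_ind.
have fin0 : polar mu D S0 (ind (oitv 0%R 1)) < +oo.
  by apply: (in_space_hardyH pE0 _).1 A3 => t; exact: hardyH_ind_01.
have [_ [V [t0 [_ Vt0]] <-] supV] := ereal_inf_lt A4.
set M1 := ereal_sup _ in supV.
have wM (s : R) : (t0 < s)%R -> (v s)%:E * Nu s <= M1.
  by move=> st; apply: ereal_sup_ubound; exists s => //; exact: Vt0.
pose s0 := (`|t0| + 1)%R.
have t0s0 : (t0 < s0)%R by rewrite (le_lt_trans (ler_norm _))// ltrDl.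
have s01 : (1 <= s0)%R by rewrite lerDr.
have Ds0 : D s0 by apply: Dpos; rewrite (lt_le_trans _ s01).
have D1 : D 1%R by exact: Dpos.
have M10 : 0 <= M1 by apply: le_trans (wM _ t0s0); rewrite mule_ge0// v0.
have fM1 : M1 \is a fin_num by rewrite ge0_fin_numE.
(* Positivity of [v s0] turns the finite product at s0 into a finite [Nu s0]. *)
have fNu : Nu s0 \is a fin_num.
  have H := le_lt_trans (wM _ t0s0) supV.
  rewrite (ge0_fin_numE (Nu_ge0 s0)) ltey; apply/eqP => N; move: H.
  by rewrite N gt0_muley ?lte_fin ?v_pos.
(* The first term serves on [1, s0], by monotonicity of v and Nu; the second serves beyond s0. *)
pose M := (v 1 * fine (Nu s0) + fine M1)%R.
have M0 : (0 <= M)%R by rewrite addr_ge0 ?fine_ge0// mulr_ge0 ?fine_ge0// ltW// v_pos.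
apply: (@ri_polar_ind_fin _ _ _ mu D mD S0 hardy_ball_mplus E (oitv 0%R 1) M) => //.
  by move=> x [x0 _]; exact: Dpos.
move=> _ s [g Bg <-] Ds s1; apply: (le_trans (hardyR_le Bg Ds)).
have {}s1 : (1 <= s)%R.
  by rewrite leNgt; apply/negP => s1'; apply: s1; split; [case: Ds|rewrite lte_fin].
rewrite EFinD EFinM !fineK//.
have [ss0|s0s] := leP s s0.
  apply: (@le_trans _ _ ((v 1)%:E * Nu s0)); last by rewrite leeDl.
  apply: lee_pmul; rewrite ?v0//; first by rewrite lee_fin v_le.
  exact: le_Nu.
apply: (@le_trans _ _ M1); first by apply: wM; exact: lt_trans s0s.
by rewrite leeDr// mule_ge0// v0.
Qed.

Let D_ (n : nat) : set T := D `&` oitv 0%R n%:R%:E.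

Let mD_ (n : nat) : measurable (D_ n) := @measurable_exhaust R L n.
Let finD_ (n : nat) : mu (D_ n) < +oo := @leb_exhaust R L n.
Let ndD_ : nondecreasing_seq D_ := @nondecreasing_exhaust R L.
Let D_E : D = \bigcup_n D_ n := @exhaustE R L.

Let res (f h k : T -> \bar R) (a : \bar R) := @leb_resonance R L f h k a.

Let nPhi : fnorm mu D Phi := fnorm_ri_polar mD res hardy_ball_mplus hardy_ball_neq0.

(** Duality exchanges (P4) and (P5): the bound on integrals in [Phi_int] yields (P4), and the
    finiteness in [Phi_fin] yields (P5) and definiteness. *)
Lemma ri_assoc_Phi : condA L NX u v nu -> ri_norm L (associate L Phi).
Proof.
move=> cA; have nA := fnorm_assoc mD nPhi; split.
- exact: (fn_ge0 nA).
- move=> f; apply: (assoc_ri_polar_eq0 mD mD_ D_E res hardy_ball_mplus hardy_ball_neq0).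
  by move=> n; apply: (Phi_fin cA (mD_ n)); [exact: subIsetl|exact: finD_].
- exact: (fn_scale nA).
- exact: (fn_triangle nA).
- exact: (fn_mono nA).
- exact: (fn_fatou nA).
- move=> E mE ED finE; have [C C0 HC] := Phi_int mE ED finE.
  apply: (@le_lt_trans _ _ C%:E); last exact: ltry.
  apply: (@polar_le _ _ _ mu D) => g [pg Pg]; rewrite (integral_ind _ _ ED).
  apply: (le_trans (HC _ pg)); rewrite -[leRHS]mule1 lee_wpmul2l// lee_fin.
  exact: ltW.
- move=> E mE ED finE; have PE := Phi_fin cA mE ED finE.
  have pE : mplus mu D (ind E) by exact: mplus_ind.
  have PE0 := fn_ge0 nPhi pE.
  exists (fine (Phi (ind E)) + 1)%R; first by rewrite ltr_wpDl// fine_ge0.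
  move=> f pf; rewrite -(integral_ind _ _ ED).
  apply: (holder mD nPhi pE pf); first by rewrite ltr_wpDl// fine_ge0.
  by rewrite EFinD fineK ?leeDl// ge0_fin_numE.
- by move=> f g pf pg fg; apply: (@assoc_ri_polar_equim _ _ _ mu D res S0 f g).
Qed.

Lemma second_associate_Phi f : mplus mu D f -> associate L (associate L Phi) f = Phi f.
Proof.
exact: (second_associate_ri_polar mD mD_ finD_ ndD_ D_E res hardy_ball_mplus hardy_ball_neq0).
Qed.

(** The constant in [bounded_op] carries no sign; the maximum with 1 makes it positive. *)
Lemma hardy_ball_bound NZ (c : R) : ri_norm L NZ ->
  (forall f, measurable_fun D f -> ext_norm NZ (hardyR u v nu f) <= c%:E * ext_norm NX f) ->
  forall k, S0 k -> NZ k <= (Num.max c 1)%:E.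
Proof.
move=> nZ HZ _ [g [pg Ng] <-]; have pR := mplus_hardyR pg.1.
rewrite -(ri_ext_norm nZ pR); apply: (le_trans (HZ _ pg.1)).
rewrite (ri_ext_norm NX_ri pg) -[leRHS]mule1.
have N0 := fn_ge0 nX pg.
apply: (@le_trans _ _ ((Num.max c 1)%:E * NX g)).
  by rewrite lee_wpmul2r// lee_fin le_max lexx.
by rewrite lee_wpmul2l// lee_fin le_max ler01 orbT.
Qed.

Lemma optimal_Phi NY : ri_norm L NY ->
  (forall f, mplus mu D f -> associate L NY f = Phi f) ->
  optimal_target L (hardyR u v nu) NX NY.
Proof.
move=> nY NYE; have fY := ri_fnorm nY; split => //.
- exists 1%R => f mf; rewrite mul1e.
  have mabs : measurable_fun D (fun x : T => `|f x|).
    exact: (measurableT_comp (@abse_measurable R setT) mf).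
  have pabs : mplus mu D (fun x : T => `|f x|) by split => //; exact: aeDW.
  have pR := mplus_hardyR mabs.
  rewrite -(hardyR_abs f) (ri_ext_norm nY pR) /ext_norm.
  have := fn_ge0 nX pabs; case E : (NX _) => [r||]// r0; last by rewrite leey.
  (* Normalising by r + e in place of r admits functions of norm 0. *)
  rewrite lee_fin in r0; apply/lee_addgt0Pr => e e0.
  have re0 : (0 < r + e)%R by rewrite ltr_wpDl.
  have re0' : (0 <= (r + e)^-1)%R by rewrite invr_ge0 ltW.
  have Bg : B (fun x : T => (r + e)^-1%:E * `|f x|).
    split; first exact: mplus_scale.
    rewrite (fn_scale nX re0' pabs) E lee_pdivrMl// mule1 lee_fin lerDl.
    exact: ltW.
  have S0R : S0 (hardyR u v nu (fun x : T => (r + e)^-1%:E * `|f x|)).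
    by exists (fun x : T => (r + e)^-1%:E * `|f x|).
  have := norm_le1_polar mD mD_ finD_ ndD_ D_E hardy_ball_mplus fY NYE S0R.
  (* The two functions agree on (0, L) only, so their norms are compared through (P6). *)
  have -> : NY (hardyR u v nu (fun x : T => (r + e)^-1%:E * `|f x|)) =
      NY (fun t => (r + e)^-1%:E * hardyR u v nu (fun x : T => `|f x|) t).
    apply: (ri_equi nY).
    + exact: hardy_ball_mplus S0R.
    + exact: mplus_scale.
    + apply: (equim_ae mD (hardy_ball_mplus S0R).1 (mplus_scale re0' pR).1).
      by apply: aeDW => t Dt; rewrite hardyR_scale.
  by rewrite (fn_scale fY re0' pR) lee_pdivrMl// mule1 EFinD.
- move=> NZ nZ [c Hc]; have c0 : (0 < Num.max c 1)%R by rewrite lt_max ltr01 orbT.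
  exists (Num.max c 1)%R => // f mf; rewrite /ext_norm.
  have pabs : mplus mu D (fun x : T => `|f x|).
    by split; [exact: (measurableT_comp (@abse_measurable R setT) mf)|exact: aeDW].
  apply: (norm_le_optimal mD mD_ finD_ ndD_ D_E res hardy_ball_mplus fY (ri_fnorm nZ)
    (ri_equi nZ) c0 NYE _ pabs).
  exact: hardy_ball_bound Hc.
Qed.

(** * Necessity of condition (A) *)

Section necessity.
Variables (NZ : (T -> \bar R) -> \bar R) (M : R).
Hypotheses (NZ_ri : ri_norm L NZ) (M0 : (0 < M)%R)
  (ball_le : forall k, S0 k -> NZ k <= M%:E).

Let polar_ind_fin (E : set T) : measurable E -> E `<=` D -> mu E < +oo ->
  polar mu D S0 (ind E) < +oo.
Proof.
move=> mE ED finE; have [C C0 HC] := ri_int NZ_ri mE ED finE.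
apply: (@le_lt_trans _ _ (C%:E * M%:E)); last by rewrite -EFinM ltry.
apply: polar_le => k S0k; rewrite (integral_ind _ _ ED).
apply: (le_trans (HC _ (hardy_ball_mplus S0k))).
by rewrite lee_wpmul2l ?ball_le// lee_fin ltW.
Qed.

Section infinite.
Hypothesis Loo : L = +oo.

Let Dpos (x : R) : (0 < x)%R -> D x.
Proof. by move=> x0; split; rewrite ?Loo ?ltry. Qed.

Let subD (a : R) (b : \bar R) : (0 <= a)%R -> (oitv a b : set T) `<=` D.
Proof. by move=> a0 x [ax _]; apply: Dpos; exact: le_lt_trans ax. Qed.

Let leb_oitv1 (a : R) : mu (oitv a (a + 1)%:E) = 1.
Proof. by rewrite [LHS]leb_oitv ?lerDl// addrAC subrr add0r. Qed.

(** (P5) gives a constant for the interval (0, 1); by resonance and (P6) it serves for every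
    interval of length 1, which is the uniformity needed at infinity. *)
Let ball_integral : exists2 C : R, (0 < C)%R & forall (a : R) k, (0 <= a)%R -> S0 k ->
  \int[mu]_(s in oitv a (a + 1)%:E) k s <= C%:E.
Proof.
have mE (a : R) : measurable (oitv a (a + 1)%:E : set T) by exact: measurable_oitv.
have sE (a : R) : (0 <= a)%R -> (oitv a (a + 1)%:E : set T) `<=` D.
  by move=> a0; exact: subD.
have fE : mu (oitv 0%R (0 + 1)%:E) < +oo by rewrite leb_oitv1 ltry.
have [C C0 HC] := ri_int NZ_ri (mE 0%R) (sE _ (lexx _)) fE.
exists (C * M)%R; first by rewrite mulr_gt0.
move=> a k a0 S0k; have pk := hardy_ball_mplus S0k.
rewrite leNgt; apply/negP => lt_k.
have muE : mu (oitv a (a + 1)%:E) = mu (oitv 0%R (0 + 1)%:E) by rewrite !leb_oitv1.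
have [k' [pk' k'k]] := integral_ind_swap res (mE a) (sE _ a0) (mE 0%R)
  (sE _ (lexx _)) muE pk lt_k.
apply/negP; rewrite -leNgt; apply: (le_trans (HC _ pk')).
rewrite (ri_equi NZ_ri pk' pk k'k) EFinM lee_wpmul2l ?ball_le// lee_fin.
exact: ltW.
Qed.

Let int_gu (s : R) g : D s -> B g ->
  \int[mu]_(t in oitv 0%R (nu s)%:E) (`|g t| * (u t)%:E) <= Nu s.
Proof.
move=> Ds Bg; rewrite -(int_uchi Ds (pB Bg)) NuE.
by apply: le_polar.
Qed.

Let mgu g : B g -> measurable_fun D (fun t : T => `|g t| * (u t)%:E).
Proof.
move=> Bg; apply: emeasurable_funM; last exact: measurable_u.
exact: (measurableT_comp (@abse_measurable R setT) (pB Bg).1).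
Qed.

Let gu0 g (t : T) : D t -> 0 <= `|g t| * (u t)%:E.
Proof. by move=> Dt; apply: mule_ge0; [exact: abse_ge0|exact: u0]. Qed.

(** On (s, s + 1) the function [hardyR g] is at least [v t] times the integral over (0, nu s), and
    this interval has length 1. *)
Let Nu_le (C : R) (s t : R) : (0 < s)%R -> (s + 1 <= t)%R ->
  (forall k, S0 k -> \int[mu]_(x in oitv s (s + 1)%:E) k x <= C%:E) ->
  (v t)%:E * Nu s <= C%:E.
Proof.
move=> s0 st HC; have Ds := Dpos s0.
have t0 : (0 < t)%R by apply: lt_le_trans st; rewrite addr_gt0.
have Dt := Dpos t0; have vt0 := v_pos Dt.
rewrite -lee_pdivlMl// NuE; apply: polar_le => g Bg.
rewrite lee_pdivlMl// (int_uchi Ds (pB Bg)).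
set y := \int[mu]_(_ in _) _.
have S0R : S0 (hardyR u v nu g) by exists g.
apply: le_trans (HC _ S0R).
have -> : (v t)%:E * y = \int[mu]_(x in oitv s (s + 1)%:E) (cst ((v t)%:E * y)) x.
  rewrite integral_cst; last exact: measurable_oitv.
  by rewrite -[LHS]mule1; congr (_ * _); exact/esym/leb_oitv1.
have y0 : 0 <= y.
  by apply: integral_ge0 => x /(oitv_nu_sub Ds); exact: gu0.
apply: ge0_le_integral.
- exact: measurable_oitv.
- by move=> x _; apply: mule_ge0 => //; exact: v0.
- exact: measurable_cst.
- exact: (measurable_funS mD (subD (ltW s0)) (hardy_ball_mplus S0R).1).
move=> x [sx xs1]; have Dx : D x by apply: Dpos; exact: lt_trans sx.
apply: lee_pmul; [exact: v0|exact: y0| |].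
  rewrite lee_fin v_le//; apply: le_trans st.
  by apply: ltW; rewrite -lte_fin.
apply: ge0_subset_integral.
- exact: measurable_oitv.
- exact: measurable_oitv.
- exact: (measurable_funS mD (oitv_nu_sub Dx) (mgu Bg)).
- by move=> z /(oitv_nu_sub Dx); exact: gu0.
- move=> z [z0 zs]; split => //; apply: (lt_le_trans zs).
  by rewrite lee_fin nu_le// ltW.
Qed.

(* Since u is nonincreasing, moving the values of g from A to (0, r), where u is
   larger, can only increase the integral. *)
Let int_gu_shift (r : R) (A : set T) (Q : \bar R) g : (0 < r)%R -> measurable A ->
  A `<=` D -> mu A = r%:E -> (forall x, A x -> (r <= x)%R) -> B g ->
  (forall g, B g -> \int[mu]_(t in oitv 0%R r%:E) (`|g t| * (u t)%:E) <= Q) ->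
  \int[mu]_(t in A) (`|g t| * (u t)%:E) <= Q.
Proof.
move=> r0 mA AD muA rA Bg HQ; have Dr := Dpos r0; have ur := u_pos Dr.
have pg := pB Bg; have [_ Ng] := Bg.
have mabs : measurable_fun D (fun x : T => `|g x|).
  exact: (measurableT_comp (@abse_measurable R setT) pg.1).
have pabs : mplus mu D (fun x : T => `|g x|) by split => //; exact: aeDW.
have m0r : measurable (oitv 0%R r%:E : set T) by exact: measurable_oitv.
have s0r : (oitv 0%R r%:E : set T) `<=` D by exact: subD.
have mu0r : mu A = mu (oitv 0%R r%:E).
  by rewrite muA [RHS]leb_oitv ?subr0// ltW.
apply: (@le_trans _ _ ((u r)%:E * \int[mu]_(t in A) `|g t|)).
  rewrite -ge0_integralZl_EFin; [|exact: mA|by move=> x _; exact: abse_ge0| |exact: ltW].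
    apply: ge0_le_integral.
    - exact: mA.
    - by move=> x /AD; exact: gu0.
    - exact: (measurable_funS mD AD (mgu Bg)).
    - by apply: measurable_funeM; exact: (measurable_funS mD AD mabs).
    - move=> x Ax; rewrite muleC lee_wpmul2r// lee_fin u_le//; first exact: AD.
      exact: rA.
  exact: (measurable_funS mD AD mabs).
rewrite -lee_pdivlMl// leNgt; apply/negP.
move=> /(integral_ind_swap res mA AD m0r s0r mu0r pabs)[g' [pg' g'g]].
apply/negP; rewrite -leNgt lee_pdivlMl//.
have Bg' : B g'.
  split => //; rewrite (ri_equi NX_ri pg' pabs g'g).
  by have := ri_ext_norm NX_ri pg; rewrite /ext_norm => ->.
apply: le_trans (HQ _ Bg').
have mg' : measurable_fun (oitv 0%R r%:E : set T) g' by exact: (measurable_funS mD s0r pg'.1).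
have mag' : measurable_fun (oitv 0%R r%:E : set T) (fun x : T => `|g' x|).
  exact: (measurableT_comp (@abse_measurable R setT) mg').
have le1 : \int[mu]_(t in oitv 0%R r%:E) g' t <= \int[mu]_(t in oitv 0%R r%:E) `|g' t|.
  apply: le_trans (le_abse_integral mu m0r mg'); exact: lee_abs.
apply: (@le_trans _ _ ((u r)%:E * \int[mu]_(t in oitv 0%R r%:E) `|g' t|)).
  by rewrite lee_wpmul2l// lee_fin ltW.
rewrite -ge0_integralZl_EFin; [|exact: m0r|by move=> x _; exact: abse_ge0|exact: mag'|exact: ltW].
apply: ge0_le_integral.
- exact: m0r.
- by move=> x _; apply: mule_ge0; [rewrite lee_fin ltW|exact: abse_ge0].
- exact: measurable_funeM.
- exact: (measurable_funS mD s0r (mgu Bg')).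
- move=> x [x0 xr]; rewrite muleC lee_wpmul2l// lee_fin u_le//; first exact: Dpos.
  by apply: ltW; rewrite -lte_fin.
Qed.

(** The interval is cut into n pieces of length r, and each piece contributes at most Q by the shift
    to (0, r). *)
Let int_gu_multiple (r : R) (Q : \bar R) (n : nat) g : (0 < r)%R -> 0 <= Q -> B g ->
  (forall g, B g -> \int[mu]_(t in oitv 0%R r%:E) (`|g t| * (u t)%:E) <= Q) ->
  \int[mu]_(t in oitv 0%R (n%:R * r)%:E) (`|g t| * (u t)%:E) <= n%:R%:E * Q.
Proof.
move=> r0 Q0 Bg HQ; elim: n => [|n IH].
  rewrite mul0r mul0e (_ : oitv _ _ = set0) ?integral_set0//.
  by apply/seteqP; split => // x [x0]; rewrite lte_fin => /(lt_trans x0); rewrite ltxx.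
pose A : set T := oitv 0%R (n.+1%:R * r)%:E `\` oitv 0%R (n%:R * r)%:E.
have mo (b : \bar R) : measurable (oitv 0%R b : set T) by exact: measurable_oitv.
have mA : measurable A by exact: measurableD.
have so (b : \bar R) : (oitv 0%R b : set T) `<=` D by exact: subD.
have AD : A `<=` D by move=> x [/so].
have nr0 : (0 <= n%:R * r)%R by rewrite mulr_ge0// ltW.
have nr1 : (n%:R * r <= n.+1%:R * r)%R by rewrite ler_wpM2r ?ler_nat// ltW.
have sub : (oitv 0%R (n%:R * r)%:E : set T) `<=` oitv 0%R (n.+1%:R * r)%:E.
  by move=> x [x0 xn]; split => //; apply: (lt_le_trans xn); rewrite lee_fin.
have muA : mu A = r%:E.
  have H : mu (oitv 0%R (n.+1%:R * r)%:E) = mu (oitv 0%R (n%:R * r)%:E) + mu A.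
    by rewrite -measureU//; [rewrite setDUK|rewrite setDIK].
  move: H; rewrite [X in X = _]leb_oitv; last exact: le_trans nr1.
  rewrite [X in _ = X + _]leb_oitv// !subr0 -natr1 mulrDl mul1r EFinD.
  by case: (mu A) => [x||]//; rewrite -!EFinD => -[] /addrI ->.
have -> : oitv 0%R (n.+1%:R * r)%:E = oitv 0%R (n%:R * r)%:E `|` A :> set T.
  by rewrite setDUK.
rewrite ge0_integral_setU; [|exact: mo|exact: mA| | |]; last first.
- by rewrite disj_set2E setDIK.
- by move=> x [/so|/AD]; exact: gu0.
- by apply: (measurable_funS mD _ (mgu Bg)) => x [/so|/AD].
rewrite -natr1 EFinD ge0_muleDl ?lee_fin// mul1e; apply: leeD => //.
(* The first piece is (0, r) itself, where the condition r <= x of the shift fails and the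
   hypothesis applies directly. *)
have [n0|n0] := eqVneq n 0%N.
  apply: le_trans (HQ _ Bg); apply: ge0_subset_integral.
  - exact: mA.
  - exact: mo.
  - exact: (measurable_funS mD (so _) (mgu Bg)).
  - by move=> x /so; exact: gu0.
  - by rewrite /A n0 mul1r; exact: subDsetl.
apply: (int_gu_shift r0 mA AD muA _ Bg HQ) => x [[x0 _] nx].
have nrx : (n%:R * r <= x)%R.
  by rewrite leNgt; apply/negP => xn; apply: nx; split => //; rewrite lte_fin.
by apply: le_trans nrx; rewrite ler_peMl ?ler1n ?lt0n// ltW.
Qed.

(* hardyR g dominates v t * (integral of |g| u over (0, nu (t / c))) on
   (t / c, t), an interval of length at least 1 for large t. *)
Lemma limsup_Nu : lowerDinfty (invL L nu) ->
  limf_esup (fun tau : R => (v tau)%:E * Nu tau) (pinfty_nbhs R) < +oo.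
Proof.
move=> [th th1 liminf1].
have [c [t0 [c1 Hc]]] : exists c t0 : R, (1 < c)%R /\ forall t, (t0 < t)%R ->
    (c <= invL L nu (th * t) / invL L nu t)%R.
  (* The lower limit is minus the upper limit of the opposite quotients. Their supremum s near
     infinity is below -1, and c is - s. *)
  move: liminf1; rewrite /limf_einf lteNr => /ereal_inf_lt[_ [V [t0 [_ Vt0]] <-]].
  set s := ereal_sup _ => s1.
  have fs (t : R) : (t0 < t)%R -> (- (invL L nu (th * t) / invL L nu t))%:E <= s.
    by move=> tt; apply: ereal_sup_ubound; exists t; [exact: Vt0|].
  case: s s1 fs => [s||]// s1 fs.
    exists (- s)%R, t0; split; first by rewrite ltrNr -lte_fin.
    by move=> t tt; have := fs t tt; rewrite lee_fin lerNl.
  have t01 : (t0 < t0 + 1)%R by rewrite ltrDl.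
  by have := fs _ t01.
have c0 : (0 < c)%R by exact: lt_trans c1.
have [C C0 HC] := ball_integral.
pose y0 := (`|t0| + 1)%R; have y00 : (0 < y0)%R by rewrite ltr_wpDl.
have t0y0 : (t0 < y0)%R by rewrite (le_lt_trans (ler_norm _))// ltrDl.
pose p := invL L nu y0; have p0 : (0 < p)%R by case: (invD (Dpos y00)).
pose n := Num.bound th.
have thn : (th <= n%:R)%R by rewrite ltW// archi_boundP// ltW// (lt_trans _ th1).
(* For t > tau0 the first term gives t / c > p, so that nu (t / c) > y0 > t0 and [Hc] applies there;
   the second gives t - t / c >= 1, as [Nu_le] requires. *)
pose tau0 := (c * p + c / (c - 1))%R.
have c10 : (0 < c - 1)%R by rewrite subr_gt0.
have bound (t : R) : (tau0 < t)%R -> (v t)%:E * Nu t <= (n%:R * C)%:E.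
  move=> tt; pose t' := (t / c)%R.
  have cp0 : (0 < c * p)%R by rewrite mulr_gt0.
  have cc0 : (0 < c / (c - 1))%R by rewrite divr_gt0.
  have t_gt0 : (0 < t)%R by rewrite (lt_trans _ tt)// addr_gt0.
  have t'0 : (0 < t')%R by rewrite divr_gt0.
  have Dt := Dpos t_gt0; have Dt' := Dpos t'0.
  have tE : (t = c * t')%R by rewrite /t' mulrC divfK// gt_eqF.
  have pt' : (p < t')%R.
    by rewrite /t' ltr_pdivlMr// mulrC (lt_trans _ tt)// ltrDl.
  have t'1 : (t' + 1 <= t)%R.
    have : (c / (c - 1) <= t)%R by rewrite ltW// (lt_trans _ tt)// ltrDr.
    by rewrite ler_pdivrMr// tE; nra.
  have r0 : (0 < nu t')%R by case: (nuD Dt').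
  have y0r : (y0 < nu t')%R by rewrite lt_nu//; exact: Dpos.
  (* At the point nu t' the growth condition says that t = c t' is at most the inverse image of th *
     nu t'; applying nu gives nu t <= th * nu t'. *)
  have := Hc _ (lt_trans t0y0 y0r); rewrite inv_nuK// ler_pdivlMr// -tE => le_t.
  have Dthr : D (th * nu t')%R by apply: Dpos; rewrite mulr_gt0// (lt_trans _ th1).
  have nu_t : (nu t <= n%:R * nu t')%R.
    have := nu_le Dt (invD Dthr) le_t; rewrite nu_invK// => /le_trans; apply.
    by rewrite ler_wpM2r// ltW.
  have NuN : Nu t <= n%:R%:E * Nu t'.
    rewrite NuE; apply: polar_le => g Bg; rewrite (int_uchi Dt (pB Bg)).
    apply: (le_trans _ (int_gu_multiple n r0 (Nu_ge0 t') Bg (fun g Bg => int_gu Dt' Bg))).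
    have Dn : D (n%:R * nu t')%R.
      by apply: Dpos; apply: lt_le_trans nu_t; case: (nuD Dt).
    apply: ge0_subset_integral.
    - exact: measurable_oitv.
    - exact: measurable_oitv.
    - exact: (measurable_funS mD (subD (lexx _)) (mgu Bg)).
    - by move=> x [x0 _]; apply: gu0; exact: Dpos.
    - by move=> x [x0 xn]; split => //; apply: (lt_le_trans xn); rewrite lee_fin.
  apply: (@le_trans _ _ ((v t)%:E * (n%:R%:E * Nu t'))).
    by apply: lee_wpmul2l => //; exact: v0.
  rewrite muleCA EFinM; apply: lee_wpmul2l; first by rewrite lee_fin.
  by apply: (Nu_le t'0 t'1) => k S0k; apply: HC => //; exact: ltW.
apply: (@le_lt_trans _ _ (n%:R * C)%:E); last by rewrite ltry.
apply: (@le_trans _ _ (ereal_sup ((fun tau : R => (v tau)%:E * Nu tau) @` [set t | (tau0 < t)%R]))).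
  apply: ereal_inf_lbound; exists [set t | (tau0 < t)%R] => //.
  by exists tau0; split => //; exact: num_real.
by apply: ge_ereal_sup => _ [t tt <-]; exact: bound.
Qed.

End infinite.

Lemma condA_necessary : (L = +oo -> lowerDinfty (invL L nu)) -> condA L NX u v nu.
Proof.
move=> HL; split=> Loo.
  have pD : mplus mu D (ind D) by exact: mplus_ind.
  apply: (in_space_hardyH pD (fun t => @hardyH_ind_D t Loo)).2.
  apply: polar_ind_fin => //; move: Loo L_gt0.
  by case: (L) => [l||]// _ _; apply: (@leb_oitv_fin _ _ l); [exact: measurable_oitv|].
have pE : mplus mu D (ind (oitv 0%R 1)) by apply: mplus_ind; exact: measurable_oitv.
split; last exact: limsup_Nu (HL Loo).
apply: (in_space_hardyH pE (fun t => @hardyH_ind_01 t Loo)).2.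
apply: polar_ind_fin; first exact: measurable_oitv.
  by move=> x [x0 _]; split; rewrite ?Loo ?ltry.
by apply: (@leb_oitv_fin _ _ 1%R); [exact: measurable_oitv|].
Qed.

End necessity.
End target.
End hardy.

Theorem proposition3p7 (R : realType) (L : \bar R)
    (NX : (R -> \bar R) -> \bar R) (nu u v : R -> R)
    (L_gt0 : (0 < L)%E)
    (NX_ri : ri_norm L NX)
    (nu_bij : set_bij (oitv 0 L) (oitv 0 L) nu)
    (nu_incr : {in oitv 0 L &, {homo nu : x y / x < y}})
    (nu_Dinfty : L = +oo%E -> lowerDinfty (invL L nu))
    (u_gt0 : {in oitv 0 L, forall x, 0 < u x})
    (v_gt0 : {in oitv 0 L, forall x, 0 < v x})
    (u_nincr : {in oitv 0 L &, {homo u : x y /~ x <= y}})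
    (v_nincr : {in oitv 0 L &, {homo v : x y /~ x <= y}})
    (v_left : (L < +oo)%E -> 0 < lim (v x @[x --> (fine L)^'-])) :
  (condA L NX u v nu ->
    (exists NY : (R -> \bar R) -> \bar R, ri_norm L NY /\
      (forall f, measplus L f -> associate L NY f = hardyY' L NX u v nu f)) /\
    (forall NY : (R -> \bar R) -> \bar R, ri_norm L NY ->
      (forall f, measplus L f -> associate L NY f = hardyY' L NX u v nu f) ->
      optimal_target L (hardyR u v nu) NX NY)) /\
  (~ condA L NX u v nu ->
    ~ exists NZ : (R -> \bar R) -> \bar R,
        ri_norm L NZ /\ bounded_op L (hardyR u v nu) NX NZ).
Proof.
split=> [cA|ncA]; last first.
  move=> [NZ [nZ [c Hc]]]; apply: ncA.
  apply: (condA_necessary nu_bij nu_incr u_gt0 v_gt0 u_nincr v_nincr NX_ri L_gt0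
    nZ (M := Num.max c 1)) nu_Dinfty.
    by rewrite lt_max ltr01 orbT.
  exact: hardy_ball_bound Hc.
have hE := hardyY'E nu_bij nu_incr u_gt0 v_gt0 u_nincr v_nincr NX.
split=> [|NY nY NYE]; last first.
  apply: (optimal_Phi nu_bij nu_incr u_gt0 v_gt0 u_nincr v_nincr NX_ri nY) => f pf.
  by apply: etrans (hE f); exact: (NYE f pf).
(* The witness is the associate of the polar; its own associate is the polar again, by the second
   associate theorem. *)
exists (associate L (ri_polar leb (oitv 0 L : set (lebesgueType R))
  (hardy_ball L nu u v NX))).
split; first exact: (ri_assoc_Phi nu_bij nu_incr u_gt0 v_gt0 u_nincr v_nincr NX_ri).
move=> f pf; apply: etrans (esym (hE f)).
exact: (second_associate_Phi nu_bij nu_incr u_gt0 v_gt0 u_nincr v_nincr NX_ri).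
Qed.
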